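(* Let $\mathcal V_{3,2}\subset\mathbb P(S^3\mathbb C^3)\cong\mathbb P^9_{\mathbb C}$ be the third Veronese surface, and let $Q_F$ be a Frobenius inner product on $S^3\mathbb R^3$. Then $$\min_{Q}\ \mathrm{EDdegree}_Q(\mathcal V_{3,2})=\mathrm{EDdegree}_{Q_F}(\mathcal V_{3,2})=7,$$ where the minimum is over all inner products $Q$ on $S^3\mathbb R^3$.
   Context: $\mathcal V_{3,2}$ is the image of $\mathbb P(\mathbb C^3)\to\mathbb P(S^3\mathbb C^3)$, $x\mapsto x^3$. Inner product means positive definite symmetric bilinear form, extended complex bilinearly to $W=S^3\mathbb C^3$. A Frobenius inner product on $S^3\mathbb R^3$ is one determined by $Q_F(x^3,y^3)=Q_1(x,y)^3$, extended by linearity, for some inner product $Q_1$ on $\mathbb R^3$. For a projective variety $X\subset\mathbb P(W)$ with affine cone $CX\subset W$, $\mathrm{EDdegree}_Q(X)$ is the number, for a general $u\in W$, of points $x\in(CX)_{\mathrm{sm}}$ with $Q(u-x,v)=0$ for all $v\in T_xCX$, i.e. of complex critical points of $x\mapsto Q(u-x,u-x)$ on $(CX)_{\mathrm{sm}}$. *)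

(* Defs.v *)
From HB Require Import structures.
From mathcomp Require Import all_boot all_order all_algebra.
From mathcomp Require Import boolp classical_sets functions cardinality.
From mathcomp Require Import reals complex.
From mathcomp Require Import mpoly.

Set Implicit Arguments.
Unset Strict Implicit.
Unset Printing Implicit Defensive.

Import Order.TTheory GRing.Theory Num.Theory.
Local Open Scope ring_scope.
Local Open Scope classical_set_scope.
Local Open Scope card_scope.

Section AffineGeometry.
Variables (F : fieldType) (W : vectType F).

Definition coords (w : W) : 'I_(\dim {:W}) -> F :=
  fun i => coord (vbasis {:W}) i w.

(* Polynomial functions on W; none of the notions below depends on the basis
   used to write them as polynomials. *)
Definition polyfun := {mpoly F[\dim {:W}]}.

Definition pval (p : polyfun) (w : W) : F := p.@[coords w].

Definition pdiff (p : polyfun) (w v : W) : F :=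
  \sum_i pval p^`M(i) w * coords v i.

Definition vanishing_ideal (Z : set W) : set polyfun :=
  [set p | forall w, Z w -> pval p w = 0].

(* Zariski tangent space, translated to the origin. *)
Definition tangent (Z : set W) (x : W) : set W :=
  [set v | forall p, vanishing_ideal Z p -> pdiff p x v = 0].

Definition tangent_dim (Z : set W) (x : W) (k : nat) : Prop :=
  exists2 T : {vspace W}, [set` T] = tangent Z x & \dim T = k.

Definition alg_independent_on (Z : set W) (k : nat) (f : 'I_k -> polyfun) :=
  forall P : {mpoly F[k]},
    (forall w, Z w -> P.@[fun i => pval (f i) w] = 0) -> P = 0.

(* dim Z = k: the largest number of polynomial functions algebraically
   independent on Z, i.e. the transcendence degree over F of the function
   field of Z when Z is irreducible. *)
Definition has_dim (Z : set W) (k : nat) : Prop :=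
  (exists f : 'I_k -> polyfun, alg_independent_on Z f) /\
  (forall m (f : 'I_m -> polyfun), alg_independent_on Z f -> (m <= k)%N).

(* For Z irreducible, as are cones over irreducible projective varieties:
   x is smooth iff dim T_x Z = dim Z. *)
Definition smooth_locus (Z : set W) : set W :=
  [set x | Z x /\ exists2 k, has_dim Z k & tangent_dim Z x k].

(* A subset of P(W) is a set of one-dimensional subspaces of W. *)
Definition affine_cone (X : set {vspace W}) : set W :=
  [set w | exists2 L, X L & w \in L].

Definition ED_critical (Q : W -> W -> F) (X : set {vspace W}) (u : W) : set W :=
  [set x | smooth_locus (affine_cone X) x /\
     forall v, tangent (affine_cone X) x v -> Q (u - x) v = 0].

(* P holds on the complement of a proper hypersurface. *)
Definition for_general (P : W -> Prop) : Prop :=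
  exists2 g : polyfun, g != 0 & forall u, pval g u != 0 -> P u.

(* There is at most one such k if F is infinite. *)
Definition has_EDdegree (Q : W -> W -> F) (X : set {vspace W}) (k : nat) :=
  for_general (fun u => ED_critical Q X u #= `I_k).

(* The default value 0 is used only if no generic count exists. *)
Definition EDdegree (Q : W -> W -> F) (X : set {vspace W}) : nat :=
  xget 0%N [set k | has_EDdegree Q X k].

End AffineGeometry.

Section SymmetricPowers.
Variables (F : fieldType) (d n : nat).

(* S^d F^(n+1): the forms of degree d in n+1 variables, the vector x of
   F^(n+1) being identified with the linear form \sum_i x_i 'X_i. *)
Definition Sym : vectType F := dhomog n.+1 F d.

Definition linform (x : 'rV[F]_n.+1) : {mpoly F[n.+1]} :=
  \sum_i x ord0 i *: 'X_i.

Lemma linform_homog x : linform x \is 1.-homog.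
Proof. by apply: rpred_sum => i _; rewrite rpredZ// dhomogX /= mdeg1. Qed.

Lemma power_homog x : linform x ^+ d \is d.-homog.
Proof. by rewrite -{2}[d]mul1n; apply/dhomogMn/linform_homog. Qed.

Definition power (x : 'rV[F]_n.+1) : Sym := DHomog (power_homog x).

(* V_(d,n): the image of P(F^(n+1)) -> P(S^d F^(n+1)), [x] |-> [x^d]. *)
Definition veronese : set {vspace Sym} :=
  [set L | exists2 x : 'rV[F]_n.+1, x != 0 & L = <[power x]>%VS].

End SymmetricPowers.

(* A real inner product on V: a symmetric ([idfun]-hermitian) positive definite
   bilinear form. *)
Notation inner_product V := {dot V for idfun}.

Arguments veronese : clear implicits.

Section InnerProducts.
Variables (R : realType) (d n : nat).

(* Complex bilinear extension of Q, expanded in the monomials of degree d;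
   the other monomials of the range have coefficient 0 in u and v. *)
Definition complexify (Q : Sym R d n -> Sym R d n -> R)
    (u v : Sym R[i] d n) : R[i] :=
  \sum_(a : 'X_{1..n.+1 < d.+1}) \sum_(b : 'X_{1..n.+1 < d.+1})
    (u : dhomog _ _ _)@_a * (v : dhomog _ _ _)@_b
      * (Q (indhomog d 'X_[a]) (indhomog d 'X_[b]))%:C%C.

Definition Frobenius (Q : Sym R d n -> Sym R d n -> R) : Prop :=
  exists Q1 : inner_product 'rV[R]_n.+1,
    forall x y, Q (power d x) (power d y) = Q1 x y ^+ d.

End InnerProducts.

Definition is_min (A : set nat) (m : nat) : Prop := A m /\ lbound A m.

(* Main.v *)
From HB Require Import structures.
From mathcomp Require Import all_boot all_order all_algebra.
From mathcomp Require Import boolp classical_sets cardinality.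
From mathcomp Require Import reals complex.
From mathcomp Require Import mpoly.
From mathcomp Require Import closed_field.
From mathcomp Require Import topology normedtype.
From mathcomp Require derive.
From mathcomp Require Import ring lra zify.
Require Import Defs.

(** Let U(a, b, c) = Q(u, a b c), a symmetric trilinear form, and let
    q(a) = Q(a ^ 3, a ^ 3). The tangent space of the cone over the Veronese surface
    at a ^ 3, with a <> 0, consists of the cubics a ^ 2 b (tangent_coneE), and 0 is
    a singular point. So the critical points of u are the cubes a ^ 3 with a <> 0 and

      U(a, a, b) = Q(a ^ 3, a ^ 2 b) for all b,

    which says that a is a critical point of q(a) - 2 U(a, a, a). As Q is
    nondegenerate, U is an arbitrary symmetric tensor, given by ten parameters.

    A generic count exists for every Q. In a chart of the cone the equations
    allow three of the ten parameters to be eliminated, so pairs of a parameter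
    and a solution depend on ten numbers, and a solution is algebraic over its
    parameter; this bounds the generic number of solutions (bounded_solutions).
    Having at least N solutions is a first-order property, hence generically
    true or generically false by quantifier elimination (atleast_generic). So
    some exact number k is generic (exact_count), and it is the ED degree.

    Always k >= 7. It suffices to find real cubics with seven real solutions off
    any given hypersurface, and they are found near x y z (at_least_seven). In
    each of the four octants with x y z > 0 the function q(a) - 2 U(a, a, a) has an
    interior minimum: it is negative at some small vectors, nonnegative on the
    walls and positive far out (octant_solution). Near each coordinate axis, a
    node of x y z = 0, the gradients of the cubic and of q are proportional at
    some direction, by an implicit function theorem, and rescaling gives three
    more solutions (saddle_direction, seven_real_solutions). All this holds for
    every positive definite Q and survives small perturbations of x y z.

    For a Frobenius Q, with Q1 of matrix A and s(a) = Q1(a, a), the equations are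
    U(a, a, -) = s(a) ^ 2 A a. The cubic of a general U is smooth, so s(a) <> 0, and
    y = a / s(a) ^ 2 is a nonzero solution of U(y, y, -) = A y. This system of three
    quadrics has at most eight solutions, one of them y = 0: for the Fermat cubic,
    where U(y, y, e_k) = y_k ^ 2, and then for a general U, the equations reduce
    every monomial of degree at most eight to the eight squarefree ones, and these
    cannot separate nine points (at_most_eight). Hence k <= 7
    (frobenius_at_most_seven). *)

Set Implicit Arguments.
Unset Strict Implicit.
Unset Printing Implicit Defensive.

Import Order.TTheory GRing.Theory Num.Theory.
Import numFieldNormedType.Exports.
Local Open Scope ring_scope.
Local Open Scope classical_set_scope.

(** * Polynomial functions and algebraic dependence *)

Section PolyIn.
Variables (F : comNzRingType) (T : Type) (n : nat) (x : 'I_n -> T -> F).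

(** The generators are arbitrary functions on T, so that polynomiality can be
    transported along parametrizations. *)
Definition poly_in (f : T -> F) : Prop :=
  exists p : {mpoly F[n]}, forall t, f t = p.@[fun i => x i t].

Lemma poly_in_ext f g : f =1 g -> poly_in f -> poly_in g.
Proof. by move=> fg [p Hp]; exists p => t; rewrite -fg. Qed.

Lemma poly_in_gen i : poly_in (x i).
Proof. by exists 'X_i => t; rewrite mevalXU. Qed.

Lemma poly_in_cst c : poly_in (fun=> c).
Proof. by exists c%:MP => t; rewrite mevalC. Qed.

Lemma poly_inD f g : poly_in f -> poly_in g -> poly_in (fun t => f t + g t).
Proof. by move=> [p Hp] [q Hq]; exists (p + q) => t; rewrite mevalD Hp Hq. Qed.

Lemma poly_inN f : poly_in f -> poly_in (fun t => - f t).
Proof. by move=> [p Hp]; exists (- p) => t; rewrite mevalN Hp. Qed.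

Lemma poly_inB f g : poly_in f -> poly_in g -> poly_in (fun t => f t - g t).
Proof. by move=> Hf Hg; apply: poly_inD => //; apply: poly_inN. Qed.

Lemma poly_inM f g : poly_in f -> poly_in g -> poly_in (fun t => f t * g t).
Proof. by move=> [p Hp] [q Hq]; exists (p * q) => t; rewrite mevalM Hp Hq. Qed.

Lemma poly_inX f k : poly_in f -> poly_in (fun t => f t ^+ k).
Proof. by move=> [p Hp]; exists (p ^+ k) => t; rewrite rmorphXn /= Hp. Qed.

Lemma poly_in_sum I (r : seq I) (P : pred I) (f : I -> T -> F) :
  (forall i, P i -> poly_in (f i)) -> poly_in (fun t => \sum_(i <- r | P i) f i t).
Proof.
move=> Hf; elim: r => [|i r IH].
  by apply: (poly_in_ext _ (poly_in_cst 0)) => t; rewrite big_nil.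
case Pi: (P i).
  by apply: (poly_in_ext _ (poly_inD (Hf _ Pi) IH)) => t; rewrite big_cons Pi.
by apply: (poly_in_ext _ IH) => t; rewrite big_cons Pi.
Qed.

Lemma poly_in_prod I (r : seq I) (P : pred I) (f : I -> T -> F) :
  (forall i, P i -> poly_in (f i)) -> poly_in (fun t => \prod_(i <- r | P i) f i t).
Proof.
move=> Hf; elim: r => [|i r IH].
  by apply: (poly_in_ext _ (poly_in_cst 1)) => t; rewrite big_nil.
case Pi: (P i).
  by apply: (poly_in_ext _ (poly_inM (Hf _ Pi) IH)) => t; rewrite big_cons Pi.
by apply: (poly_in_ext _ IH) => t; rewrite big_cons Pi.
Qed.

End PolyIn.

Lemma poly_in_trans (F : comNzRingType) (T : Type) n m
    (x : 'I_n -> T -> F) (y : 'I_m -> T -> F) (f : T -> F) :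
  (forall i, poly_in y (x i)) -> poly_in x f -> poly_in y f.
Proof.
move=> Hx [p Hp]; apply: (poly_in_ext (fun t => esym (Hp t))).
apply: (@poly_in_ext _ _ _ _
  (fun t => \sum_(m <- msupp p) p@_m * \prod_i x i t ^+ m i)).
  by move=> t; rewrite mevalE.
apply: poly_in_sum => k _; apply: poly_inM; first exact: poly_in_cst.
by apply: poly_in_prod => i _; apply: poly_inX.
Qed.

Lemma poly_in_comp (F : comNzRingType) (S T : Type) n
    (x : 'I_n -> T -> F) (h : S -> T) (f : T -> F) :
  poly_in x f -> poly_in (fun i s => x i (h s)) (fun s => f (h s)).
Proof. by move=> [p Hp]; exists p => s; rewrite Hp. Qed.

(** The chain rule along the curve g: the derivative of a polynomial on a curve
    is expressed by its partial derivatives. *)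
Lemma deriv_mmap (F : comNzRingType) n (p : {mpoly F[n]}) (g : 'I_n -> {poly F}) :
  (mmap polyC g p)^`() = \sum_i mmap polyC g p^`M(i) * (g i)^`().
Proof.
elim/mpolyind: p => [|c m p _ _ IH].
  rewrite mmap0 derivC big1 // => i _; by rewrite mderiv0 mmap0 mul0r.
rewrite mmapD derivD IH; under [RHS]eq_bigr do rewrite mderivD mmapD mulrDl.
rewrite big_split /=; congr (_ + _) => {p IH}.
rewrite mmapZ mmapX mul_polyC derivZ -mul_polyC.
under eq_bigr do rewrite mderivZ mmapZ -mulrA.
rewrite -mulr_sumr; congr (_ * _).
under eq_bigr do rewrite mderivX mmapZ mmapX.
rewrite /mmap1.
have derivP (r : seq 'I_n) (h : 'I_n -> {poly F}) : uniq r ->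
  (\prod_(i <- r) h i)^`() =
    \sum_(i <- r) (h i)^`() * \prod_(j <- r | j != i) h j.
  elim: r => [|a r IH] /=; first by rewrite !big_nil derivC.
  move=> /andP[ar ur]; rewrite !big_cons derivM IH // eqxx /=.
  congr (_ + _).
    congr (_ * _); rewrite [RHS]big_seq_cond [LHS]big_seq; apply: eq_bigl => j.
    by case jr: (j \in r) => //=; apply/esym/eqP => ja; rewrite -ja jr in ar.
  rewrite mulr_sumr big_seq [RHS]big_seq; apply: eq_bigr => i ir.
  rewrite big_cons ifT; last by apply/eqP => ai; rewrite ai ir in ar.
  by rewrite mulrCA.
rewrite derivP ?index_enum_uniq //; apply: eq_bigr => i _.
rewrite [in RHS](bigD1 i) //= mnmBE mnm1E eqxx /=.
rewrite deriv_exp subn1 -[_ *+ m i]mulr_natl polyC_natr.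
rewrite -!mulrA; congr (_ * _); rewrite mulrC -mulrA; congr (_ * _).
congr (_ * _).
by apply: eq_bigr => j ji; rewrite mnmBE mnm1E eq_sym (negPf ji) subn0.
Qed.

Lemma horner_mmap (F : comNzRingType) n (p : {mpoly F[n]}) (g : 'I_n -> {poly F}) a :
  (mmap polyC g p).[a] = p.@[fun i => (g i).[a]].
Proof.
elim/mpolyind: p => [|c m p _ _ IH]; first by rewrite mmap0 horner0 meval0.
rewrite mmapD hornerD mevalD IH mmapZ hornerM hornerC mevalZ mmapX mevalX.
congr (_ * _ + _); rewrite /mmap1 horner_prod; apply: eq_bigr => i _.
by rewrite horner_exp.
Qed.

Local Notation widen := (widen_ord (leqnSn _)).

Lemma muni_eq0 (F : comNzRingType) n (p : {mpoly F[n.+1]}) : muni p = 0 -> p = 0.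
Proof.
move=> H; apply/mpolyP => m; rewrite mcoeff0.
pose res (k : 'X_{1..n.+1}) := [multinom k (widen i) | i < n].
have: (muni p)`_(m ord_max) @_ (res m) = 0 by rewrite H coef0 mcoeff0.
rewrite muniE coef_sum raddf_sum /=.
have E k : ((p@_k *: 'X_[res k]) *: 'X^(k ord_max))`_(m ord_max)@_(res m)
           = (k == m)%:R * p@_k.
  rewrite coefZ coefXn; have -> : (k == m) = (k ord_max == m ord_max) && (res k == res m).
    apply/eqP/andP => [->|[/eqP e1 /eqP e2]]; first by rewrite !eqxx.
    apply/mnmP => i; have [j ->|ni] := unliftP ord_max i.
      have := congr1 (fun k : 'X_{1..n} => k j) e2; rewrite !mnmE.
      by congr (_ = _); congr (fun_of_multinom _ _); apply: val_inj => /=;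
        rewrite /bump leqNgt ltn_ord.
    by rewrite ni.
  rewrite eq_sym; case: eqP => _; rewrite ?mulr0 ?mulr1 ?mcoeff0 ?mul0r //=.
  by rewrite mcoeffZ mcoeffX mulrC.
under eq_bigr do rewrite E.
have [mp|mp] := boolP (m \in msupp p); last by rewrite (memN_msupp_eq0 mp).
rewrite (bigD1_seq m mp (msupp_uniq p)) /= eqxx mul1r big1 ?addr0 //.
by move=> k /negPf ->; rewrite mul0r.
Qed.

Lemma horner_muni (F : comNzRingType) n (p : {mpoly F[n.+1]}) (v : 'I_n.+1 -> F) :
  (map_poly (meval (fun i => v (widen i))) (muni p)).[v ord_max] = p.@[v].
Proof.
rewrite muniE [in RHS]mevalE raddf_sum /= horner_sum; apply: eq_bigr => m _.
rewrite -mul_polyC rmorphM /= map_polyC map_polyXn /= hornerM hornerC hornerXn.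
rewrite mevalZ mevalX big_ord_recr /= mulrA; congr (_ * _ * _).
by apply: eq_bigr => i _; rewrite mnmE.
Qed.

Lemma poly_neq0_nat (F : numDomainType) (p : {poly F}) : p != 0 ->
  exists k : nat, p.[k%:R] != 0.
Proof.
move=> p0; apply: contrapT => /forallNP H.
have u : uniq [seq k%:R : F | k <- iota 0 (size p)].
  by rewrite map_inj_uniq ?iota_uniq // => i j /eqP; rewrite eqr_nat => /eqP.
have /(max_poly_roots p0) : all (root p) [seq k%:R : F | k <- iota 0 (size p)].
  apply/allP => y /mapP[k _ ->]; rewrite /root; apply: contrapT => /negP; exact: H.
by move=> /(_ u); rewrite size_map size_iota ltnn.
Qed.

(** Induction on the number of variables: at a natural point where the leading
    coefficient in the last variable does not vanish, p becomes a nonzero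
    univariate polynomial, which has finitely many roots. *)
Lemma mpoly_neq0_nat (F : numDomainType) n (p : {mpoly F[n]}) : p != 0 ->
  exists v : 'I_n -> nat, p.@[fun i => (v i)%:R] != 0.
Proof.
elim: n p => [|n IH] p p0.
  exists (fun=> 0%N); move: p0; rewrite {1 2}(nvar0_mpolyC p) mevalC.
  by rewrite mpolyC_eq0.
have : muni p != 0 by apply: contra_neq p0; exact: muni_eq0.
rewrite -lead_coef_eq0 => /IH[v Hv].
have : map_poly (meval (fun i => (v i)%:R)) (muni p) != 0.
  apply: contra_neq Hv => /(congr1 (fun q : {poly F} => q`_(size (muni p)).-1)).
  by rewrite coef_map coef0.
move=> /poly_neq0_nat[k Hk].
exists (fun i => if unlift ord_max i is Some j then v j else k).
rewrite -horner_muni unlift_none.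
rewrite (_ : map_poly _ _ = map_poly (meval (fun i => (v i)%:R)) (muni p)) //.
apply: eq_map_poly => q; apply: meval_eq => i.
by rewrite (_ : widen i = lift ord_max i) ?liftK //; apply: val_inj => /=;
  rewrite /bump leqNgt ltn_ord.
Qed.

Lemma msizeM_leq (F : idomainType) n (p q : {mpoly F[n]}) k l :
  (msize p <= k.+1)%N -> (msize q <= l.+1)%N -> (msize (p * q) <= (k + l).+1)%N.
Proof.
have [->|p0] := eqVneq p 0; first by rewrite mul0r msize0.
have [->|q0] := eqVneq q 0; first by rewrite mulr0 msize0.
move=> Hp Hq; rewrite msizeM // -subn1 leq_subLR add1n -addSn -addnS.
exact: leq_add.
Qed.

Lemma msizeX_leq (F : idomainType) n (p : {mpoly F[n]}) k a :
  (msize p <= k.+1)%N -> (msize (p ^+ a) <= (a * k).+1)%N.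
Proof.
move=> Hp; elim: a => [|a IH]; first by rewrite expr0 msize1.
by rewrite exprS mulSn; exact: msizeM_leq.
Qed.

Lemma msize_prod_leq (F : idomainType) n m (p : 'I_m -> {mpoly F[n]}) (k : 'I_m -> nat) :
  (forall i, msize (p i) <= (k i).+1)%N ->
  (msize (\prod_i p i) <= (\sum_i k i).+1)%N.
Proof.
move=> H; elim/big_rec2: _ => [|i l q _ IH]; first by rewrite msize1.
exact: msizeM_leq.
Qed.

(** Counting: the products of powers of the f i with exponents below N number
    N ^ n.+1, and lie in a space of polynomials of degree O(N), of dimension
    O(N ^ n); for large N there is a linear relation between them. *)
Theorem mpoly_alg_dep (F : fieldType) n (f : 'I_n.+1 -> {mpoly F[n]}) :
  exists2 P : {mpoly F[n.+1]}, P != 0 &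
    forall v, P.@[fun i => (f i).@[v]] = 0.
Proof.
pose d := \max_i msize (f i).
have fd i : (msize (f i) <= d.+1)%N by apply/leqW/leq_bigmax.
(* A product of powers with exponents below N has degree at most D, and
   (D + 1) ^ n <= c ^ n * N ^ n < N ^ n.+1. *)
pose c := (n.+1 * d).+1; pose N := (c ^ n).+1; pose D := (n.+1 * (N * d))%N.
pose A := {ffun 'I_n.+1 -> 'I_N}; pose B := {ffun 'I_n -> 'I_D.+1}.
pose mA (a : A) : 'X_{1..n.+1} := [multinom (a i : nat) | i < n.+1].
pose mB (b : B) : 'X_{1..n} := [multinom (b i : nat) | i < n].
pose fA (a : A) := \prod_i f i ^+ a i.
have cardAB : (#|B| < #|A|)%N.
  rewrite !card_ffun !card_ord (@leq_ltn_trans ((c * N) ^ n)%N) //.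
    have le1 : (D.+1 <= c * N)%N.
      have -> : D = (n.+1 * d * N)%N by rewrite /D mulnA mulnAC.
      by rewrite /c -[(_ * d).+1]add1n mulnDl mul1n -add1n leq_add2r.
    by case: (n) (le1) => // k le2; rewrite leq_exp2r.
  by rewrite expnMn expnS ltn_pmul2r ?expn_gt0.
pose M := \matrix_(i < #|A|, j < #|B|) (fA (enum_val i))@_(mB (enum_val j)).
have /rowV0Pn[v vM v0] : kermx M != 0.
  rewrite kermx_eq0 /row_free neq_ltn (leq_ltn_trans (rank_leq_col _)) //.
move/sub_kermxP: vM => vM.
pose P := \sum_(i < #|A|) v 0 i *: 'X_[mA (enum_val i)].
have mA_inj : injective mA.
  move=> a b /mnmP ab; apply/ffunP => i; apply: val_inj.
  by have := ab i; rewrite !mnmE.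
exists P.
  apply: contra_neq v0 => P0; apply/rowP => i; rewrite mxE.
  have := congr1 (mcoeff (mA (enum_val i))) P0; rewrite mcoeff0 => <-.
  rewrite raddf_sum (bigD1 i) //= mcoeffZ mcoeffX eqxx mulr1.
  rewrite big1 ?addr0 // => j ji; rewrite mcoeffZ mcoeffX.
  by rewrite (inj_eq mA_inj) (inj_eq enum_val_inj) (negPf ji) mulr0.
move=> x; transitivity ((\sum_(i < #|A|) v 0 i *: fA (enum_val i)).@[x]).
  rewrite !raddf_sum; apply: eq_bigr => i _ /=; rewrite !mevalZ; congr (_ * _).
  rewrite mevalX rmorph_prod; apply: eq_bigr => j _ /=.
  by rewrite rmorphXn /= mnmE.
rewrite (_ : \sum_(i < _) _ = 0) ?meval0 //; apply/mpolyP => m.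
rewrite mcoeff0 raddf_sum /=; under eq_bigr do rewrite mcoeffZ.
have [mD|mD] := boolP [forall i, m i < D.+1]%N.
  pose b : B := [ffun i => inord (m i)].
  have mb : m = mB b.
    apply/mnmP => i; rewrite mnmE ffunE inordK //; exact: (forallP mD).
  have := congr1 (fun u : 'rV_ _ => u 0 (enum_rank b)) vM; rewrite !mxE => E.
  by rewrite -[RHS]E; apply: eq_bigr => i _; rewrite mxE enum_rankK -mb.
rewrite big1 // => i _; rewrite memN_msupp_eq0 ?mulr0 //.
apply: msize_mdeg_ge; have [j] := forallPn mD; rewrite -leqNgt => mj.
apply: (@leq_trans (m j)); last by rewrite mdegE (bigD1 j) //= leq_addr.
apply: leq_trans mj; apply: leq_trans (msize_prod_leq (fun j => msizeX_leq _ (fd j))) _.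
rewrite ltnS /D -[X in (_ <= X * _)%N]card_ord -sum_nat_const leq_sum // => k _.
by rewrite leq_mul2r ltnW ?orbT.
Qed.

Corollary poly_in_alg_dep (F : fieldType) (T : Type) n
    (x : 'I_n -> T -> F) (f : 'I_n.+1 -> T -> F) :
  (forall i, poly_in x (f i)) ->
  exists2 P : {mpoly F[n.+1]}, P != 0 & forall t, P.@[fun i => f i t] = 0.
Proof.
move=> H; have [p Hp] : {p : 'I_n.+1 -> {mpoly F[n]} &
    forall i t, f i t = (p i).@[fun i => x i t]}.
  have h i : {q : {mpoly F[n]} | forall t, f i t = q.@[fun i => x i t]}.
    exact: (boolp.constructive_indefinite_description (H i)).
  by exists (fun i => sval (h i)) => i; exact: svalP (h i).
have [P P0 HP] := mpoly_alg_dep p; exists P => // t.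
rewrite -(HP (fun i => x i t)); apply: meval_eq => i; exact: Hp.
Qed.

(** * First-order properties hold generically or fail generically *)

Section Definable.
Variable F : closedFieldType.

Definition definable (D : (nat -> F) -> Prop) : Prop :=
  exists f : GRing.formula F, forall e : seq F, GRing.holds e f <-> D (nth 0 e).

Lemma definable_ext D D' : (forall e, D e <-> D' e) -> definable D -> definable D'.
Proof. by move=> DD [f Hf]; exists f => e; rewrite Hf DD. Qed.

Lemma definable_not D : definable D -> definable (fun e => ~ D e).
Proof. by move=> [f Hf]; exists (GRing.Not f) => e /=; rewrite Hf. Qed.

Lemma definable_and D D' : definable D -> definable D' ->
  definable (fun e => D e /\ D' e).
Proof.
by move=> [f Hf] [g Hg]; exists (GRing.And f g) => e /=; rewrite Hf Hg.
Qed.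

Lemma definable_all (I : eqType) (r : seq I) (D : I -> (nat -> F) -> Prop) :
  (forall i, definable (D i)) -> definable (fun e => forall i, i \in r -> D i e).
Proof.
move=> H; elim: r => [|i r IH]; first by exists (GRing.Bool true) => e; split.
apply: definable_ext (definable_and (H i) IH) => e; split.
  by move=> [Di Dr] j; rewrite inE => /orP[/eqP->//|]; exact: Dr.
by move=> Da; split=> [|j jr]; apply: Da; rewrite inE ?eqxx // jr orbT.
Qed.

Lemma definable_forall (I : finType) (D : I -> (nat -> F) -> Prop) :
  (forall i, definable (D i)) -> definable (fun e => forall i, D i e).
Proof.
move=> H; apply: definable_ext (definable_all (enum I) H) => e.
by split=> Da i; [apply: Da; rewrite mem_enum | move=> _; exact: Da].
Qed.

Lemma term_mpoly N (p : {mpoly F[N]}) :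
  exists t : GRing.term F, forall e : seq F, GRing.eval e t = p.@[fun i => e`_i].
Proof.
elim/mpolyind: p => [|c m p _ _ [t Ht]].
  by exists (GRing.Const 0) => e; rewrite meval0.
pose s := foldr (fun (i : 'I_N) t => GRing.Mul (GRing.Exp (GRing.Var F i) (m i)) t)
  (GRing.Const 1) (index_enum 'I_N).
exists (GRing.Add (GRing.Mul (GRing.Const c) s) t) => e /=.
rewrite Ht mevalD mevalZ mevalX; congr (_ * _ + _).
rewrite /s; elim: (index_enum _) => [|i r IH] /=; first by rewrite big_nil.
by rewrite IH big_cons.
Qed.

Lemma definable_eq0 N (f : (nat -> F) -> F) :
  poly_in (fun (i : 'I_N) (e : nat -> F) => e i) f -> definable (fun e => f e = 0).
Proof.
move=> [p Hp]; have [t Ht] := term_mpoly p.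
by exists (GRing.Equal t (GRing.Const 0)) => e /=; rewrite Ht Hp.
Qed.

(** D only depends on the first n + m variables, so quantifying the m variables
    from n on amounts to quantifying over all assignments that agree with e
    below n. *)
Lemma definable_exists n m (D : (nat -> F) -> Prop) :
  (forall e e', (forall i, (i < n + m)%N -> e i = e' i) -> D e -> D e') ->
  definable D ->
  definable (fun e => exists2 e', (forall i, (i < n)%N -> e' i = e i) & D e').
Proof.
move=> HD [f Hf]; exists (foldr GRing.Exists f (iota n m)) => e.
rewrite -GRing.foldExistsP; split=> [[e' ee' /Hf De']|[e' ee' De']].
  exists (nth 0 e') => // i lt_in; apply/esym/ee'.
  by rewrite inE /= mem_iota leqNgt lt_in.
pose M := maxn (n + m) (size e).
exists (mkseq (fun i => if (i < n + m)%N then e' i else e`_i) M).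
  move=> i; rewrite inE /= mem_iota => Hi.
  have [lt_iM|le_Mi] := ltnP i M; last first.
    rewrite !nth_default ?size_mkseq //.
    by apply: leq_trans le_Mi; rewrite leq_maxr.
  rewrite nth_mkseq //; case: ltnP => // lt_i.
  by rewrite ee' // ltnNge; apply: contra Hi => ->.
apply/Hf; apply: HD De' => i lt_i.
by rewrite nth_mkseq ?lt_i // (leq_trans lt_i) // leq_maxl.
Qed.

Section Generic.
Variable n : nat.

Definition extend0 (c : 'I_n -> F) (i : nat) : F :=
  if insub i is Some j then c j else 0.

Lemma nth_extend0 (c : 'I_n -> F) : nth 0 [seq c i | i <- enum 'I_n] = extend0 c.
Proof.
apply/funext => i; rewrite /extend0; case: insubP => [j lt_in ij|].
  by rewrite (nth_map j) ?size_enum_ord // -ij nth_ord_enum.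
by rewrite -leqNgt => le_ni; rewrite nth_default // size_map size_enum_ord.
Qed.

(** P holds on the complement of a proper hypersurface of affine n-space; finite
    unions of hypersurfaces being hypersurfaces, finitely many such properties
    hold simultaneously. *)
Definition generic (P : ('I_n -> F) -> Prop) : Prop :=
  exists2 g : {mpoly F[n]}, g != 0 & forall c, g.@[c] != 0 -> P c.

Lemma genericS P P' : (forall c, P c -> P' c) -> generic P -> generic P'.
Proof. by move=> PP [g g0 Hg]; exists g => // c /Hg; exact: PP. Qed.

Lemma generic_true P : (forall c, P c) -> generic P.
Proof. by move=> HP; exists 1 => //; rewrite oner_neq0. Qed.

Lemma generic_and P P' : generic P -> generic P' -> generic (fun c => P c /\ P' c).
Proof.
move=> [g g0 Hg] [h h0 Hh]; exists (g * h); first by rewrite mulf_neq0.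
by move=> c; rewrite mevalM mulf_eq0 negb_or => /andP[/Hg ? /Hh].
Qed.

Lemma generic_neq0 (g : {mpoly F[n]}) : g != 0 -> generic (fun c => g.@[c] != 0).
Proof. by move=> g0; exists g. Qed.

Lemma generic_forall (I : finType) (P : I -> ('I_n -> F) -> Prop) :
  (forall i, generic (P i)) -> generic (fun c => forall i, P i c).
Proof.
move=> H; suff: generic (fun c => forall i, i \in enum I -> P i c).
  by apply: genericS => c Hc i; apply: Hc; rewrite mem_enum.
elim: (enum I) => [|i r IH]; first by apply: generic_true => c.
apply: genericS (generic_and (H i) IH) => c [Pi Pr] j.
by rewrite inE => /orP[/eqP->//|]; exact: Pr.
Qed.

(** The value on inverses is a default: the translation is used for terms
    without them. *)
Fixpoint mpoly_of_term (t : GRing.term F) : {mpoly F[n]} :=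
  match t with
  | GRing.Var i => if insub i is Some j then 'X_j else 0
  | GRing.Const c => c%:MP
  | GRing.NatConst k => k%:R
  | GRing.Add t u => mpoly_of_term t + mpoly_of_term u
  | GRing.Opp t => - mpoly_of_term t
  | GRing.NatMul t k => mpoly_of_term t *+ k
  | GRing.Mul t u => mpoly_of_term t * mpoly_of_term u
  | GRing.Inv t => 0
  | GRing.Exp t k => mpoly_of_term t ^+ k
  end.

Lemma eval_mpoly_of_term t c : GRing.rterm t ->
  GRing.eval [seq c i | i <- enum 'I_n] t = (mpoly_of_term t).@[c].
Proof.
elim: t => //=.
- move=> i _; rewrite nth_extend0 /extend0; case: insub => [j|].
    by rewrite mevalXU.
  by rewrite meval0.
- by move=> x _; rewrite mevalC.
- by move=> k _; rewrite -mpolyC_nat mevalC.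
- by move=> t IHt u IHu /andP[/IHt-> /IHu->]; rewrite mevalD.
- by move=> t IHt /IHt->; rewrite mevalN.
- by move=> t IHt k /IHt->; rewrite mevalMn.
- by move=> t IHt u IHu /andP[/IHt-> /IHu->]; rewrite mevalM.
- by move=> t IHt k /IHt->; rewrite rmorphXn.
Qed.

(** An equation between polynomials is an identity or fails off a hypersurface,
    and Boolean operations preserve this alternative. *)
Lemma generic_qf (f : GRing.formula F) : GRing.qf_form f -> GRing.rformula f ->
  let D c := GRing.qf_eval [seq c i | i <- enum 'I_n] f in
  generic (fun c => D c) \/ generic (fun c => ~~ D c).
Proof.
elim: f => //=.
- by case=> _ _; [left|right]; apply: generic_true.
- move=> t u _ /andP[rt ru].
  have [E|E] := eqVneq (mpoly_of_term t) (mpoly_of_term u).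
    by left; apply: generic_true => c; rewrite !eval_mpoly_of_term ?E.
  right; apply: genericS (@generic_neq0 (mpoly_of_term t - mpoly_of_term u) _).
    by move=> c; rewrite mevalB subr_eq0 !eval_mpoly_of_term.
  by rewrite subr_eq0.
- move=> f IHf g IHg /andP[qf qg] /andP[rf rg].
  case: (IHf qf rf) => Hf; last by right; apply: genericS Hf => c /negPf ->.
  case: (IHg qg rg) => Hg; last first.
    by right; apply: genericS Hg => c /negPf ->; rewrite andbF.
  by left; apply: genericS (generic_and Hf Hg) => c [-> ->].
- move=> f IHf g IHg /andP[qf qg] /andP[rf rg].
  case: (IHf qf rf) => Hf; first by left; apply: genericS Hf => c ->.
  case: (IHg qg rg) => Hg; first by left; apply: genericS Hg => c ->; rewrite orbT.
  by right; apply: genericS (generic_and Hf Hg) => c [/negPf-> /negPf->].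
- move=> f IHf g IHg /andP[qf qg] /andP[rf rg].
  case: (IHf qf rf) => Hf; last by left; apply: genericS Hf => c /negPf ->.
  case: (IHg qg rg) => Hg; first by left; apply: genericS Hg => c ->; rewrite implybT.
  by right; apply: genericS (generic_and Hf Hg) => c [-> /negPf->].
- move=> f IHf qf rf; case: (IHf qf rf) => Hf; [right|left] => //.
  by apply: genericS Hf => c ->.
Qed.

(** Quantifier elimination over an algebraically closed field reduces the claim
    to quantifier-free formulas. *)
Theorem definable_generic (D : (nat -> F) -> Prop) : definable D ->
  generic (fun c => D (extend0 c)) \/ generic (fun c => ~ D (extend0 c)).
Proof.
move=> [f Hf]; pose f' := GRing.to_rform f.
have rf' : GRing.rformula f' by exact: GRing.to_rform_rformula.
pose prj := @ClosedFieldQE.ex_elim F; pose q := GRing.quantifier_elim prj f'.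
have wf := @ClosedFieldQE.wf_ex_elim F.
have ok := ClosedFieldQE.holds_ex_elim (@solve_monicpoly F).
have /andP[qq rq] : GRing.qf_form q && GRing.rformula q.
  exact: GRing.quantifier_elim_wf.
have qD c : reflect (D (extend0 c)) (GRing.qf_eval [seq c i | i <- enum 'I_n] q).
  apply: (iffP (GRing.quantifier_elim_rformP wf ok _ rf')).
    by move/GRing.to_rformP/Hf; rewrite nth_extend0.
  by move=> Dc; apply/GRing.to_rformP/Hf; rewrite nth_extend0.
case: (generic_qf qq rq) => H; [left|right]; apply: genericS H => c.
  by move/qD.
by move=> /negP nq /qD.
Qed.

End Generic.
End Definable.

(** * Derivatives of polynomial functions on a vector space *)

Section PolynomialFunctions.
Variables (F : fieldType) (W : vectType F).
Implicit Types (p q : polyfun W) (w v : W).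

Lemma coords_lin c w v i : coords (c *: w + v) i = c * coords w i + coords v i.
Proof. by rewrite /coords linearP. Qed.

Lemma coords_vecE w : w = \sum_(i < \dim {:W}) coords w i *: (vbasis {:W})`_i.
Proof. by rewrite -coord_vbasis ?memvf. Qed.

Lemma coords_sumE (c : 'I_(\dim {:W}) -> F) :
  coords (\sum_(i < \dim {:W}) c i *: (vbasis {:W})`_i) = c.
Proof.
by apply/funext => i; rewrite /coords coord_sum_free // (basis_free (vbasisP _)).
Qed.

Definition linpoly (f : W -> F) : polyfun W :=
  \sum_(i < \dim {:W}) f (vbasis {:W})`_i *: 'X_i.

Lemma pval_linpoly (f : {scalar W}) w : pval (linpoly f) w = f w.
Proof.
rewrite /pval /linpoly {2}(coords_vecE w) !raddf_sum /=; apply: eq_bigr => i _.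
by rewrite mevalZ mevalXU linearZ /= mulrC.
Qed.

Lemma pdiff_linpoly (f : {scalar W}) w v : pdiff (linpoly f) w v = f v.
Proof.
rewrite [in RHS](coords_vecE v) linear_sum /pdiff; apply: eq_bigr => i _ /=.
rewrite linearZ /= mulrC; congr (_ * _); rewrite /pval /linpoly.
rewrite (raddf_sum (mderiv i)) raddf_sum /=.
rewrite (bigD1 i) //= big1 ?addr0 => [|j ji].
  by rewrite mderivZ mevalZ mderivX mnm1E eqxx scale1r -{1}[U_(i)%MM]add0m addmK mpolyX0 meval1 mulr1.
by rewrite mderivZ mevalZ mderivX mnm1E (negPf ji) scale0r meval0 mulr0.
Qed.

Lemma pdiffB p q w v : pdiff (p - q) w v = pdiff p w v - pdiff q w v.
Proof.
rewrite /pdiff -sumrB; apply: eq_bigr => i _.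
by rewrite /pval mderivB mevalB mulrBl.
Qed.

Lemma pdiffM p q w v :
  pdiff (p * q) w v = pdiff p w v * pval q w + pval p w * pdiff q w v.
Proof.
rewrite /pdiff mulr_suml mulr_sumr -big_split; apply: eq_bigr => i _ /=.
by rewrite /pval mderivM mevalD !mevalM; ring.
Qed.

Lemma pdiff_lin p w c v v' : pdiff p w (c *: v + v') = c * pdiff p w v + pdiff p w v'.
Proof.
rewrite /pdiff mulr_sumr -big_split; apply: eq_bigr => i _ /=.
by rewrite coords_lin; ring.
Qed.

(** This produces tangent vectors: if a polynomial curve lies in a set, its
    linear coefficient is tangent there at its constant coefficient. By the
    chain rule the derivative of p is the linear coefficient of p along the
    curve, a univariate polynomial that vanishes at all natural numbers. *)
Lemma pdiff_curve p (s : seq W) : (forall k : nat, k%:R = 0 :> F -> k = 0%N) ->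
  (forall t : F, pval p (\sum_(i < size s) t ^+ i *: s`_i) = 0) ->
  pdiff p s`_0 s`_1 = 0.
Proof.
move=> char0 Hp; pose g i : {poly F} := \poly_(k < size s) coords s`_k i.
have gE t i : (g i).[t] = coords (\sum_(k < size s) t ^+ k *: s`_k) i.
  rewrite horner_poly /coords linear_sum; apply: eq_bigr => k _ /=.
  by rewrite linearZ /= mulrC.
have g0 i k : (g i)`_k = coords s`_k i.
  rewrite coef_poly; case: ltnP => // le_sk; rewrite nth_default //.
  by rewrite /coords linear0.
have : (mmap polyC g p)^`().[0] = 0.
  suff -> : mmap polyC g p = 0 by rewrite derivC horner0.
  apply: contrapT => /eqP q0.
  have u : uniq [seq k%:R : F | k <- iota 0 (size (mmap polyC g p))].
    rewrite map_inj_in_uniq ?iota_uniq // => i j _ _ eij.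
    wlog le_ij : i j eij / (i <= j)%N.
      by move=> H; case: (leqP i j) => [/H|/ltnW /H] ->.
    have : (j - i)%:R = 0 :> F by rewrite natrB // eij subrr.
    by move=> /char0/eqP; rewrite subn_eq0 => le_ji; apply/eqP; rewrite eqn_leq le_ij.
  suff /(max_poly_roots q0) /(_ u) : all (root (mmap polyC g p))
      [seq k%:R : F | k <- iota 0 (size (mmap polyC g p))].
    by rewrite size_map size_iota ltnn.
  apply/allP => y _; rewrite rootE horner_mmap -(Hp y) /pval; apply/eqP.
  by apply: meval_eq => i; exact: gE.
rewrite deriv_mmap horner_sum => <-; apply: eq_bigr => i _.
rewrite hornerM horner_mmap; congr (_ * _).
  by apply: meval_eq => j; rewrite -g0 horner_coef0.
by rewrite -[LHS]g0 horner_coef0 coef_deriv.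
Qed.

End PolynomialFunctions.

(** * Cubic forms as combinations of products of linear forms *)

Section Cubics.
Variable F : fieldType.
Local Notation vec := 'rV[F]_3.
Local Notation W := (Sym F 3 2).
Implicit Types (a b c : vec) (u v w : W).

Definition base_vec (i : 'I_3) : vec := delta_mx 0 i.

Lemma linformD a b : linform (a + b) = linform a + linform b.
Proof.
by rewrite /linform -big_split; apply: eq_bigr => i _; rewrite mxE scalerDl.
Qed.

Lemma linformZ t a : linform (t *: a) = t *: linform a.
Proof.
by rewrite /linform scaler_sumr; apply: eq_bigr => i _; rewrite mxE scalerA.
Qed.

Lemma linform_base i : linform (base_vec i) = 'X_i.
Proof.
rewrite /linform (bigD1 i) //= mxE !eqxx scale1r big1 ?addr0 // => j ji.
by rewrite mxE (negPf ji) andbF scale0r.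
Qed.

Lemma linform_coef a i : (linform a)@_U_(i) = a 0 i.
Proof.
rewrite /linform raddf_sum (bigD1 i) //= mcoeffZ mcoeffX eqxx mulr1.
rewrite big1 ?addr0 // => j ji; rewrite mcoeffZ mcoeffX eq_mnm1 (negPf ji).
by rewrite mulr0.
Qed.

Lemma linform_eq0 a : linform a = 0 -> a = 0.
Proof. by move=> H; apply/rowP => i; rewrite -linform_coef H mcoeff0 mxE. Qed.

Lemma mul3_homog a b c : linform a * linform b * linform c \is 3.-homog.
Proof. by apply: (@dhomogM _ _ _ 2) (linform_homog c); apply: dhomogM (linform_homog a) (linform_homog b). Qed.

Definition mul3 a b c : W := DHomog (mul3_homog a b c).

Lemma power3E a : power 3 a = mul3 a a a.
Proof. by apply: val_inj => /=; rewrite !exprS expr0 mulr1 mulrA. Qed.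

Lemma mul3C a b c : mul3 a b c = mul3 b a c.
Proof. by apply: val_inj => /=; ring. Qed.

Lemma mul3CA a b c : mul3 a b c = mul3 a c b.
Proof. by apply: val_inj => /=; ring. Qed.

Lemma mul3_linr a b : linear (mul3 a b).
Proof.
move=> t c d; apply: val_inj => /=.
by rewrite linformD linformZ mulrDr scalerAr.
Qed.
HB.instance Definition _ a b :=
  GRing.isLinear.Build F vec W _ (mul3 a b) (mul3_linr a b).

Lemma mul3Zr a b t c : mul3 a b (t *: c) = t *: mul3 a b c.
Proof. exact: linearZ. Qed.
Lemma mul3Zm a b t c : mul3 a (t *: c) b = t *: mul3 a c b.
Proof. by rewrite mul3CA mul3Zr !(mul3CA a b). Qed.
Lemma mul3Zl a b t c : mul3 (t *: c) a b = t *: mul3 c a b.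
Proof. by rewrite mul3C mul3Zm !(mul3C a). Qed.

Lemma vec_sum a : a = \sum_i a 0 i *: (base_vec i).
Proof. exact: row_sum_delta. Qed.

Lemma mul3_sum a b c : mul3 a b c =
  \sum_i \sum_j \sum_k (a 0 i * b 0 j * c 0 k) *: mul3 (base_vec i) (base_vec j) (base_vec k).
Proof.
rewrite {1}(vec_sum a) mul3C mul3CA linear_sum; apply: eq_bigr => i _ /=.
rewrite mul3Zr -mul3CA -mul3C {1}(vec_sum b) mul3CA linear_sum scaler_sumr.
apply: eq_bigr => j _ /=.
rewrite mul3Zr -mul3CA {1}(vec_sum c) linear_sum !scaler_sumr.
by apply: eq_bigr => k _ /=; rewrite mul3Zr !scalerA.
Qed.

Lemma power3_shift a b t :
  power 3 (a + t *: b) = power 3 a + (3 * t) *: mul3 a a b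
    + (3 * t ^+ 2) *: mul3 a b b + t ^+ 3 *: power 3 b.
Proof.
rewrite !power3E; apply: val_inj => /=; rewrite linformD linformZ.
by rewrite -!mul_mpolyC !mpolyCM mpolyC_nat; ring.
Qed.

Lemma power3Z t a : power 3 (t *: a) = t ^+ 3 *: power 3 a.
Proof. by rewrite !power3E mul3Zl mul3Zm mul3Zr !scalerA !exprS expr0 mulr1 mulrA. Qed.

Lemma power3_0 : power 3 (0 : vec) = 0 :> W.
Proof. by rewrite -(scale0r (0 : vec)) power3Z expr0n scale0r. Qed.

(** Naming a cubic monomial by three indices reduces linear statements on
    cubics to products of basis vectors, as in Sym_ind. *)
Lemma mnm3P (m : 'X_{1..3}) : mdeg m = 3%N ->
  exists ijk : 'I_3 * 'I_3 * 'I_3, m = (U_(ijk.1.1) + U_(ijk.1.2) + U_(ijk.2))%MM.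
Proof.
have step (m' : 'X_{1..3}) d : mdeg m' = d.+1 ->
    exists i, exists2 m'' : 'X_{1..3}, mdeg m'' = d & m' = (m'' + U_(i))%MM.
  move=> H; have [i mi] : exists i, (0 < m' i)%N.
    apply: contrapT => /forallNP H0; move: H; rewrite mdegE big1 // => i _.
    by apply/eqP; rewrite -leqn0 leqNgt; apply/negP.
  exists i; exists (m' - U_(i))%MM; last by rewrite submK // lep1mP -lt0n.
  have : mdeg (m' - U_(i) + U_(i))%MM = d.+1 by rewrite submK // lep1mP -lt0n.
  by rewrite mdegD mdeg1 addn1 => -[].
move=> /step[k [m1 /step[j [m2 /step[i [m3 /eqP]]]]]].
by rewrite mdeg_eq0 => /eqP -> -> -> ->; exists (i, j, k); rewrite add0m.
Qed.

Lemma indhomog_mnm3 i j k :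
  indhomog 3 'X_[(U_(i) + U_(j) + U_(k))%MM] = mul3 (base_vec i) (base_vec j) (base_vec k) :> W.
Proof.
apply: val_inj; rewrite /= insubdK; first by rewrite !linform_base !mpolyXD.
by rewrite unfold_in /= dhomogX /= !mdegD !mdeg1.
Qed.

Lemma Sym_sum u :
  u = \sum_(m : 'X_{1..3 < 4}) (u : dhomog _ _ _)@_m *: (indhomog 3 'X_[m] : W).
Proof.
apply: val_inj; rewrite raddf_sum /=.
have /mpolywE {1}-> : (msize (val u) <= 4)%N.
  have [->|u0] := eqVneq (val u) 0; first by rewrite msize0.
  rewrite -mlead_deg // ltnS (dhomog_mf (valP u)) //; exact: mlead_supp.
apply: eq_bigr => m _; have [m3|m3] := eqVneq (mdeg m) 3%N.
  by rewrite insubdK // unfold_in /= dhomogX /= m3.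
by rewrite (dhomog_nemf_coeff (valP u) m3) !scale0r.
Qed.

Lemma Sym_ind (P : W -> Prop) :
  (forall t u v, P u -> P v -> P (t *: u + v)) -> P 0 ->
  (forall i j k, P (mul3 (base_vec i) (base_vec j) (base_vec k))) -> forall u, P u.
Proof.
move=> PD P0 PX u; rewrite (Sym_sum u).
elim/big_rec: _ => // m v _ Pv; apply: PD => //.
have [/mnm3P[[[i j] k] ->]|m3] := eqVneq (mdeg m) 3%N.
  by rewrite indhomog_mnm3.
by rewrite /indhomog /insubd insubN //= dhomogX.
Qed.

Lemma dim_Sym : \dim {:W} = 10%N.
Proof. by rewrite dimvf. Qed.

End Cubics.

(** * Tangent spaces of the Veronese cone *)

Section VeroneseCone.
Variable F : numClosedFieldType.
Local Notation vec := 'rV[F]_3.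
Local Notation W := (Sym F 3 2).
Local Notation e := (base_vec F).
Implicit Types (a b c : vec) (u v w : W).

(** The entries of w as a symmetric tensor. The factor 6 normalizes them so
    that the tensor of a ^ 3 is a_i a_j a_k. *)
Definition scoef (i j k : 'I_3) w : F :=
  ((val w : {mpoly F[3]})^`M(i)^`M(j)^`M(k))@_0%MM / 6.

Lemma scoef_scalar i j k : scalar (scoef i j k).
Proof.
move=> t w v; rewrite /scoef /= !(mderivD, mderivZ) mcoeffD mcoeffZ.
by rewrite mulrDl mulrA.
Qed.
HB.instance Definition _ i j k :=
  GRing.isLinear.Build F W F _ (scoef i j k) (scoef_scalar i j k).

Lemma mderiv_linform a i : (linform a)^`M(i) = (a 0 i)%:MP.
Proof.
rewrite /linform (raddf_sum (mderiv i)) (bigD1 i) //= big1 ?addr0 => [|j ji].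
  rewrite mderivZ mderivX mnm1E eqxx scale1r -{1}[U_(i)%MM]add0m addmK mpolyX0.
  by rewrite -mul_mpolyC mulr1.
by rewrite mderivZ mderivX mnm1E (negPf ji) scale0r scaler0.
Qed.

Lemma scoef_mul3 i j k a b c : scoef i j k (mul3 a b c) =
  (a 0 i * b 0 j * c 0 k + a 0 i * b 0 k * c 0 j + a 0 j * b 0 i * c 0 k
   + a 0 j * b 0 k * c 0 i + a 0 k * b 0 i * c 0 j + a 0 k * b 0 j * c 0 i) / 6.
Proof.
rewrite /scoef /= !(mderivM, mderivD, mderiv_linform, mderivC, mulr0, mul0r, addr0, add0r).
rewrite -!(mpolyCM, mpolyCD) mcoeffC eqxx mulr1; congr (_ / _); ring.
Qed.

Lemma scoef_power i j k a : scoef i j k (power 3 a) = a 0 i * a 0 j * a 0 k.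
Proof. by rewrite power3E scoef_mul3; field. Qed.

Lemma scoef_inj w : (forall i j k, scoef i j k w = 0) -> w = 0.
Proof.
move=> H; apply: val_inj; apply/mpolyP => m /=; rewrite mcoeff0.
have [/mnm3P[[[i j] k] ->]/=|m3] := eqVneq (mdeg m) 3%N; last first.
  exact: dhomog_nemf_coeff (valP w) m3.
have /eqP := H k j i; rewrite mulf_eq0 invr_eq0 pnatr_eq0 orbF !mcoeff_deriv.
by rewrite !mulrn_eq0 /= add0m => /eqP.
Qed.

Definition cone : set W := affine_cone (veronese F 3 2).

(** Scalars are absorbed into cubes by taking cube roots. *)
Lemma coneP w : cone w <-> exists a, w = power 3 a.
Proof.
split=> [[_ [a a0 ->] /vlineP[t ->]]|[a ->]].
  exists (3.-root t *: a); by rewrite power3Z rootCK.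
have [->|a0] := eqVneq a 0; last by exists <[power 3 a]>%VS; [exists a | exact: memv_line].
exists <[power 3 (e ord0)]>%VS; last by rewrite power3_0 mem0v.
exists (e ord0) => //; apply/eqP => /rowP/(_ ord0); rewrite !mxE !eqxx => /eqP.
by rewrite oner_eq0.
Qed.

Lemma cone_power a : cone (power 3 a). Proof. by apply/coneP; exists a. Qed.

Lemma tangent_lin (Z : set W) x t u v :
  tangent Z x u -> tangent Z x v -> tangent Z x (t *: u + v).
Proof. by move=> Hu Hv p Hp; rewrite pdiff_lin Hu // Hv // mulr0 addr0. Qed.

Lemma natF_eq0 k : k%:R = 0 :> F -> k = 0%N.
Proof. by move/eqP; rewrite pnatr_eq0 => /eqP. Qed.

(** The vector a ^ 2 * b is the velocity of (a + t b / 3) ^ 3 at t = 0. *)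
Lemma tangent_mul3 a b : tangent cone (power 3 a) (mul3 a a b).
Proof.
move=> p Hp.
pose s := [:: power 3 a; mul3 a a b; 3^-1 *: mul3 a b b; 27^-1 *: power 3 b].
apply: (@pdiff_curve _ _ p s natF_eq0) => t; apply: Hp; apply/coneP.
exists (a + (t / 3) *: b); rewrite power3_shift /s !big_ord_recl big_ord0 /=.
rewrite !scalerA addr0 expr0 scale1r !addrA.
rewrite expr1 (_ : 3 * (t / 3) = t); last by field.
rewrite (_ : 3 * (t / 3) ^+ 2 = t ^+ 2 / 3); last by field.
by rewrite (_ : (t / 3) ^+ 3 = t ^+ 3 / 27); last by field.
Qed.

(** When the two products of six coordinates agree, the quadric
    w_ijk w_i'j'k' - w_lmn w_l'm'n' vanishes on all cubes, and its differential
    is a linear condition on tangent vectors. *)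
Lemma tangent_quadric a v (i j k i' j' k' l m n l' m' n' : 'I_3) :
  (forall c : vec, c 0 i * c 0 j * c 0 k * (c 0 i' * c 0 j' * c 0 k') =
               c 0 l * c 0 m * c 0 n * (c 0 l' * c 0 m' * c 0 n')) ->
  tangent cone (power 3 a) v ->
  scoef i j k v * (a 0 i' * a 0 j' * a 0 k') + a 0 i * a 0 j * a 0 k * scoef i' j' k' v =
  scoef l m n v * (a 0 l' * a 0 m' * a 0 n') + a 0 l * a 0 m * a 0 n * scoef l' m' n' v.
Proof.
move=> H /(_ (linpoly (scoef i j k) * linpoly (scoef i' j' k')
   - linpoly (scoef l m n) * linpoly (scoef l' m' n'))) T.
apply/eqP; rewrite -subr_eq0; apply/eqP; rewrite -[RHS]T.
  by rewrite pdiffB !pdiffM !pval_linpoly !pdiff_linpoly /=; rewrite !scoef_power.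
move=> w /coneP[c ->]; rewrite /pval mevalB !mevalM.
by rewrite -!/(pval _ _) !pval_linpoly /=; rewrite !scoef_power H subrr.
Qed.

(** Choose p with a_p <> 0. Subtracting a ^ 2 * b for a suitable b kills the
    entries (p, p, k) of a tangent vector, and the quadrics express the other
    entries, multiplied by a_p ^ 3, through these. *)
Theorem tangent_coneE a : a != 0 ->
  forall v, tangent cone (power 3 a) v <-> exists b, v = mul3 a a b.
Proof.
move=> a0 v; split=> [Tv|[b ->]]; last exact: tangent_mul3.
have [p ap] : exists p, a 0 p != 0.
  apply: contrapT => /forallNP H; move/eqP: a0; apply; apply/rowP => i.
  by rewrite mxE; apply: contrapT => /eqP; exact: H.
have ap3 : a 0 p * a 0 p * a 0 p != 0 by rewrite !mulf_neq0.
(* The solution b of the linear equations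
   scoef p p k (mul3 a a b) = scoef p p k v, found first for k = p. *)
pose bp := scoef p p p v / a 0 p ^+ 2.
pose b : vec := \row_k if k == p then bp else
  (3 * scoef p p k v - 2 * a 0 p * a 0 k * bp) / a 0 p ^+ 2.
exists b; apply/eqP; rewrite -subr_eq0; apply/eqP; set v' := v - _.
have Tv' : tangent cone (power 3 a) v'.
  rewrite /v' -scaleN1r addrC; apply: tangent_lin => //; exact: tangent_mul3.
have v'p k : scoef p p k v' = 0.
  rewrite linearB /= scoef_mul3 !mxE eqxx.
  by have [->|kp] := eqVneq k p; rewrite /bp; field.
have v'2 i j : scoef p i j v' = 0.
  have := tangent_quadric (i := p) (j := p) (k := p) (i' := p) (j' := i) (k' := j)
    (l := p) (m := p) (n := i) (l' := p) (m' := p) (n' := j) _ Tv'.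
  rewrite !v'p !(mul0r, mulr0, add0r, addr0) => H.
  lapply H; last by move=> c; ring.
  by move=> E; apply: (mulfI ap3); rewrite E mulr0.
apply: scoef_inj => i j k.
have := tangent_quadric (i := p) (j := p) (k := p) (i' := i) (j' := j) (k' := k)
    (l := p) (m := p) (n := i) (l' := p) (m' := j) (n' := k) _ Tv'.
rewrite !v'p !v'2 !(mul0r, mulr0, add0r, addr0) => H.
lapply H; last by move=> c; ring.
  by move=> E; apply: (mulfI ap3); rewrite E mulr0.
Qed.

Lemma tangent_dim_cone a : a != 0 -> tangent_dim cone (power 3 a) 3.
Proof.
move=> a0; pose f : 'Hom(vec, W) := linfun (mul3 a a).
exists (limg f).
  apply/seteqP; split=> v /=.
    by move=> /memv_imgP[b _ ->]; rewrite lfunE; exact: tangent_mul3.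
  move=> /(tangent_coneE a0)[b ->]; have := memv_img f (memvf b).
  by rewrite lfunE.
rewrite limg_dim_eq; first by rewrite dimvf /dim /= mul1n.
suff -> : lker f = 0%VS by rewrite capv0.
apply/eqP; rewrite -subv0; apply/subvP => b; rewrite memv_ker lfunE memv0 /=.
move=> /eqP/(congr1 val) /= /eqP; rewrite !mulf_eq0 orbb => /orP[]/eqP/linform_eq0.
  by move=> /eqP; rewrite (negPf a0).
by move/eqP.
Qed.

(** The cone contains the line through every cube, so all cubes are tangent at
    0; by polarization they span the space of cubics, of dimension ten. *)
Lemma tangent_dim_cone0 : ~ tangent_dim cone 0 3.
Proof.
case=> T ET dT.
have TP b : power 3 b \in T.
  have : [set` T] (power 3 b).
    rewrite ET => p Hp; have := @pdiff_curve _ _ p [:: 0; power 3 b] natF_eq0.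
    rewrite /=; apply=> t; apply: Hp; apply/coneP; exists (3.-root t *: b).
    by rewrite !big_ord_recl big_ord0 /= addr0 scaler0 add0r power3Z rootCK.
  by [].
have polar a b c : mul3 a b c = 6^-1 *: (power 3 (a + b + c) - power 3 (a + b)
    - power 3 (a + c) - power 3 (b + c) + power 3 a + power 3 b + power 3 c).
  apply: (@scalerI _ _ (6 : F)); rewrite ?pnatr_eq0 // scalerA divff ?pnatr_eq0 //.
  rewrite scale1r !power3E scaler_nat; apply: val_inj => /=.
  by rewrite !linformD; ring.
suff TW : T = fullv by move: dT; rewrite TW dim_Sym.
apply/eqP; rewrite eqEsubv subvf /=; apply/subvP => u _.
elim/Sym_ind: u => [t u v uT vT||i j k]; [exact: memvD (memvZ _ _) _ | exact: mem0v |].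
by rewrite polar memvZ // !(memvD, memvN, memvB) // TP.
Qed.

End VeroneseCone.

(** * Dimension and smooth points of the Veronese cone *)

Section ConeDimension.
Variable F : numClosedFieldType.
Local Notation vec := 'rV[F]_3.
Local Notation W := (Sym F 3 2).
Local Notation e := (base_vec F).
Local Notation cone := (@cone F).

Definition vcoord (i : 'I_3) (a : vec) : F := a 0 i.

Lemma poly_in_linear (f : {scalar W}) :
  poly_in vcoord (fun a => f (power 3 a)).
Proof.
apply: (@poly_in_ext _ _ _ _ (fun a => \sum_i \sum_j \sum_k
    (vcoord i a * vcoord j a * vcoord k a) * f (mul3 (e i) (e j) (e k)))).
  move=> a; rewrite power3E mul3_sum !linear_sum; apply: eq_bigr => i _ /=.
  rewrite !linear_sum; apply: eq_bigr => j _ /=; rewrite !linear_sum.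
  by apply: eq_bigr => k _ /=; rewrite linearZ.
do 3![apply: poly_in_sum => ? _]; apply: poly_inM; last exact: poly_in_cst.
by apply: poly_inM; [apply: poly_inM|]; exact: poly_in_gen.
Qed.

Lemma poly_in_pval (p : polyfun W) : poly_in vcoord (fun a => pval p (power 3 a)).
Proof.
apply: (@poly_in_trans _ _ _ _ (fun i a => coords (power 3 a) i)).
  by move=> i; exact: (poly_in_linear (coord (vbasis {:W}) i)).
by exists p.
Qed.

(** The entries (0, 0, i) are independent, because a_0 ^ 2 a_i takes every triple
    of values with nonzero first one. Four functions are polynomials in the
    three coordinates of a, hence dependent. *)
Lemma has_dim_cone : has_dim cone 3.
Proof.
split.
  exists (fun i => linpoly (scoef 0 0 i)) => P HP; apply: contrapT => /eqP P0.
  (* The factor 'X_0 provides a point with nonzero first coordinate. *)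
  have : P * 'X_0 != 0 by rewrite mulf_neq0 // -msize_poly_eq0 msizeX.
  move=> /mpoly_neq0_nat[v]; rewrite mevalM mevalXU mulf_eq0 negb_or => /andP[Pv v0].
  pose r := 3.-root ((v 0)%:R : F).
  have r3 : r ^+ 3 = (v 0)%:R by rewrite rootCK.
  have r0 : r != 0 by apply: contra_neq v0 => r0; rewrite -r3 r0 expr0n.
  pose a : vec := \row_i if i == 0 then r else (v i)%:R / r ^+ 2.
  move/eqP: Pv; apply; rewrite -(HP _ (cone_power a)); apply: meval_eq => i.
  rewrite pval_linpoly /= scoef_power !mxE eqxx.
  have [->|i0] := eqVneq i 0; first by rewrite -r3 !exprS expr0 mulr1 mulrA.
  by field.
move=> m f Hf; rewrite leqNgt; apply/negP => lt3m.
have H (i : 'I_4) : poly_in vcoord (fun a => pval (f (widen_ord lt3m i)) (power 3 a)).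
  exact: poly_in_pval.
have [P P0 HP] := poly_in_alg_dep H.
have [v Pv] := mpoly_neq0_nat P0.
(* P, read as a polynomial in all m functions. *)
pose P' : {mpoly F[m]} := P \mPo [tuple 'X_(widen_ord lt3m i) | i < 4].
have P'E x : P'.@[x] = P.@[fun i => x (widen_ord lt3m i)].
  rewrite comp_mpoly_meval; apply: meval_eq => i; by rewrite tnth_mktuple mevalXU.
have P'0 : P' = 0 by apply: Hf => w /coneP[a ->]; rewrite P'E.
pose x (i : 'I_m) : F := if insub (val i) is Some j then (v j)%:R else 0.
move/eqP: Pv; apply; transitivity (P'.@[x]); last by rewrite P'0 meval0.
by rewrite P'E; apply: meval_eq => i; rewrite /x /= valK.
Qed.

Lemma has_dim_inj (G : fieldType) (V : vectType G) (Z : set V) k l :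
  has_dim Z k -> has_dim Z l -> k = l.
Proof.
move=> [[f Hf] Hk] [[g Hg] Hl]; apply/eqP; rewrite eqn_leq.
by rewrite (Hl _ _ Hf) (Hk _ _ Hg).
Qed.

Lemma smooth_coneE w : smooth_locus cone w <-> exists2 a, a != 0 & w = power 3 a.
Proof.
split=> [[/coneP[a ->] [k Hk Tk]]|[a a0 ->]]; last first.
  split; first exact: cone_power.
  by exists 3; [exact: has_dim_cone | exact: tangent_dim_cone].
exists a => //; apply: contraPneq Tk => ->; rewrite power3_0.
by rewrite (has_dim_inj Hk has_dim_cone); exact: tangent_dim_cone0.
Qed.

Lemma ED_criticalE (Q : W -> W -> F) u w :
  ED_critical Q (veronese F 3 2) u w <->
  exists2 a, a != 0 & w = power 3 a /\ forall b, Q (u - w) (mul3 a a b) = 0.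
Proof.
split=> [[/smooth_coneE[a a0 ->] H]|[a a0 [-> H]]].
  by exists a => //; split=> // b; apply: H; exact: tangent_mul3.
split; first by apply/smooth_coneE; exists a.
by move=> v /(tangent_coneE a0)[b ->].
Qed.

End ConeDimension.

(** * Symmetric tensors and the complexified inner product *)

(** The rank of the multiset of i, j, k in lexicographic order: s counts the
    nonzero indices, there are 'C(s.+1, 2) multisets with fewer of them, and
    those with exactly s are ordered by their number of indices 2. *)
Definition tens_index (i j k : 'I_3) : 'I_10 :=
  let s := ((i != 0%N :> nat) + (j != 0%N :> nat) + (k != 0%N :> nat))%N in
  inord ('C(s.+1, 2) + ((i == 2%N :> nat) + (j == 2%N :> nat) + (k == 2%N :> nat)))%N.

Definition tens (K : Type) (c : 'I_10 -> K) (i j k : 'I_3) : K := c (tens_index i j k).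

Lemma tensC12 (K : Type) (c : 'I_10 -> K) i j k : tens c i j k = tens c j i k.
Proof.
rewrite /tens /tens_index; congr (c (inord ('C(_.+1, 2) + _)));
  by congr (_ + _)%N; exact: addnC.
Qed.

Lemma tensC23 (K : Type) (c : 'I_10 -> K) i j k : tens c i j k = tens c i k j.
Proof.
by rewrite /tens /tens_index; congr (c (inord ('C(_.+1, 2) + _))); exact: addnAC.
Qed.

Definition tens_rep (t : 'I_10) : 'I_3 * 'I_3 * 'I_3 :=
  nth (ord0, ord0, ord0)
    [seq (inord x.1.1, inord x.1.2, inord x.2) | x <-
      [:: (0,0,0); (0,0,1); (0,0,2); (0,1,1); (0,1,2); (0,2,2);
          (1,1,1); (1,1,2); (1,2,2); (2,2,2)]%N] t.

Lemma ord3_ind (P : 'I_3 -> Prop) : P (inord 0) -> P (inord 1) -> P (inord 2) -> forall i, P i.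
Proof.
move=> P0 P1 P2 [[|[|[|//]]] lt_i3].
- by rewrite (_ : Ordinal _ = inord 0) //; apply: val_inj; rewrite /= inordK.
- by rewrite (_ : Ordinal _ = inord 1) //; apply: val_inj; rewrite /= inordK.
- by rewrite (_ : Ordinal _ = inord 2) //; apply: val_inj; rewrite /= inordK.
Qed.

Lemma tens_repK t : let x := tens_rep t in tens_index x.1.1 x.1.2 x.2 = t.
Proof.
by case: t => [[|[|[|[|[|[|[|[|[|[|//]]]]]]]]]] lt_t]; apply: val_inj;
  rewrite /tens_rep /tens_index /= !inordK.
Qed.

Lemma tens_symE (K : Type) (f : 'I_3 -> 'I_3 -> 'I_3 -> K) :
  (forall i j k, f i j k = f j i k) -> (forall i j k, f i j k = f i k j) ->
  forall i j k, tens (fun t => let x := tens_rep t in f x.1.1 x.1.2 x.2) i j k = f i j k.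
Proof.
move=> f12 f23; rewrite /tens /tens_rep /tens_index.
move=> i j k; elim/ord3_ind: i; elim/ord3_ind: j; elim/ord3_ind: k.
all: rewrite !inordK //=.
all: first [by rewrite [RHS]f12 [RHS]f23 | by rewrite [RHS]f23 [RHS]f12
  | by rewrite [RHS]f12 [RHS]f23 [RHS]f12].
Qed.

Lemma mcoeff_indhomog (K : fieldType) (n m : 'X_{1..3}) :
  (val (indhomog 3 'X_[n] : Sym K 3 2) : {mpoly K[3]})@_m = ((mdeg n == 3%N) && (n == m))%:R.
Proof.
have [dn|dn] /= := eqVneq (mdeg n) 3%N.
  by rewrite insubdK ?mcoeffX // unfold_in /= dhomogX /= dn.
by rewrite /indhomog /insubd insubN ?dhomogX //= mcoeff0.
Qed.

Section Complexification.
Variables (R : realType) (Q : inner_product (Sym R 3 2)).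
Local Notation C := R[i].
Local Notation QC := (complexify Q).
Local Notation toC := (real_complex R).
Local Notation m3 i j k := (mul3 (base_vec _ i) (base_vec _ j) (base_vec _ k)).
Implicit Types (u v w : Sym C 3 2).

Lemma inner_sym (x y : Sym R 3 2) : Q x y = Q y x.
Proof. by rewrite hermC expr0 mul1r. Qed.

Lemma inner_gt0 (x : Sym R 3 2) : x != 0 -> 0 < Q x x.
Proof. exact: neq0_dnorm_gt0. Qed.

Lemma complexify_linr u : scalar (QC u).
Proof.
move=> t v w; rewrite /complexify mulr_sumr -big_split; apply: eq_bigr => a _ /=.
rewrite mulr_sumr -big_split; apply: eq_bigr => b _ /=.
by rewrite mcoeffD mcoeffZ; ring.
Qed.
HB.instance Definition _ u :=
  GRing.isLinear.Build C (Sym C 3 2) C _ (QC u) (complexify_linr u).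

Lemma complexify_sym u v : QC u v = QC v u.
Proof.
rewrite /complexify exchange_big; apply: eq_bigr => a _; apply: eq_bigr => b _ /=.
by rewrite inner_sym; ring.
Qed.

Lemma complexify_mul3 i j k l m n : QC (m3 i j k) (m3 l m n) = toC (Q (m3 i j k) (m3 l m n)).
Proof.
rewrite -!indhomog_mnm3 /complexify.
set M := (U_(i) + U_(j) + U_(k))%MM; set N := (U_(l) + U_(m) + U_(n))%MM.
have dM : (mdeg M < 4)%N by rewrite !mdegD !mdeg1.
have dN : (mdeg N < 4)%N by rewrite !mdegD !mdeg1.
rewrite (bigD1 (BMultinom dM)) //= (bigD1 (BMultinom dN)) //=.
rewrite !mcoeff_indhomog !mdegD !mdeg1 /= !eqxx !mul1r.
rewrite !big1 ?addr0 // => [x xM|x xN].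
  rewrite big1 // => y _; rewrite mcoeff_indhomog (_ : (M == x :> 'X_{1..3}) = false).
    by rewrite andbF !mul0r.
  by apply/negbTE; apply: contra xM => /eqP xM; apply/eqP/val_inj.
rewrite !mcoeff_indhomog (_ : (N == x :> 'X_{1..3}) = false) ?andbF ?mulr0 ?mul0r //.
by apply/negbTE; apply: contra xN => /eqP xN; apply/eqP/val_inj.
Qed.

Definition re_part u : Sym R 3 2 :=
  \sum_(m : 'X_{1..3 < 4}) complex.Re ((u : dhomog _ _ _)@_m) *: (indhomog 3 'X_[m] : Sym R 3 2).
Definition im_part u : Sym R 3 2 :=
  \sum_(m : 'X_{1..3 < 4}) complex.Im ((u : dhomog _ _ _)@_m) *: (indhomog 3 'X_[m] : Sym R 3 2).

(** The products of basis vectors are real, so pairing with them separates the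
    real and the imaginary part of u. *)
Lemma complexify_mul3r u i j k :
  QC u (m3 i j k) = (Q (re_part u) (m3 i j k) +i* Q (im_part u) (m3 i j k))%C.
Proof.
pose q (m : 'X_{1..3 < 4}) := Q (indhomog 3 'X_[m]) (m3 i j k).
have ReE : Q (re_part u) (m3 i j k) = \sum_(m : 'X_{1..3 < 4}) complex.Re ((u : dhomog _ _ _)@_m) * q m.
  rewrite inner_sym linear_sum; apply: eq_bigr => m _ /=.
  by rewrite linearZ /= inner_sym.
have ImE : Q (im_part u) (m3 i j k) = \sum_(m : 'X_{1..3 < 4}) complex.Im ((u : dhomog _ _ _)@_m) * q m.
  rewrite inner_sym linear_sum; apply: eq_bigr => m _ /=.
  by rewrite linearZ /= inner_sym.
have -> : QC u (m3 i j k) = \sum_(m : 'X_{1..3 < 4}) (u : dhomog _ _ _)@_m * toC (q m).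
  rewrite complexify_sym {1}(Sym_sum u) linear_sum; apply: eq_bigr => m _ /=.
  rewrite linearZ /=; congr (_ * _); rewrite complexify_sym /q.
  have [/mnm3P[[[a b] c] ->]|dm] := eqVneq (mdeg m) 3%N.
    by rewrite !indhomog_mnm3 complexify_mul3.
  rewrite /indhomog /insubd !insubN ?dhomogX //= complexify_sym linear0.
  by rewrite inner_sym linear0.
apply/eqP; rewrite eq_complex /= ReE ImE; apply/andP; split; apply/eqP.
  rewrite (raddf_sum (@complex.Re R)); apply: eq_bigr => m _.
  by case: (_ @_ _) => x y /=; rewrite mulr0 subr0.
rewrite (raddf_sum (@complex.Im R)); apply: eq_bigr => m _.
by case: (_ @_ _) => x y /=; rewrite mulr0 add0r.
Qed.

Lemma inner_nondeg (x : Sym R 3 2) : (forall i j k, Q x (m3 i j k) = 0) -> x = 0.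
Proof.
move=> H; have H' y : Q x y = 0.
  by elim/Sym_ind: y => [t y z Hy Hz||//]; rewrite ?linearP ?linear0 /= ?Hy ?Hz ?mulr0 ?addr0.
by apply: contrapT => /eqP/inner_gt0; rewrite H' ltxx.
Qed.

(** The real and the imaginary part of u are orthogonal to a spanning family of
    real cubics, hence zero by positive definiteness. *)
Lemma complexify_nondeg u : (forall i j k, QC u (m3 i j k) = 0) -> u = 0.
Proof.
move=> H.
have re0 : re_part u = 0.
  by apply: inner_nondeg => i j k; have := H i j k; rewrite complexify_mul3r => -[].
have im0 : im_part u = 0.
  by apply: inner_nondeg => i j k; have := H i j k; rewrite complexify_mul3r => -[].
apply: val_inj; apply/mpolyP => m; rewrite mcoeff0.
have [dm|dm] := eqVneq (mdeg m) 3%N; last exact: dhomog_nemf_coeff (valP u) dm.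
have dm4 : (mdeg m < 4)%N by rewrite dm.
have E (f : {mpoly C[3]} -> 'X_{1..3} -> R) :
    \sum_(n : 'X_{1..3 < 4}) f (val u) n *: (indhomog 3 'X_[n] : Sym R 3 2) = 0 ->
    f (val u) m = 0.
  move=> /(congr1 (fun x : Sym R 3 2 => (val x : {mpoly R[3]})@_m)).
  rewrite mcoeff0 !raddf_sum (bigD1 (BMultinom dm4)) //= mcoeffZ.
  rewrite mcoeff_indhomog /= dm !eqxx mulr1 big1 ?addr0 // => n nm.
  rewrite mcoeffZ mcoeff_indhomog (_ : (n == m :> 'X_{1..3}) = false) ?andbF ?mulr0 //.
  by apply/negbTE; apply: contra nm => /eqP nm; apply/eqP/val_inj.
have := E (fun p n => complex.Re p@_n) re0; have := E (fun p n => complex.Im p@_n) im0.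
by case: (_ @_ _) => x y /= -> ->.
Qed.

(** The linear form Q(u, -), as a symmetric tensor. *)
Definition tens_of u (t : 'I_10) : C :=
  let x := tens_rep t in QC u (m3 x.1.1 x.1.2 x.2).

Lemma tens_ofE u i j k : tens (tens_of u) i j k = QC u (m3 i j k).
Proof.
apply: (@tens_symE _ (fun i j k => QC u (m3 i j k))) => {}i {}j {}k.
  by rewrite mul3C.
by rewrite mul3CA.
Qed.

(** By nondegeneracy the linear map tens_of is injective, between spaces of
    dimension ten. *)
Lemma tens_of_surj (c : 'I_10 -> C) : exists u, forall t, tens_of u t = c t.
Proof.
have L_lin : linear (fun u => \row_t tens_of u t : 'rV[C]_10).
  move=> t u v; apply/rowP => i; rewrite !mxE /tens_of.
  by rewrite !(complexify_sym _ (m3 _ _ _)) linearP.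
pose Lm := GRing.isLinear.Build C (Sym C 3 2) 'rV[C]_10 _ _ L_lin.
pose LL : {linear Sym C 3 2 -> 'rV[C]_10} := HB.pack (fun u => \row_t tens_of u t : 'rV[C]_10) Lm.
pose f : 'Hom(Sym C 3 2, 'rV[C]_10) := linfun LL.
have kf : lker f = 0%VS.
  apply/eqP; rewrite -subv0; apply/subvP => u; rewrite memv_ker lfunE memv0 /=.
  move/eqP/rowP => H; apply/eqP; apply: complexify_nondeg => i j k.
  by rewrite -tens_ofE /tens; have := H (tens_index i j k); rewrite !mxE.
have /eqP lf : limg f == fullv.
  by rewrite eqEdim subvf limg_dim_eq ?kf ?capv0 // dim_Sym dimvf /dim /= mul1n.
have : (\row_t c t) \in limg f by rewrite lf memvf.
move=> /memv_imgP[u _ cu]; exists u => t.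
by have := congr1 (fun r : 'rV[C]_10 => r 0 t) cu; rewrite lfunE !mxE.
Qed.

Lemma tens_of_linpoly t : {p : polyfun (Sym C 3 2) | forall u, pval p u = tens_of u t}.
Proof.
exists (linpoly (QC (let x := tens_rep t in m3 x.1.1 x.1.2 x.2))) => u.
by rewrite pval_linpoly /= complexify_sym.
Qed.

(** The tensor of Q(u, -) replaces u as the parameter of the problem; its ten
    entries are linear coordinates on the space of all u. *)
Lemma for_general_tens (P : ('I_10 -> C) -> Prop) :
  generic P -> for_general (fun u : Sym C 3 2 => P (tens_of u)).
Proof.
move=> [g g0 Hg].
pose p : polyfun (Sym C 3 2) := g \mPo [tuple sval (tens_of_linpoly t) | t < 10].
have pE u : pval p u = g.@[tens_of u].
  rewrite /pval comp_mpoly_meval; apply: meval_eq => t.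
  by rewrite tnth_mktuple; exact: svalP (tens_of_linpoly t) u.
exists p; last by move=> u; rewrite pE; exact: Hg.
have [v] := mpoly_neq0_nat g0; apply: contra_neq => p0.
have [u Hu] := tens_of_surj (fun t => (v t)%:R).
by rewrite -(meval_eq _ Hu) -pE p0 /pval meval0.
Qed.

End Complexification.

(** * The critical equations, and the dichotomy for their number of solutions *)

(** The k-th coordinate of the linear form c(a, a, -). *)
Definition tcontr (K : comNzRingType) (c : 'I_10 -> K) (k : 'I_3) (a : 'rV[K]_3) : K :=
  \sum_i \sum_j tens c i j k * (a 0 i * a 0 j).

Lemma tcontrZ (K : comNzRingType) (c : 'I_10 -> K) k t a :
  tcontr c k (t *: a) = t ^+ 2 * tcontr c k a.
Proof.
rewrite /tcontr mulr_sumr; apply: eq_bigr => i _; rewrite mulr_sumr.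
by apply: eq_bigr => j _; rewrite !mxE; ring.
Qed.

Section TensorSystem.
Variable F : numClosedFieldType.
Local Notation vec := 'rV[F]_3.
Local Notation W := (Sym F 3 2).
Local Notation ix := tens_index.

Variable p : 'I_3 -> vec -> F.
Hypothesis p_poly : forall k, poly_in (@vcoord F) (p k).

(** If c is the tensor of Q(u, -) and p k a = Q(a ^ 3, a ^ 2 e_k), these equations
    say that a ^ 3 is critical for u. *)
Definition tsys (c : 'I_10 -> F) (a : vec) : Prop :=
  a != 0 /\ forall k, tcontr c k a = p k a.

(** Solutions are counted by their cubes, as critical points are: multiplying a
    by a cube root of unity does not change the critical point. *)
Definition atleast (N : nat) (c : 'I_10 -> F) : Prop :=
  exists f : 'I_N -> vec,
    (forall i, tsys c (f i)) /\ injective (fun i => power 3 (f i)).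

Lemma power3_eqP (a b : vec) : (forall i j k, a 0 i * a 0 j * a 0 k = b 0 i * b 0 j * b 0 k)
  <-> power 3 a = power 3 b.
Proof.
split=> [H|H i j k]; last by rewrite -!scoef_power H.
apply/eqP; rewrite -subr_eq0; apply/eqP/scoef_inj => i j k.
by rewrite linearB /= !scoef_power H subrr.
Qed.

(** Having N solutions is a first-order property of the parameters, since cubes
    are compared through the entries of their tensors. *)
Theorem atleast_generic N : generic (atleast N) \/ generic (fun c => ~ atleast N c).
Proof.
(* The i-th vector is stored in the three variables from 10 + 3 * i on, after
   the ten parameters. *)
pose va (e : nat -> F) (i : 'I_N) : vec := \row_j e (10 + (3 * i + j))%N.
pose M := (10 + 3 * N)%N.
have pe n : (n < M)%N -> poly_in (fun (i : 'I_M) (e : nat -> F) => e i) (fun e => e n).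
  by move=> nM; exact: (poly_in_gen (fun (i : 'I_M) (e : nat -> F) => e i) (Ordinal nM)).
have pv i j : poly_in (fun (i : 'I_M) (e : nat -> F) => e i) (fun e => va e i 0 j).
  apply: (poly_in_ext (f := fun e => e (10 + (3 * i + j))%N)); first by move=> e; rewrite mxE.
  apply: pe; rewrite ltn_add2l; have := ltn_ord i; have := ltn_ord j; lia.
have pc i : poly_in (fun (i : 'I_M) (e : nat -> F) => e i)
    (fun e : nat -> F => (fun t : 'I_10 => e t) i).
  by apply: pe; rewrite (leq_trans (ltn_ord i)) // leq_addr.
pose D1 e := forall i : 'I_N, ~ (forall j, va e i 0 j = 0) /\
  forall k, tcontr (fun t => e t) k (va e i) - p k (va e i) = 0.
pose D2 e := forall i j : 'I_N, ~ (i <> j /\ forall k l m,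
  va e i 0 k * va e i 0 l * va e i 0 m - va e j 0 k * va e j 0 l * va e j 0 m = 0).
pose D e := D1 e /\ D2 e.
have defD : definable D.
  apply: definable_and; apply: definable_forall => i.
    apply: definable_and.
      by apply/definable_not/definable_forall => j; exact: definable_eq0 (pv _ _).
    apply: definable_forall => k; apply: (@definable_eq0 _ M); apply: poly_inB.
      apply: poly_in_sum => j _; apply: poly_in_sum => l _.
      by apply: poly_inM; [exact: pc | apply: poly_inM; exact: pv].
    apply: (poly_in_trans (x := fun j e => vcoord j (va e i))) => [j|]; first exact: pv.
    exact: (poly_in_comp (fun e => va e i) (p_poly k)).
  apply: definable_forall => j; apply: definable_not.
  case: (pselect (i = j)) => ij.
    by exists (GRing.Bool false) => e /=; split=> // -[].
  apply: (@definable_ext _ (fun e => forall k l m : 'I_3,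
     va e i 0 k * va e i 0 l * va e i 0 m - va e j 0 k * va e j 0 l * va e j 0 m = 0)).
    by move=> e; split=> [|[]].
  do 3![apply: definable_forall => ?]; apply: (@definable_eq0 _ M).
  by apply: poly_inB; apply: poly_inM => //; apply: poly_inM.
have vaE e e' i : (forall n, (n < M)%N -> e n = e' n) -> va e i = va e' i.
  move=> ee; apply/rowP => j; rewrite !mxE; apply: ee.
  rewrite ltn_add2l; have := ltn_ord i; have := ltn_ord j; lia.
have Dext e e' : (forall n, (n < 10 + 3 * N)%N -> e n = e' n) -> D e -> D e'.
  move=> ee [H1 H2]; split=> [i|i j]; rewrite -!(vaE _ _ _ ee).
    have [Ha Hb] := H1 i; split=> // k; rewrite -(Hb k).
    congr (_ - _); apply: eq_bigr => x _; apply: eq_bigr => y _; congr (_ * _).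
    by rewrite /tens ee // (leq_trans (ltn_ord _)) // leq_addr.
  exact: H2.
have [] := definable_generic 10 (definable_exists Dext defD) => H; [left|right];
    apply: genericS H => c.
- move=> [e' e'c [H1 H2]].
  have ce : (fun t : 'I_10 => e' t) = c.
    apply/funext => t; rewrite e'c // /extend0 insubT //= => lt.
    by congr c; apply: val_inj.
  exists (va e'); split=> [i|i j /power3_eqP H].
    have [Ha Hb] := H1 i; split.
      by apply/eqP => v0; apply: Ha => j; rewrite v0 mxE.
    by move=> k; apply/eqP; rewrite -subr_eq0 -ce Hb.
  apply: contrapT => ij; apply: (H2 i j); split=> // k l m.
  by rewrite H subrr.
- apply: contra_not => -[f [Hf f_inj]].
  pose e' n := if (n < 10)%N then extend0 c n else
    (if insub ((n - 10) %/ 3)%N is Some i then f i else 0) 0 (inord ((n - 10) %% 3)).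
  have vf i : va e' i = f i.
    apply/rowP => j; rewrite mxE /e' ltnNge leq_addr /= addKn.
    have -> : ((3 * i + j) %/ 3 = i)%N by rewrite mulnC divnMDl // divn_small // addn0.
    have -> : ((3 * i + j) %% 3 = j)%N by rewrite mulnC modnMDl modn_small.
    by rewrite valK inord_val.
  have ec : (fun t : 'I_10 => e' t) = c.
    apply/funext => t; rewrite /e' ltn_ord /extend0 insubT //= => lt.
    by congr c; apply: val_inj.
  exists e'; first by move=> n n10; rewrite /e' n10.
  split=> [i|i j [ij]]; rewrite ?vf.
    have [a0 Ha] := Hf i; split; last by move=> k; rewrite ec Ha subrr.
    by move=> v0; move/eqP: a0; apply; apply/rowP => j; rewrite v0 mxE.
  move=> H; apply: ij; apply: f_inj; apply/power3_eqP => k l m.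
  by apply/eqP; rewrite -subr_eq0 H.
Qed.

End TensorSystem.

(** * The number of solutions is generically bounded *)

(** Where the leading coefficient of P in the last variable does not vanish, the
    possible values of that variable are the roots of a nonzero polynomial of
    bounded degree. *)
Lemma algebraic_generic (F : closedFieldType) n (P : {mpoly F[n.+1]}) : P != 0 ->
  exists N, generic (fun c : 'I_n -> F => exists2 r : seq F, (size r <= N)%N &
    forall v : 'I_n.+1 -> F, (forall i, v (widen_ord (leqnSn _) i) = c i) ->
      P.@[v] = 0 -> v ord_max \in r).
Proof.
move=> P0; have mP0 : muni P != 0 by apply: contra_neq P0; exact: muni_eq0.
exists (size (muni P)).
exists (lead_coef (muni P)); first by rewrite lead_coef_eq0.
move=> c Hc; pose q := map_poly (meval c) (muni P).
have q0 : q != 0.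
  apply: contra_neq Hc => /(congr1 (fun q : {poly F} => q`_(size (muni P)).-1)).
  by rewrite coef_map coef0.
have [r qE] := closed_field_poly_normal q.
exists r.
  apply: (@leq_trans (size q)); last by rewrite size_poly.
  rewrite qE size_scale ?lead_coef_eq0 // size_prod_XsubC; exact: leqnSn.
move=> v vc Pv; have : root q (v ord_max).
  rewrite rootE -Pv -horner_muni; apply/eqP; congr (_.[_]).
  by apply: eq_map_poly => x; apply: meval_eq => i; rewrite vc.
by rewrite qE rootZ ?lead_coef_eq0 // root_prod_XsubC.
Qed.

Lemma tens_index_inj (k i j : 'I_3) : tens_index k k i = tens_index k k j -> i = j.
Proof.
move/(congr1 val); rewrite /tens_index.
by elim/ord3_ind: i; elim/ord3_ind: j; elim/ord3_ind: k; rewrite !inordK //= !inordK.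
Qed.

Lemma tens_index_neq (k i l j m : 'I_3) : j != k -> (i != k) || (l != k) ->
  tens_index i l j != tens_index k k m.
Proof.
move=> jk ilk; apply/eqP => /(congr1 val); move: jk ilk; rewrite /tens_index -!val_eqE.
by elim/ord3_ind: i; elim/ord3_ind: j; elim/ord3_ind: k; elim/ord3_ind: l;
  elim/ord3_ind: m; rewrite /= !inordK //= !inordK.
Qed.

Section Bound.
Variable F : numClosedFieldType.
Local Notation vec := 'rV[F]_3.
Local Notation W := (Sym F 3 2).
Local Notation ix := tens_index.
Variable p : 'I_3 -> vec -> F.
Hypothesis p_poly : forall k, poly_in (@vcoord F) (p k).
Hypothesis p_homog : forall k t a, p k (t *: a) = t ^+ 5 * p k a.

Section Chart.
Variable k : 'I_3.

(** The solutions a with a_k <> 0, in the coordinates s = a_k ^ 3 and d = a / a_k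
    of the cone. By homogeneity c(a, a, e_j) = p_j(a) becomes
    c(d, d, e_j) = s p_j(d). *)
Definition chart_sol (x : ('I_10 -> F) * F * vec) : Prop :=
  x.2 0 k = 1 /\ forall j, tcontr x.1.1 j x.2 = x.1.2 * p j x.2.
Let T := {x | chart_sol x}.
Let tc (t : 'I_10) (x : T) : F := (sval x).1.1 t.
Let ts (x : T) : F := (sval x).1.2.
Let td (j : 'I_3) (x : T) : F := (sval x).2 0 j.

(** As d_k = 1, the equations express the entries (k, k, j) of c through the other
    seven, s and the two free coordinates of d. These ten functions generate;
    s and the d_j are stored in the slots of the eliminated entries. *)
Let gen (t : 'I_10) (x : T) : F :=
  if [pick j | ix k k j == t] is Some j then if j == k then ts x else td j x
  else tc t x.

Let gen_kk j x : gen (ix k k j) x = if j == k then ts x else td j x.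
Proof.
rewrite /gen; case: pickP => [i /eqP/tens_index_inj -> //|/(_ j)].
by rewrite eqxx.
Qed.

Let poly_ts : poly_in gen ts.
Proof.
by apply: poly_in_ext (poly_in_gen gen (ix k k k)) => x; rewrite gen_kk eqxx.
Qed.

Let poly_td j : poly_in gen (td j).
Proof.
have [->|jk] := eqVneq j k.
  apply: poly_in_ext (poly_in_cst gen 1) => x; rewrite /td.
  by have [-> _] := svalP x.
by apply: poly_in_ext (poly_in_gen gen (ix k k j)) => x; rewrite gen_kk (negPf jk).
Qed.

Let poly_p j : poly_in gen (fun x => p j (sval x).2).
Proof.
apply: (poly_in_trans (x := fun i x => td i x)); first exact: poly_td.
exact: (poly_in_comp (fun x : T => (sval x).2) (p_poly j)).
Qed.

Let tcE j x : tc (ix k k j) x = ts x * p j (sval x).2 -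
  \sum_(i | true) \sum_(l | (i != k) || (l != k)) tc (ix i l j) x * (td i x * td l x).
Proof.
have [dk /(_ j) E] := svalP x; rewrite -[_ * p _ _]E /tcontr.
under eq_bigr => i _ do rewrite (bigID (fun l => (i != k) || (l != k))) /=.
rewrite big_split /= [X in X + _ - _](_ : _ = \sum_i \sum_(l | (i != k) || (l != k))
  tc (ix i l j) x * (td i x * td l x)) // addrC addKr.
rewrite (bigD1 k) //= [X in _ + X]big1 ?addr0 => [|i ik]; last first.
  by rewrite big_pred0 // => l; rewrite ik.
rewrite (big_pred1 k) => [|l]; last by rewrite eqxx /= negbK.
by rewrite dk !mulr1.
Qed.

Let poly_tc_free t : (forall m, t != ix k k m) -> poly_in gen (tc t).
Proof.
move=> tk; apply: poly_in_ext (poly_in_gen gen t) => x; rewrite /gen.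
by case: pickP => // m /eqP mt; have := tk m; rewrite mt eqxx.
Qed.

Let poly_tc_kkj j : j != k -> poly_in gen (tc (ix k k j)).
Proof.
move=> jk; apply: poly_in_ext (fun x => esym (tcE j x)) _.
apply: poly_inB; first exact: poly_inM poly_ts (poly_p j).
apply: poly_in_sum => i _; apply: poly_in_sum => l il.
apply: poly_inM; last exact: poly_inM.
by apply: poly_tc_free => m; exact: tens_index_neq.
Qed.

Let poly_tc_gen i j l : [|| i != k, j != k | l != k] -> poly_in gen (tc (ix i j l)).
Proof.
have C12 a b c : ix a b c = ix b a c by exact: (tensC12 id).
have C23 a b c : ix a b c = ix a c b by exact: (tensC23 id).
have two a b c : b != k -> c != k -> poly_in gen (tc (ix a b c)).
  by move=> bk ck; apply: poly_tc_free => m; apply: tens_index_neq; rewrite ?bk ?orbT.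
have [->|ik] := eqVneq i k; have [->|jk] := eqVneq j k; have [->|lk] := eqVneq l k => //= _.
- exact: poly_tc_kkj.
- by rewrite C23; exact: poly_tc_kkj.
- exact: two.
- by rewrite C12 C23; exact: poly_tc_kkj.
- by rewrite C12; exact: two.
- by rewrite C23 C12; apply: two.
- exact: two.
Qed.

Let poly_tc t : poly_in gen (tc t).
Proof.
rewrite -(tens_repK t); set i := _.1.1; set j := _.1.2; set l := _.2.
have [|/norP[/negPn/eqP-> /norP[/negPn/eqP-> /negPn/eqP->]]] :=
  boolP [|| i != k, j != k | l != k]; first exact: poly_tc_gen.
apply: poly_in_ext (fun x => esym (tcE k x)) _.
apply: poly_inB; first exact: poly_inM poly_ts (poly_p k).
apply: poly_in_sum => a _; apply: poly_in_sum => b ab.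
apply: poly_inM; last exact: poly_inM.
by apply: poly_tc_gen; rewrite orbA ab.
Qed.

(** The ten parameters and h are eleven polynomials in ten generators, hence
    satisfy a polynomial relation, which leaves h boundedly many values over a
    general parameter. *)
Let finite_values (h : T -> F) : poly_in gen h ->
  exists N, generic (fun c => exists2 r : seq F, (size r <= N)%N &
    forall x : T, (sval x).1.1 = c -> h x \in r).
Proof.
move=> ph.
pose f (i : 'I_11) (x : T) := if unlift ord_max i is Some t then tc t x else h x.
have [i|P P0 HP] := @poly_in_alg_dep F T 10 gen f.
  by rewrite /f; case: unlift => [t|//]; exact: poly_tc.
have [N HN] := algebraic_generic P0; exists N; apply: genericS HN => c [r rN Hr].
exists r => // x xc; have := Hr (fun i => f i x) _ (HP x).
rewrite /f unlift_none; apply=> i.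
rewrite (_ : widen_ord _ i = lift ord_max i) ?liftK /tc ?xc //.
by apply: val_inj => /=; rewrite /bump leqNgt ltn_ord.
Qed.

Lemma chart_bound : exists N, generic (fun c => exists2 L : seq W, (size L <= N)%N &
  forall a, tsys p c a -> a 0 k != 0 -> power 3 a \in L).
Proof.
have [N HN] := finite_values poly_ts.
have [N0 H0] := finite_values (poly_td (inord 0)).
have [N1 H1] := finite_values (poly_td (inord 1)).
have [N2 H2] := finite_values (poly_td (inord 2)).
exists (N * (N0 * (N1 * N2)))%N.
apply: genericS (generic_and HN (generic_and H0 (generic_and H1 H2))).
move=> c [[r rN Hr] [[r0 rN0 Hr0] [[r1 rN1 Hr1] [r2 rN2 Hr2]]]].
pose mk (s x y z : F) : W := s *: power 3 (\row_j nth 0 [:: x; y; z] j).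
exists [seq mk q.1 q.2.1 q.2.2.1 q.2.2.2 |
   q <- [seq (s, xyz) | s <- r, xyz <- [seq (x, yz) | x <- r0, yz <-
     [seq (y, z) | y <- r1, z <- r2]]]].
  by rewrite size_map !size_allpairs !leq_mul.
move=> a [a0 Ha] ak; pose d : vec := (a 0 k)^-1 *: a.
have ad : a = a 0 k *: d by rewrite scalerA divff // scale1r.
have Hx : chart_sol (c, a 0 k ^+ 3, d).
  split=> [|j] /=; first by rewrite mxE mulVf.
  have := Ha j; rewrite ad tcontrZ p_homog -[a 0 k *: d]ad => E.
  apply: (@mulfI _ (a 0 k ^+ 2)); first by rewrite expf_neq0.
  by rewrite E; ring.
pose x : T := exist _ _ Hx.
apply/mapP; exists (a 0 k ^+ 3, (d 0 (inord 0), (d 0 (inord 1), d 0 (inord 2)))).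
  apply/allpairsP; exists (a 0 k ^+ 3, (d 0 (inord 0), (d 0 (inord 1), d 0 (inord 2)))).
  split=> //=; first exact: (Hr x).
  apply/allpairsP; exists (d 0 (inord 0), (d 0 (inord 1), d 0 (inord 2))).
  split=> //=; first exact: (Hr0 x).
  apply/allpairsP; exists (d 0 (inord 1), d 0 (inord 2)).
  by split=> //=; [exact: (Hr1 x) | exact: (Hr2 x)].
rewrite /mk /= {1}ad power3Z; congr (_ *: power 3 _); apply/rowP.
by apply: ord3_ind; rewrite [RHS]mxE inordK.
Qed.

End Chart.

(** Every solution lies in one of the three charts. *)
Theorem bounded_solutions : exists N, generic (fun c => ~ atleast p N c).
Proof.
have H k := chart_bound k.
have [N HN] : {N : 'I_3 -> nat & forall k, generic (fun c => exists2 L : seq W, (size L <= N k)%N &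
  forall a, tsys p c a -> a 0 k != 0 -> power 3 a \in L)}.
  have h k := cid (H k).
  by exists (fun k => sval (h k)) => k; exact: svalP (h k).
exists (\sum_k N k).+1; apply: genericS (generic_forall HN) => c Hc [f [Hf f_inj]].
have [L HL] : {L : 'I_3 -> seq W & forall k, (size (L k) <= N k)%N /\
  forall a, tsys p c a -> a 0 k != 0 -> power 3 a \in L k}.
  have h k : {L : seq W | (size L <= N k)%N /\
      forall a, tsys p c a -> a 0 k != 0 -> power 3 a \in L}.
    by apply: cid; have [L L1 L2] := Hc k; exists L.
  by exists (fun k => sval (h k)) => k; exact: svalP (h k).
pose LL := flatten [seq L k | k <- enum 'I_3].
have sLL : (size LL <= \sum_k N k)%N.
  rewrite size_flatten /shape -map_comp sumnE big_map big_enum /=.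
  by apply: leq_sum => k _; case: (HL k).
have : (size [seq power 3 (f i) | i <- enum 'I_(\sum_k N k).+1] <= size LL)%N.
  apply: uniq_leq_size; first by rewrite map_inj_uniq ?enum_uniq.
  move=> w /mapP[i _ ->]; have [a0 _] := Hf i.
  have [k ak] : exists k, f i 0 k != 0.
    apply: contrapT => /forallNP H0; move/eqP: a0; apply; apply/rowP => k.
    by rewrite mxE; apply: contrapT => /eqP; exact: H0.
  apply/flatten_mapP; exists k; first by rewrite mem_enum.
  by have [_ ->] := HL k.
by rewrite size_map size_enum_ord leqNgt ltnS sLL.
Qed.

End Bound.

(** * The generic number of critical points *)

(** Take for k the largest number such that k solutions exist generically: by
    the dichotomy, k + 1 solutions then generically do not exist. *)
Lemma exact_count (F : numClosedFieldType) (p : 'I_3 -> 'rV[F]_3 -> F) :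
  (forall k, poly_in (@vcoord F) (p k)) ->
  (forall k t a, p k (t *: a) = t ^+ 5 * p k a) ->
  exists k, generic (fun c => atleast p k c /\ ~ atleast p k.+1 c).
Proof.
move=> p_poly p_homog.
have [N HN] := bounded_solutions p_poly p_homog.
elim: N HN => [|N IH] HN.
  have [g g0 Hg] := HN; have [v Hv] := mpoly_neq0_nat g0.
  by case: (Hg _ Hv); exists (fun=> 0); split=> -[].
have [H|/IH//] := atleast_generic p_poly N.
by exists N; exact: generic_and.
Qed.

(** Two nonempty Zariski open subsets of affine space meet. *)
Lemma generic_contra (F : numClosedFieldType) n (P : ('I_n -> F) -> Prop) :
  generic P -> generic (fun c => ~ P c) -> False.
Proof.
move=> HP /(generic_and HP) [g g0 Hg].
by have [v /Hg[]] := mpoly_neq0_nat g0.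
Qed.

Lemma atleastS (F : numClosedFieldType) (p : 'I_3 -> 'rV[F]_3 -> F) m n c :
  (m <= n)%N -> atleast p n c -> atleast p m c.
Proof.
move=> mn [f [Hf f_inj]]; exists (fun i => f (widen_ord mn i)); split=> // i j /f_inj.
by move/(congr1 val) => /= ij; exact: val_inj.
Qed.

Lemma card_eq_atleast (F : numClosedFieldType) (p : 'I_3 -> 'rV[F]_3 -> F) k c :
  atleast p k c -> ~ atleast p k.+1 c ->
  ([set w | exists2 a, tsys p c a & w = power 3 a] #= `I_k)%card.
Proof.
move=> [f [Hf f_inj]] Hn; set A := (X in (X #= _)%card).
pose g (n : nat) : Sym F 3 2 := if insub n is Some i then power 3 (f i) else 0.
have -> : A = g @` `I_k.
  apply/seteqP; split=> [w [a Ha ->]|w [n /= nk <-]]; last first.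
    by rewrite /g insubT /=; exists (f (Sub n nk)).
  apply: contrapT => Hw; apply: Hn.
  exists (fun i => if unlift ord_max i is Some j then f j else a); split=> [i|i j].
    by case: unliftP.
  have Ha' l : power 3 (f l) <> power 3 a.
    by move=> E; apply: Hw; exists (val l); rewrite //= /g valK E.
  case: unliftP => [i' ->|->]; case: unliftP => [j' ->|->] //.
  - by move/f_inj ->.
  - by move/Ha'.
  - by move/esym/Ha'.
apply: inj_card_eq => m n; rewrite !inE /= => mk nk.
rewrite /g (insubT (fun n => n < k)%N mk) (insubT (fun n => n < k)%N nk) => /f_inj.
by move/(congr1 val).
Qed.

Section EDdegreeCount.
Variables (R : realType) (Q : inner_product (Sym R 3 2)).
Local Notation C := R[i].
Local Notation QC := (complexify Q).
Local Notation X := (veronese C 3 2).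
Local Notation e := (base_vec C).

Lemma complexifyZr u (t : C) v : QC u (t *: v) = t * QC u v.
Proof. by have := complexify_linr Q u t v 0; rewrite !addr0 linear0 addr0. Qed.

(** A sixth of the k-th partial derivative of a |-> Q(a ^ 3, a ^ 3). *)
Definition dquad (k : 'I_3) (a : 'rV[C]_3) : C := QC (power 3 a) (mul3 a a (e k)).

Lemma complexify_sum6 (a b c a' b' c' : 'rV[C]_3) :
  QC (mul3 a b c) (mul3 a' b' c') =
  \sum_i \sum_j \sum_k \sum_l \sum_m \sum_o
   (a 0 i * b 0 j * c 0 k) * ((a' 0 l * b' 0 m * c' 0 o) *
     QC (mul3 (e i) (e j) (e k)) (mul3 (e l) (e m) (e o))).
Proof.
rewrite (mul3_sum a) complexify_sym linear_sum; apply: eq_bigr => i _ /=.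
rewrite linear_sum; apply: eq_bigr => j _ /=.
rewrite linear_sum; apply: eq_bigr => k _ /=.
rewrite complexifyZr complexify_sym (mul3_sum a') linear_sum mulr_sumr.
apply: eq_bigr => l _ /=; rewrite linear_sum mulr_sumr; apply: eq_bigr => m _ /=.
by rewrite linear_sum mulr_sumr; apply: eq_bigr => o _ /=; rewrite complexifyZr.
Qed.

Local Notation eR := (base_vec R).

Lemma inner_sum6 (a b c a' b' c' : 'rV[R]_3) :
  Q (mul3 a b c) (mul3 a' b' c') =
  \sum_i \sum_j \sum_k \sum_l \sum_m \sum_o
   (a 0 i * b 0 j * c 0 k) * ((a' 0 l * b' 0 m * c' 0 o) *
     Q (mul3 (eR i) (eR j) (eR k)) (mul3 (eR l) (eR m) (eR o))).
Proof.
rewrite (mul3_sum a) inner_sym linear_sum; apply: eq_bigr => i _ /=.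
rewrite linear_sum; apply: eq_bigr => j _ /=.
rewrite linear_sum; apply: eq_bigr => k _ /=.
rewrite linearZ /= inner_sym (mul3_sum a') linear_sum mulr_sumr.
apply: eq_bigr => l _ /=; rewrite linear_sum mulr_sumr; apply: eq_bigr => m _ /=.
by rewrite linear_sum mulr_sumr; apply: eq_bigr => o _ /=; rewrite linearZ.
Qed.

Definition cplx (a : 'rV[R]_3) : 'rV[C]_3 := map_mx (real_complex R) a.

Lemma complexify_real (a b c a' b' c' : 'rV[R]_3) :
  QC (mul3 (cplx a) (cplx b) (cplx c)) (mul3 (cplx a') (cplx b') (cplx c')) =
  real_complex R (Q (mul3 a b c) (mul3 a' b' c')).
Proof.
rewrite complexify_sum6 inner_sum6.
do 6![rewrite rmorph_sum; apply: eq_bigr => ? _ /=].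
by rewrite !rmorphM /= !mxE complexify_mul3.
Qed.

Lemma poly_in_bilin (T : Type) n (x : 'I_n -> T -> C) (a b c a' b' c' : T -> 'rV[C]_3) :
  (forall i, poly_in x (fun t => a t 0 i)) -> (forall i, poly_in x (fun t => b t 0 i)) ->
  (forall i, poly_in x (fun t => c t 0 i)) -> (forall i, poly_in x (fun t => a' t 0 i)) ->
  (forall i, poly_in x (fun t => b' t 0 i)) -> (forall i, poly_in x (fun t => c' t 0 i)) ->
  poly_in x (fun t => QC (mul3 (a t) (b t) (c t)) (mul3 (a' t) (b' t) (c' t))).
Proof.
move=> Ha Hb Hc Ha' Hb' Hc'.
apply: poly_in_ext (fun t => esym (complexify_sum6 _ _ _ _ _ _)) _.
do 6![apply: poly_in_sum => ? _].
apply: poly_inM; [|apply: poly_inM; [|exact: poly_in_cst]];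
  by apply: poly_inM; [apply: poly_inM|].
Qed.

Lemma dquad_poly k : poly_in (@vcoord C) (dquad k).
Proof.
apply: (@poly_in_ext _ _ _ _ (fun a => QC (mul3 a a a) (mul3 a a (e k)))).
  by move=> a; rewrite /dquad power3E.
by apply: poly_in_bilin => i; try exact: poly_in_cst; exact: (poly_in_gen (@vcoord C) i).
Qed.

Lemma dquad_homog k (t : C) a : dquad k (t *: a) = t ^+ 5 * dquad k a.
Proof.
rewrite /dquad power3Z mul3Zl mul3Zm scalerA.
rewrite complexifyZr complexify_sym complexifyZr.
by rewrite complexify_sym; ring.
Qed.

Lemma tcontr_tens_of u k a : tcontr (tens_of Q u) k a = QC u (mul3 a a (e k)).
Proof.
rewrite (mul3_sum a a (e k)) !linear_sum /tcontr.
apply: eq_bigr => i _ /=; rewrite !linear_sum; apply: eq_bigr => j _ /=.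
rewrite !linear_sum (bigD1 k) //= big1 ?addr0 => [|l lk]; last first.
  by rewrite mxE (negPf lk) andbF mulr0 scale0r linear0.
by rewrite mxE !eqxx mulr1 complexifyZr tens_ofE mulrC.
Qed.

Lemma ED_critical_tsys u w :
  ED_critical QC X u w <-> exists2 a, tsys dquad (tens_of Q u) a & w = power 3 a.
Proof.
rewrite ED_criticalE; split=> -[a].
  move=> a0 [-> H]; exists a => //; split=> // k; rewrite tcontr_tens_of.
  have := H (e k); rewrite complexify_sym linearB /= => /eqP.
  by rewrite subr_eq0 !(complexify_sym _ (mul3 _ _ _)) => /eqP.
move=> [a0 H] ->; exists a => //; split=> // b.
rewrite (vec_sum b) !linear_sum big1 // => k _.
rewrite /= mul3Zr complexifyZr; have := H k; rewrite tcontr_tens_of => E.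
by rewrite complexify_sym linearB /= !(complexify_sym _ (mul3 _ _ _)) E subrr mulr0.
Qed.

Lemma dquad_real k (a : 'rV[R]_3) :
  dquad k (cplx a) = real_complex R (Q (power 3 a) (mul3 a a (eR k))).
Proof.
rewrite /dquad !power3E -complexify_real; congr (QC _ (mul3 _ _ _)).
by apply/rowP => i; rewrite !mxE rmorph_nat.
Qed.

Theorem has_EDdegree_count k :
  generic (fun c => atleast dquad k c /\ ~ atleast dquad k.+1 c) -> has_EDdegree QC X k.
Proof.
move=> /(for_general_tens Q)[g g0 Hg]; exists g => // u /Hg[H1 H2].
rewrite (_ : ED_critical _ _ _ = [set w | exists2 a, tsys dquad (tens_of Q u) a & w = power 3 a]).
  exact: card_eq_atleast.
by apply/seteqP; split=> w /ED_critical_tsys.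
Qed.

(** Both counts are valid at a common point off the two hypersurfaces. *)
Lemma has_EDdegree_inj k l : has_EDdegree QC X k -> has_EDdegree QC X l -> k = l.
Proof.
move=> [g g0 Hg] [h h0 Hh].
have [v] : exists v : 'I_(\dim {:Sym C 3 2}) -> nat, (g * h).@[fun i => (v i)%:R] != 0.
  by apply: mpoly_neq0_nat; rewrite mulf_neq0.
rewrite mevalM mulf_eq0 negb_or => /andP[gv hv].
pose u : Sym C 3 2 := \sum_(i < \dim {:Sym C 3 2}) (v i)%:R *: (vbasis {:Sym C 3 2})`_i.
have cu : coords u = (fun i => (v i)%:R) by exact: coords_sumE.
have := Hg u; have := Hh u; rewrite /pval cu => /(_ hv) Hl /(_ gv) Hk.
by apply/esym/card_eq_II; apply: card_eq_trans Hk; exact: card_esym.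
Qed.

Lemma EDdegreeE k : has_EDdegree QC X k -> EDdegree QC X = k.
Proof.
by move=> Hk; apply: (has_EDdegree_inj _ Hk); rewrite /EDdegree; apply: xgetPex; exists k.
Qed.

End EDdegreeCount.

(** * At most eight solutions of U(y, y, -) = A y *)

Section WordReduction.
Variable F : numClosedFieldType.
Local Notation vec := 'rV[F]_3.
Local Notation ix := tens_index.

Section Words.
Variable d : nat.
Local Notation word := {ffun 'I_d -> 'I_3}.

Definition wval (w : word) (y : vec) : F := \prod_x y 0 (w x).

Definition wset (w : word) (p q : 'I_d) (i j : 'I_3) : word :=
  [ffun x => if x == p then i else if x == q then j else w x].

Definition repeats (w : word) : option ('I_d * 'I_d) :=
  [pick pq : 'I_d * 'I_d | (pq.1 != pq.2) && (w pq.1 == w pq.2)].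

(** A word is the monomial of its letters. If the letters at p and q are both k,
    this is y_k ^ 2 * r, and its row holds the coefficients of
    r * c(y, y, e_k); the row of a squarefree word is that of the word itself.
    For the Fermat cubic c(y, y, e_k) = y_k ^ 2, and the matrix is 1. *)
Definition word_mx (K : comNzRingType) (c : 'I_10 -> K) : 'M[K]_#|word| :=
  \matrix_(w, w') let v := enum_val w in let v' := enum_val w' in
    if repeats v is Some (p, q) then
      \sum_i \sum_j (wset v p q i j == v')%:R * tens c i j (v p)
    else (v == v')%:R.

(** The tensor of x ^ 3 + y ^ 3 + z ^ 3. *)
Definition fermat (t : 'I_10) : F :=
  [exists i : 'I_3, ix i i i == t]%:R.

Lemma tens_fermat i j k : tens fermat i j k = ((i == k) && (j == k))%:R.
Proof.
rewrite /tens /fermat; congr (nat_of_bool _)%:R; apply/existsP/andP => [[l /eqP]|].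
  move=> /(congr1 val); rewrite /tens_index -!val_eqE.
  by elim/ord3_ind: i; elim/ord3_ind: j; elim/ord3_ind: k; elim/ord3_ind: l;
    rewrite /= !inordK //= !inordK.
by move=> [/eqP-> /eqP->]; exists k.
Qed.

Lemma word_mx_fermat : word_mx fermat = 1%:M.
Proof.
apply/matrixP => w w'; rewrite !mxE -(inj_eq enum_val_inj).
move: (enum_val w) (enum_val w') => {w w'} v v'.
rewrite /repeats; case: pickP => [[p q] /= /andP[pq /eqP vpq]|//].
rewrite (bigD1 (v p)) //= (bigD1 (v p)) //= tens_fermat !eqxx mulr1.
rewrite big1 ?addr0 => [|j jv]; last by rewrite tens_fermat (negPf jv) andbF mulr0.
rewrite big1 ?addr0 => [|i iv]; last first.
  by rewrite big1 // => j _; rewrite tens_fermat (negPf iv) mulr0.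
congr (_ == _)%:R; apply/ffunP => x; rewrite ffunE.
by case: eqP => [->//|_]; case: eqP => [->|].
Qed.

(** The determinant is a polynomial in c, equal to 1 at the Fermat cubic. *)
Lemma word_mx_generic : generic (fun c : 'I_10 -> F => word_mx c \in unitmx).
Proof.
pose D := \det (word_mx (fun t => 'X_t : {mpoly F[10]})).
have DE c : D.@[c] = \det (word_mx c).
  rewrite -det_map_mx; congr (\det _); apply/matrixP => w w'; rewrite !mxE /=.
  case: (repeats (enum_val w)) => [[p q]|]; last first.
    by case: (enum_val w == enum_val w'); rewrite ?meval1 ?meval0.
  rewrite raddf_sum; apply: eq_bigr => i _; rewrite raddf_sum.
  by apply: eq_bigr => j _ /=; rewrite mevalM mevalXU;
    case: (wset (enum_val w) p q i j == enum_val w'); rewrite ?meval1 ?meval0.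
exists D; last by move=> c; rewrite DE unitmxE unitfE.
by apply: contra_eq_neq (DE fermat) => ->; rewrite meval0 word_mx_fermat det1 eq_sym oner_eq0.
Qed.

(** The value at y of the polynomial in the row of w, when c(y, y, e_k) = l k. *)
Definition word_rhs (l : 'I_3 -> F) (y : vec) (w : word) : F :=
  if repeats w is Some (p, q) then l (w p) * \prod_(x | (x != p) && (x != q)) y 0 (w x)
  else wval w y.

Lemma word_mxE c (y : vec) (w : word) :
  \sum_w' word_mx c (enum_rank w) w' * wval (enum_val w') y =
  word_rhs (fun k => tcontr c k y) y w.
Proof.
transitivity (\sum_(w' : word) word_mx c (enum_rank w) (enum_rank w') * wval w' y).
  rewrite (reindex (@enum_rank word)) /=; last exact/onW_bij/enum_rank_bij.
  by apply: eq_bigr => w' _; rewrite enum_rankK.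
under eq_bigr do rewrite mxE !enum_rankK.
rewrite /word_rhs; case Er: (repeats w) => [[p q]|]; last first.
  rewrite (bigD1 w) //= eqxx mul1r big1 ?addr0 // => w' w'w.
  by rewrite eq_sym (negPf w'w) mul0r.
have pq : p != q by move: Er; rewrite /repeats; case: pickP => // -[p' q'] /= /andP[? _] [<- <-].
under eq_bigr do rewrite mulr_suml; rewrite exchange_big /tcontr mulr_suml /=.
apply: eq_bigr => i _; rewrite mulr_suml.
under eq_bigr do rewrite mulr_suml; rewrite exchange_big /=; apply: eq_bigr => j _.
rewrite (bigD1 (wset w p q i j)) //= eqxx mul1r big1 ?addr0 => [|w' w'w]; last first.
  by rewrite eq_sym (negPf w'w) !mul0r.
rewrite -!mulrA; congr (_ * _).
rewrite /wval (bigD1 p) //= (bigD1 q) 1?eq_sym //= !ffunE eqxx eq_sym (negPf pq) eqxx.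
rewrite !mulrA; congr (_ * _); apply: eq_bigr => x /andP[xp xq].
by rewrite ffunE (negPf xp) (negPf xq).
Qed.

(** Inverting the matrix rewrites a monomial in terms of squarefree ones and of
    multiples of the three quadrics c(y, y, e_k). *)
Lemma wval_solve c : word_mx c \in unitmx -> exists M : word -> word -> F,
  forall y w, wval w y = \sum_w' M w w' * word_rhs (fun k => tcontr c k y) y w'.
Proof.
move=> cU; exists (fun w w' => invmx (word_mx c) (enum_rank w) (enum_rank w')) => y w.
pose v : 'cV[F]_#|{: word}| := \col_w' wval (enum_val w' : word) y.
have E w' : (word_mx c *m v) (enum_rank w') 0 = word_rhs (fun k => tcontr c k y) y w'.
  by rewrite mxE -word_mxE; apply: eq_bigr => w'' _; rewrite [v _ _]mxE.
transitivity ((invmx (word_mx c) *m (word_mx c *m v)) (enum_rank w) 0).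
  by rewrite mulKmx // [RHS]mxE enum_rankK.
rewrite mxE (reindex (@enum_rank word)) /=; last exact/onW_bij/enum_rank_bij.
by apply: eq_bigr => w' _; rewrite E.
Qed.

Lemma repeats_none (w : word) : repeats w = None -> injective w.
Proof.
rewrite /repeats; case: pickP => // H _ x y xy; apply: contrapT => /eqP nxy.
by have := H (x, y); rewrite /= nxy xy eqxx.
Qed.

End Words.

(** A general cubic is smooth: a word of four letters out of three has a
    repetition, so where the three quadrics vanish all monomials of degree four
    do. *)
Lemma generic_smooth : generic (fun c : 'I_10 -> F =>
  forall a : vec, (forall k, tcontr c k a = 0) -> a = 0).
Proof.
apply: genericS (word_mx_generic 4) => c /wval_solve[M HM] a Ha.
have H (w : {ffun 'I_4 -> 'I_3}) : wval w a = 0.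
  rewrite HM big1 // => w' _; rewrite /word_rhs.
  case Er: (repeats w') => [[p q]|]; first by rewrite Ha mul0r mulr0.
  by have := leq_card _ (repeats_none Er); rewrite !card_ord.
apply/rowP => i; rewrite mxE; have /eqP := H [ffun=> i].
rewrite /wval; under eq_bigr do rewrite ffunE.
by rewrite prodr_const card_ord expf_eq0 => /eqP.
Qed.

Section Counting.
Variables (l : 'I_3 -> 'I_3 -> F).
Definition lin_apply (k : 'I_3) (y : vec) : F := \sum_j l k j * y 0 j.

Section Points.
Variables (m : nat) (Y : 'I_m -> vec) (c : 'I_10 -> F).
Hypothesis Ysol : forall s k, tcontr c k (Y s) = lin_apply k (Y s).

(** The values of the eight squarefree monomials at the points; its row space
    is their span as functions on the points. *)
Definition squarefree_mx : 'M[F]_(#|{set 'I_3}|, m) :=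
  \matrix_(B < #|{set 'I_3}|, s < m) \prod_(i in enum_val B) Y s 0 i.
Definition spanned (f : vec -> F) := (\row_s f (Y s) <= squarefree_mx)%MS.

Let spanned_ext f g : (forall s, f (Y s) = g (Y s)) -> spanned f -> spanned g.
Proof.
by move=> fg; rewrite /spanned (_ : \row_s f (Y s) = \row_s g (Y s)) //; apply/rowP => s;
  rewrite !mxE fg.
Qed.

Let spanned_sum (I : Type) (r : seq I) (P : pred I) (a : I -> F) (f : I -> vec -> F) :
  (forall i, spanned (f i)) -> spanned (fun y => \sum_(i <- r | P i) a i * f i y).
Proof.
move=> Hf; rewrite /spanned (_ : \row_s _ = \sum_(i <- r | P i) a i *: \row_s f i (Y s)).
  by apply: summx_sub => i _; apply: scalemx_sub; exact: Hf.
by apply/rowP => s; rewrite mxE summxE; apply: eq_bigr => i _; rewrite !mxE.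
Qed.

Let spanned_set (B : {set 'I_3}) : spanned (fun y => \prod_(i in B) y 0 i).
Proof.
rewrite /spanned (_ : \row_s _ = row (enum_rank B) squarefree_mx) ?row_sub //.
by apply/rowP => s; rewrite !mxE enum_rankK.
Qed.

(** At the points the quadric c(y, y, e_k) agrees with a linear form, so the
    multiples of quadrics in wval_solve drop by one degree, and induction leaves
    squarefree monomials only. *)
Lemma words_spanned n : (forall d : 'I_n, word_mx d c \in unitmx) ->
  forall w : seq 'I_3, (size w < n)%N -> spanned (fun y => \prod_(i <- w) y 0 i).
Proof.
move=> cU w; move: {2}(size w) (erefl (size w)) => d.
elim: d w => [|d IH] w sw dn.
  have := spanned_set finset.set0; apply: spanned_ext => s; rewrite big_set0.
  by rewrite (size0nil sw) big_nil.
rewrite sw in dn; have cUd : word_mx d.+1 c \in unitmx := cU (Ordinal dn).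
have [M HM] := wval_solve cUd.
pose v : {ffun 'I_d.+1 -> 'I_3} := [ffun x : 'I_d.+1 => nth ord0 w x].
apply: (@spanned_ext (fun y => \sum_(w' : {ffun 'I_d.+1 -> 'I_3}) M v w' * word_rhs (fun k => lin_apply k y) y w') (fun y => \prod_(i <- w) y 0 i)).
  move=> s; transitivity (wval v (Y s)).
    rewrite HM; apply: eq_bigr => w' _; congr (_ * _); rewrite /word_rhs.
    by case: (repeats w') => // -[p q]; rewrite Ysol.
  rewrite /wval (big_nth ord0) sw big_mkord; apply: eq_bigr => x _.
  by rewrite ffunE.
apply: (@spanned_sum _ _ _ _ (fun (w' : {ffun 'I_d.+1 -> 'I_3}) y => word_rhs (fun k => lin_apply k y) y w')) => w'.
rewrite /word_rhs; case Er: (repeats w') => [[p q]|]; last first.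
  have := spanned_set [set w' x | x in 'I_d.+1]%SET; apply: spanned_ext => s.
  by rewrite big_imset //=; apply: in2W; exact: repeats_none.
pose r := [seq w' x | x <- enum 'I_d.+1 & (x != p) && (x != q)].
have pq : p != q by move: Er; rewrite /repeats; case: pickP => // -[p' q'] /= /andP[? _] [<- <-].
have sr : (size r).+1 = d.
  have -> : size r = #|~: [set p; q]%SET|.
    rewrite size_map size_filter -sum1_count big_enum_cond -sum1_card.
    by apply: eq_bigl => x; rewrite !inE negb_or.
  by have := cardsC [set p; q]%SET; rewrite cards2 pq card_ord; lia.
apply: (@spanned_ext (fun y => \sum_j l (w' p) j * \prod_(i <- j :: r) y 0 i) (fun y => lin_apply (w' p) y * \prod_(x | (x != p) && (x != q)) y 0 (w' x))).
  move=> s; rewrite /lin_apply mulr_suml; apply: eq_bigr => j _.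
  by rewrite big_cons mulrA big_map big_filter big_enum_cond.
apply: (@spanned_sum _ _ _ _ (fun (j : 'I_3) y => \prod_(i <- j :: r) y 0 i)) => j; apply: IH => /=; rewrite sr //.
exact: ltnW.
Qed.

End Points.

(** A Bezout bound. Restricted to the solutions, the polynomials of degree at
    most eight are spanned by the eight squarefree monomials. Given nine
    solutions, a product of eight affine functions vanishes at all of them but
    a chosen one, so the nine indicator functions would lie in a space of
    dimension eight. *)
Theorem at_most_eight : generic (fun c : 'I_10 -> F => forall Y : 'I_9 -> vec,
  (forall s k, tcontr c k (Y s) = lin_apply k (Y s)) -> ~ injective Y).
Proof.
have H : generic (fun c : 'I_10 -> F => forall d : 'I_9, word_mx d c \in unitmx).
  by apply: generic_forall => d; exact: word_mx_generic.
apply: genericS H => c cU Y HY Y_inj.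
have sp := words_spanned HY cU.
(* On the points f behaves as a polynomial of degree at most d. *)
pose short d (f : vec -> F) := forall w : seq 'I_3, (size w + d < 9)%N ->
  spanned Y (fun y => f y * \prod_(i <- w) y 0 i).
have short1 : short 0%N (fun=> 1).
  move=> w; rewrite addn0 => /sp; congr (is_true (_ <= _)%MS); apply/rowP => s.
  by rewrite !mxE mul1r.
have shortS d f j b : short d f -> short d.+1 (fun y => f y * (y 0 j - b)).
  move=> Hf w; rewrite addnS => wd.
  pose row1 := \row_s (f (Y s) * \prod_(i <- j :: w) Y s 0 i).
  pose row2 := \row_s (f (Y s) * \prod_(i <- w) Y s 0 i).
  have : ((row1 - b *: row2)%R <= squarefree_mx Y)%MS.
    apply: addmx_sub; first exact: Hf.
    by rewrite eqmx_opp; apply: scalemx_sub; apply: Hf; exact: ltnW.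
  congr (is_true (_ <= _)%MS); apply/rowP => s; rewrite !mxE big_cons; ring.
pose j s t := if [pick j | Y s 0 j != Y t 0 j] is Some j then j else ord0.
have jP s t : t != s -> Y s 0 (j s t) != Y t 0 (j s t).
  move=> ts; rewrite /j; case: pickP => // H; case/eqP: ts; apply: Y_inj.
  by apply/rowP => i; have /negbT/negPn/eqP := H i.
have shortP s (r : seq 'I_9) : short (size r) (fun y => \prod_(t <- r) (y 0 (j s t) - Y t 0 (j s t))).
  elim: r => [|t r IH].
    by move=> w /short1; congr (is_true (_ <= _)%MS); apply/rowP => s'; rewrite !mxE big_nil.
  move=> w /(shortS _ _ (j s t) (Y t 0 (j s t)) IH); congr (is_true (_ <= _)%MS).
  by apply/rowP => s'; rewrite !mxE big_cons; ring.
have d_sub s : ((delta_mx 0 s : 'rV[F]_9) <= squarefree_mx Y)%MS.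
  pose r := [seq t <- enum 'I_9 | t != s].
  have sr : size r = 8%N.
    rewrite size_filter -sum1_count big_enum_cond sum1_card.
    by transitivity #|predC1 s|; [exact: eq_card | rewrite cardC1 card_ord].
  pose a := \prod_(t <- r) (Y s 0 (j s t) - Y t 0 (j s t)).
  have a0 : a != 0.
    rewrite prodf_seq_neq0; apply/allP => t; rewrite mem_filter => /andP[ts _].
    by rewrite subr_eq0 jP.
  have := shortP s r [::]; rewrite sr => /(_ isT).
  rewrite /spanned (_ : \row__ _ = a *: (delta_mx 0 s : 'rV[F]_9)).
    by move/(scalemx_sub a^-1); rewrite scalerA mulVf // scale1r.
  apply/rowP => t; rewrite !mxE big_nil mulr1 eqxx /=.
  have [->|ts] := eqVneq t s; first by rewrite mulr1.
  rewrite mulr0; apply/eqP; rewrite prodf_seq_eq0; apply/hasP; exists t.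
    by rewrite mem_filter ts mem_enum.
  by rewrite /= subrr.
have : (1%:M <= squarefree_mx Y)%MS.
  by apply/row_subP => s; rewrite row1.
move=> /mxrankS; rewrite mxrank1 => H9.
have := leq_trans H9 (rank_leq_row _).
by rewrite -cardsT -powersetT card_powerset cardsT card_ord.
Qed.

End Counting.
End WordReduction.

(** * Frobenius inner products *)

Section FrobeniusCount.
Variables (R : realType) (Q : inner_product (Sym R 3 2)) (Q1 : inner_product 'rV[R]_3).
Hypothesis QQ1 : forall x y, Q (power 3 x) (power 3 y) = Q1 x y ^+ 3.
Local Notation C := R[i].

(** The coefficient of t in Q(x ^ 3, (y + t b) ^ 3) = Q1(x, y + t b) ^ 3, obtained
    from the values at t = 1 and t = -1. *)
Lemma frobenius_polar (x y b : 'rV[R]_3) :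
  Q (power 3 x) (mul3 y y b) = Q1 x y ^+ 2 * Q1 x b.
Proof.
have H t : Q (power 3 x) (power 3 (y + t *: b)) = (Q1 x y + t * Q1 x b) ^+ 3.
  by rewrite QQ1 linearD linearZ.
have E t : Q (power 3 x) (power 3 (y + t *: b)) = Q1 x y ^+ 3 +
    3 * t * Q (power 3 x) (mul3 y y b) + 3 * t ^+ 2 * Q (power 3 x) (mul3 y b b)
    + t ^+ 3 * Q1 x b ^+ 3.
  by rewrite power3_shift !linearD !linearZ /= !QQ1.
have := E 1; have := E (-1); rewrite !H.
set q1 := Q _ _; set q2 := Q _ _; set u := Q1 _ _; set v := Q1 _ _.
move=> E1 E2; lra.
Qed.

(** The complexified Q1: its matrix A and its quadratic form sq. *)
Let A (k j : 'I_3) : C := real_complex R (Q1 (base_vec R j) (base_vec R k)).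
Let sq (a : 'rV[C]_3) : C := \sum_k a 0 k * lin_apply A k a.

Lemma poly_in_nat_eq (f g : 'rV[C]_3 -> C) :
  poly_in (@vcoord C) f -> poly_in (@vcoord C) g ->
  (forall v : 'I_3 -> nat, f (\row_i (v i)%:R) = g (\row_i (v i)%:R)) -> f =1 g.
Proof.
move=> [p Hp] [q Hq] H a; rewrite Hp Hq; congr (_.@[_]); apply/eqP.
rewrite -subr_eq0; apply/negP => /negP/mpoly_neq0_nat[v].
rewrite mevalB subr_eq0; move/eqP; apply.
have := H v; rewrite Hp Hq; congr (_ = _); apply: meval_eq => i;
  by rewrite /vcoord mxE.
Qed.

(** Both sides are polynomials, and frobenius_polar compares them at natural
    vectors. *)
Lemma dquad_frobenius k a : dquad Q k a = sq a ^+ 2 * lin_apply A k a.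
Proof.
have pl j : poly_in (@vcoord C) (lin_apply A j).
  apply: poly_in_sum => i _; apply: poly_inM; first exact: poly_in_cst.
  exact: (poly_in_gen (@vcoord C) i).
apply: (@poly_in_nat_eq _ (fun a => sq a ^+ 2 * lin_apply A k a)).
- exact: dquad_poly.
- apply: poly_inM => //; apply: poly_inX; apply: poly_in_sum => i _.
  by apply: poly_inM => //; exact: (poly_in_gen (@vcoord C) i).
move=> v; pose x : 'rV[R]_3 := \row_i (v i)%:R.
have -> : \row_i (v i)%:R = cplx x :> 'rV[C]_3.
  by apply/rowP => i; rewrite !mxE rmorph_nat.
rewrite dquad_real frobenius_polar.
have lE j : lin_apply A j (cplx x) = real_complex R (Q1 x (base_vec R j)).
  rewrite /lin_apply {2}(vec_sum x) [Q1 _ _]hermC expr0 mul1r linear_sum rmorph_sum.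
  apply: eq_bigr => i _ /=; rewrite linearZ /= rmorphM /= mxE /A mulrC.
  by rewrite [Q1 (base_vec R j) _]hermC expr0 mul1r.
have -> : sq (cplx x) = real_complex R (Q1 x x).
  rewrite /sq {4}(vec_sum x) linear_sum rmorph_sum.
  by apply: eq_bigr => i _ /=; rewrite lE linearZ /= rmorphM /= mxE.
by rewrite lE -rmorphXn -rmorphM.
Qed.

(** The system reads U(a, a, -) = s(a) ^ 2 A a, with s the quadratic form of Q1.
    If the cubic of U is smooth then s(a) <> 0, and y = a / s(a) ^ 2 solves
    U(y, y, -) = A y; it determines a ^ 3 = y ^ 3 / s(y) ^ 2. Of the at most
    eight solutions y, one is 0. *)
Theorem frobenius_at_most_seven : generic (fun c => ~ atleast (dquad Q) 8 c).
Proof.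
apply: genericS (generic_and (generic_smooth C) (at_most_eight A)) => c.
move=> [c_smooth c9] [f [Hf f_inj]].
have s0 i : sq (f i) != 0.
  apply/eqP => s0; have [a0 Ha] := Hf i; move/eqP: a0; apply; apply: c_smooth => k.
  by rewrite Ha dquad_frobenius s0 expr0n mul0r.
pose y i := (sq (f i) ^+ 2)^-1 *: f i.
have lZ k t a : lin_apply A k (t *: a) = t * lin_apply A k a.
  by rewrite /lin_apply mulr_sumr; apply: eq_bigr => j _; rewrite mxE; ring.
have sqZ t a : sq (t *: a) = t ^+ 2 * sq a.
  by rewrite /sq mulr_sumr; apply: eq_bigr => j _; rewrite mxE lZ; ring.
have y_sol i k : tcontr c k (y i) = lin_apply A k (y i).
  have [_ Ha] := Hf i; rewrite tcontrZ Ha dquad_frobenius lZ.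
  by have := s0 i; set s := sq _ => sn0; field.
have fy i : f i = sq (f i) ^+ 2 *: y i.
  by rewrite scalerA divff ?scale1r // expf_neq0.
have cube i : power 3 (f i) = (sq (y i) ^+ 2)^-1 *: power 3 (y i).
  rewrite {1}fy power3Z; congr (_ *: _); rewrite /y sqZ.
  by have := s0 i; set s := sq _ => sn0; field.
have y_inj : injective y.
  by move=> i j yij; apply: f_inj; rewrite !cube yij.
have y0 i : y i <> 0.
  move=> yi0; have [/eqP a0 _] := Hf i; apply: a0.
  by rewrite fy yi0 scaler0.
pose Y (i : 'I_9) : 'rV[C]_3 := if unlift ord_max i is Some j then y j else 0.
apply: (c9 Y) => [i k|i j].
  rewrite /Y; case: unlift => // ; rewrite -(scale0r (0 : 'rV[C]_3)) tcontrZ lZ.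
  by rewrite expr0n !mul0r.
rewrite /Y; case: unliftP => [i' ->|->]; case: unliftP => [j' ->|->] //.
- by move/y_inj ->.
- by move/y0.
- by move/esym/y0.
Qed.

End FrobeniusCount.

(** * Minima of real polynomials depending on a parameter *)

Section RealAnalysis.
Variable R : realType.
Local Notation vec := 'rV[R]_3.

Lemma cont_cst (T : topologicalType) (c : R) : continuous (fun _ : T => c).
Proof. exact: cst_continuous. Qed.

Lemma cont_add (T : topologicalType) (f g : T -> R) :
  continuous f -> continuous g -> continuous (fun t => f t + g t).
Proof. by move=> cf cg t; exact: (cvgD (cf t) (cg t)). Qed.

Lemma cont_mul (T : topologicalType) (f g : T -> R) :
  continuous f -> continuous g -> continuous (fun t => f t * g t).
Proof. by move=> cf cg t; exact: (cvgM (cf t) (cg t)). Qed.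

Lemma continuous_poly_in (T : topologicalType) n (x : 'I_n -> T -> R) (f : T -> R) :
  (forall i, continuous (x i)) -> poly_in x f -> continuous f.
Proof.
move=> Hx [p Hp]; have -> : f = (fun t => p.@[x^~ t]) by apply/funext.
elim/mpolyind: p {Hp} => [|c m p _ _ IH].
  rewrite (_ : (fun _ => _) = fun=> 0); first exact: cont_cst.
  by apply/funext => t; rewrite meval0.
rewrite (_ : (fun _ => _) = (fun t => c * \prod_i x i t ^+ m i + p.@[x^~ t])); last first.
  by apply/funext => t; rewrite mevalD mevalZ mevalX.
apply: cont_add IH; apply: cont_mul; first exact: cont_cst.
elim: (index_enum 'I_n) => [|i r IHr].
  rewrite (_ : (fun _ => _) = fun=> 1); first exact: cont_cst.
  by apply/funext => t; rewrite big_nil.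
rewrite (_ : (fun _ => _) = (fun t => x i t ^+ m i * \prod_(i <- r) x i t ^+ m i)); last first.
  by apply/funext => s; rewrite big_cons.
apply: cont_mul IHr; elim: (m i) => [|k IHk].
  rewrite (_ : (fun _ => _) = fun=> 1); first exact: cont_cst.
  by apply/funext => s; rewrite expr0.
rewrite (_ : (fun _ => _) = (fun t => x i t * x i t ^+ k)); last first.
  by apply/funext => s; rewrite exprS.
exact: cont_mul.
Qed.

(** Generators of the polynomials in a parameter t and a vector a. *)
Definition param_gen (i : 'I_4) (x : R * vec) : R :=
  if unlift ord0 i is Some j then x.2 0 j else x.1.

Lemma param_gen_continuous i : continuous (param_gen i).
Proof.
rewrite /param_gen; case: unlift => [j|] x; last exact: cvg_fst.
apply: (@continuous_comp _ _ _ snd (fun M : vec => M 0 j) x); first exact: cvg_snd.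
exact: coord_continuous.
Qed.

Lemma poly_in_param : poly_in param_gen fst.
Proof.
by apply: poly_in_ext (poly_in_gen param_gen ord0) => x; rewrite /param_gen unlift_none.
Qed.

Lemma poly_in_coord j : poly_in param_gen (fun x => x.2 0 j).
Proof.
by apply: poly_in_ext (poly_in_gen param_gen (lift ord0 j)) => x; rewrite /param_gen liftK.
Qed.

Lemma param_continuous f : poly_in param_gen f -> continuous f.
Proof. exact: (continuous_poly_in param_gen_continuous). Qed.

Lemma slice_continuous f t : poly_in param_gen f -> continuous (fun a : vec => f (t, a)).
Proof.
move=> Hf; apply: (@continuous_poly_in _ 4 (fun i a => param_gen i (t, a))); last first.
  exact: (poly_in_comp (fun a : vec => (t, a)) Hf).
move=> i; rewrite /param_gen; case: unlift => [j|] a /=; last exact: cont_cst.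
exact: coord_continuous.
Qed.

Definition small (P : R -> Prop) : Prop := exists2 d : R, 0 < d & forall t, `|t| < d -> P t.

Lemma smallS P P' : (forall t, P t -> P' t) -> small P -> small P'.
Proof. by move=> H [d d0 Hd]; exists d => // t /Hd/H. Qed.

Lemma small_and P P' : small P -> small P' -> small (fun t => P t /\ P' t).
Proof.
move=> [d d0 Hd] [e e0 He]; exists (Num.min d e); first by rewrite lt_min d0.
by move=> t; rewrite lt_min => /andP[/Hd ? /He].
Qed.

Lemma small_forall (I : finType) (P : I -> R -> Prop) :
  (forall i, small (P i)) -> small (fun t => forall i, P i t).
Proof.
move=> H; suff: small (fun t => forall i, i \in enum I -> P i t).
  by apply: smallS => t Ht i; apply: Ht; rewrite mem_enum.
elim: (enum I) => [|i r IH]; first by exists 1.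
apply: smallS (small_and (H i) IH) => t [Pi Pr] j.
by rewrite inE => /orP[/eqP->//|]; exact: Pr.
Qed.

(** The tube lemma around the compact set K at parameter 0. *)
Lemma tube (K : set vec) f : compact K -> poly_in param_gen f ->
  (forall a, K a -> 0 < f (0, a)) -> small (fun t => forall a, K a -> 0 < f (t, a)).
Proof.
move=> cK Hf f0.
have : \forall t \near (0 : R), K `<=` (fun a => 0 < f (t, a)).
  apply: ((compact_near_coveringP K).1 cK R (nbhs (0 : R)) (fun t a => 0 < f (t, a)) _) => a Ka.
  have := @param_continuous f Hf (0, a) [set y | 0 < y].
  have n0 : nbhs (f (0, a)) [set y : R | 0 < y].
    exact: (open_nbhs_nbhs (conj (@open_gt R 0) (f0 a Ka))).
  move=> /(_ n0) [[A B] /= [nA nB] AB]; exists (B, A) => //= -[x t] [/= Bx At].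
  exact: (AB (t, x)).
move=> /nbhs_ballP[d /= d0 Hd]; exists d => // t td a Ka.
by apply: (Hd t) => //; rewrite /ball /= sub0r normrN.
Qed.

Definition box (l r : 'I_3 -> R) : set vec := [set a | forall i, l i <= a 0 i <= r i].
Definition box_boundary (l r : 'I_3 -> R) : set vec :=
  [set a | box l r a /\ exists i, a 0 i = l i \/ a 0 i = r i].

Lemma box_compact l r : compact (box l r).
Proof.
have -> : box l r = [set a : vec | forall i, `[l i, r i]%classic (a 0 i)].
  by apply/seteqP; split=> a H i; have := H i; rewrite /= in_itv.
apply: (@rV_compact R 3 (fun i => `[l i, r i]%classic)) => i.
exact: segment_compact.
Qed.

Lemma box_boundary_compact l r : compact (box_boundary l r).
Proof.
apply: (@subclosed_compact _ _ (box l r)); [|exact: box_compact|by move=> a []].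
have -> : box_boundary l r = box l r `&`
    \bigcup_(i in [set: 'I_3]) [set a : vec | (a 0 i - l i) * (a 0 i - r i) = 0].
  apply/seteqP; split=> a [Ka].
    move=> [i Hi]; split=> //; exists i => //=.
    by case: Hi => ->; rewrite subrr ?mul0r ?mulr0.
  move=> [i _ /= /eqP]; rewrite mulf_eq0 !subr_eq0 => /orP Hi; split=> //; exists i.
  by case: Hi => /eqP; [left|right].
apply: closedI; first by apply: compact_closed; [exact: norm_hausdorff | exact: box_compact].
apply: closed_bigcup; first exact: finite_finset.
move=> i _.
have c : continuous (fun a : vec => (a 0 i - l i) * (a 0 i - r i)).
  by apply: cont_mul; apply: cont_add; try exact: cont_cst; exact: coord_continuous.
by move/continuous_closedP: c => /(_ [set x : R | x = 0]); apply; exact: closed_eq.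
Qed.

(** The barrier on the boundary persists for small t by the tube lemma, so that
    the minimum over the box lies inside. *)
Lemma interior_min l r f (p0 : vec) : poly_in param_gen f -> box l r p0 ->
  (forall a, box_boundary l r a -> f (0, p0) < f (0, a)) ->
  small (fun t => exists2 a : vec, (forall i, l i < a 0 i < r i) &
    forall b, box l r b -> f (t, a) <= f (t, b)).
Proof.
move=> Hf Kp0 H0.
have Hg : poly_in param_gen (fun x => f x - f (x.1, p0)).
  apply: poly_inB => //.
  apply: (poly_in_trans (x := fun i x => param_gen i (x.1, p0))); last first.
    exact: (poly_in_comp (fun x : R * vec => (x.1, p0)) Hf).
  move=> i; rewrite /param_gen; case: unlift => [j|] /=; last exact: poly_in_param.
  exact: poly_in_cst.
have /(tube (@box_boundary_compact l r) Hg) : forall a, box_boundary l r a ->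
  0 < f (0, a) - f (0, p0) by move=> a /H0; rewrite subr_gt0.
apply: smallS => t Ht.
have [a aK amin] : exists2 a : vec, a \in box l r & forall b, b \in box l r -> f (t, a) <= f (t, b).
  apply: derive.compact_EVT_min; [by exists p0 | exact: box_compact |].
  apply: continuous_subspaceT; exact: slice_continuous.
rewrite inE in aK.
exists a; last by move=> b Kb; apply: amin; rewrite inE.
have nB : ~ box_boundary l r a.
  move=> /Ht /=; rewrite subr_gt0 ltNge amin //; by rewrite inE.
move=> i; have /andP[h1 h2] := aK i.
rewrite !lt_neqAle h1 h2 !andbT; apply/andP; split; apply/eqP => E; apply: nB;
  split=> //; exists i; [left|right] => //.
Qed.

(** The remainder beyond first order is at most M * t ^ 2 for |t| <= 1, so a short
    step against the slope would decrease P. *)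
Lemma poly_local_min (P : {poly R}) (d : R) : 0 < d ->
  (forall t, `|t| < d -> P.[0] <= P.[t]) -> P`_1 = 0.
Proof.
move=> d0 H; pose S := drop_poly 2 P.
have PE t : P.[t] = P.[0] + P`_1 * t + t ^+ 2 * S.[t].
  rewrite -{1}(poly_take_drop 2 P) hornerD hornerM hornerXn [_ * t ^+ 2]mulrC.
  congr (_ + _); rewrite horner_coef0 /take_poly horner_poly.
  by rewrite !big_ord_recl big_ord0 /= expr0 expr1 mulr1 addr0.
pose M := 1 + \sum_(i < size S) `|S`_i|.
have M0 : 0 < M by rewrite ltr_pwDl // sumr_ge0.
have SM t : `|t| <= 1 -> `|S.[t]| <= M.
  move=> t1; rewrite horner_coef (le_trans (ler_norm_sum _ _ _)) // /M ler_wpDl //.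
  apply: ler_sum => i _; rewrite normrM ler_piMr // normrX exprn_ile1 //.
apply: contrapT => /eqP P1.
(* The step is t = - c * s. The three bounds on s give |t| < 1, |t| < d and
   s * M <= 1 / 2. *)
pose c := P`_1; pose s := Num.min (1 / (2 * (1 + `|c|))) (Num.min (d / (2 * (1 + `|c|))) (1 / (2 * M))).
have c0 : 0 < 2 * (1 + `|c|) by rewrite mulr_gt0 // ltr_pwDl.
have M2 : 0 < 2 * M by rewrite mulr_gt0.
have s0 : 0 < s by rewrite /s !lt_min; apply/and3P; split; exact: divr_gt0.
have [s1 [s2 s3]] : s <= 1 / (2 * (1 + `|c|)) /\ s <= d / (2 * (1 + `|c|)) /\ s <= 1 / (2 * M).
  by rewrite /s !ge_min !lexx !orbT.
pose t := - (c * s).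
have tn : `|t| = `|c| * s by rewrite normrN normrM (gtr0_norm s0).
have cs x : 0 < x -> s <= x / (2 * (1 + `|c|)) -> `|c| * s < x.
  move=> x0; rewrite ler_pdivlMr // => H1; have := normr_ge0 c; nra.
have t1 : `|t| <= 1 by rewrite tn ltW // cs.
have td : `|t| < d by rewrite tn cs.
have := H _ td; rewrite [P.[t]]PE.
have /ler_normlP[_ SM2] := SM _ t1.
have c2 : 0 < c ^+ 2 by rewrite exprn_even_gt0.
rewrite ler_pdivlMr ?mulr_gt0 // in s3.
move: SM2; rewrite -/c; set S0 := S.[_] => SM2 HH.
have : (c * s) ^+ 2 * S0 <= (c ^+ 2 * s) * (s * M).
  rewrite (_ : (c * s) ^+ 2 * S0 = (c ^+ 2 * s) * (s * S0)); last by ring.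
  apply: ler_wpM2l; first by rewrite mulr_ge0 // ltW.
  by apply: ler_wpM2l => //; exact: ltW.
have A0 : 0 < c ^+ 2 * s by rewrite mulr_gt0.
have : (c ^+ 2 * s) * (s * M) <= (c ^+ 2 * s) * 2^-1.
  by apply: ler_wpM2l; [exact: ltW | lra].
have E : c * t = - (c ^+ 2 * s) by rewrite /t; ring.
have E2 : t ^+ 2 = (c * s) ^+ 2 by rewrite /t sqrrN.
move: HH; rewrite E E2; lra.
Qed.

End RealAnalysis.

(** * Zeros of polynomial equations depending on a parameter *)

Section ImplicitFunction.
Variable R : realType.
Local Notation vec := 'rV[R]_3.
Local Notation gen := (@param_gen R).
Local Notation e := (base_vec R).

Lemma poly_eq_fun (P P' : {poly R}) : (forall t, P.[t] = P'.[t]) -> P = P'.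
Proof.
move=> H; apply/eqP; rewrite -subr_eq0; apply/negP => /negP/poly_neq0_nat[k].
by rewrite hornerD hornerN H subrr eqxx.
Qed.

(** The partial derivative J is given as the linear coefficient of f along lines,
    the form to which poly_local_min applies. *)
Lemma poly_in_deriv f (i : 'I_3) : poly_in gen f ->
  exists2 J, poly_in gen J & forall t a, exists2 P : {poly R},
    (forall s, P.[s] = f (t, a + s *: e i)) & P`_1 = J (t, a).
Proof.
move=> [p Hp]; exists (fun x => p^`M(lift ord0 i).@[fun j => gen j x]); first by exists p^`M(lift ord0 i).
move=> t a; pose g (j : 'I_4) : {poly R} := (gen j (t, a))%:P + (j == lift ord0 i)%:R *: 'X.
have gE s j : (g j).[s] = gen j (t, a + s *: e i).
  rewrite /g hornerD hornerC hornerZ hornerX /param_gen.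
  case: unliftP => [k ->|->] /=; last by rewrite mul0r addr0.
  rewrite !mxE eqxx /= (inj_eq (@lift_inj _ ord0)) mulrC; congr (_ + _ * _%:R).
have g0 j : (g j).[0] = gen j (t, a) by rewrite gE scale0r addr0.
exists (mmap polyC g p); first by move=> s; rewrite horner_mmap Hp; apply: meval_eq => j.
have := coef_deriv (mmap polyC g p) 0; rewrite mulr1n => <-.
rewrite -horner_coef0 deriv_mmap horner_sum (bigD1 (lift ord0 i)) //= big1 ?addr0.
  rewrite hornerM horner_mmap (meval_eq _ g0) /g derivD derivC derivZ derivX eqxx.
  by rewrite add0r scale1r hornerC mulr1.
move=> j ji; rewrite hornerM /g derivD derivC derivZ derivX (negPf ji).
by rewrite add0r scale0r horner0 mulr0.
Qed.

Lemma positive_near0 f : poly_in gen f -> 0 < f (0, 0) ->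
  exists2 r : R, 0 < r & forall t (v : vec), `|t| < r -> (forall i, `|v 0 i| < r) ->
    0 < f (t, v).
Proof.
move=> Hf f0; have := @param_continuous _ f Hf (0, 0) [set y | 0 < y].
move=> /(_ (open_nbhs_nbhs (conj (@open_gt R 0) f0))) [[A B] /= [nA nB] AB].
move: nA nB => /nbhs_ballP[d /= d0 Hd] /nbhs_ballP[d' /= d'0 Hd'].
exists (Num.min d d'); first by rewrite lt_min d0.
move=> t v; rewrite lt_min => /andP[td _] vd; apply: (AB (t, v)); split=> /=.
  by apply: Hd; rewrite /ball /= sub0r normrN.
apply: Hd'; split=> // i j; rewrite /ball /= mxE sub0r normrN ord1.
by have := vd j; rewrite lt_min => /andP[].
Qed.

Lemma poly_in_det m (T : Type) (x : 'I_m -> T -> R) n (A : 'I_n -> 'I_n -> T -> R) :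
  (forall i j, poly_in x (A i j)) -> poly_in x (fun t => \det (\matrix_(i, j) A i j t)).
Proof.
move=> HA; apply: poly_in_sum => s _; apply: poly_inM; first exact: poly_in_cst.
apply: poly_in_prod => i _.
by apply: (poly_in_ext _ (HA i _)) => t; rewrite mxE.
Qed.

(** An existence part of the implicit function theorem. At t = 0 the sum of the
    squares of the equations vanishes at the isolated zero only, so for small t
    it has a minimum inside a small box. There the row of the G j is killed by
    the Jacobian matrix, which is still invertible, so the G j vanish. *)
Theorem implicit_zero (G : 'I_3 -> R * vec -> R) (M : 'M[R]_3) :
  (forall j, poly_in gen (G j)) ->
  (forall j i, exists2 P : {poly R}, (forall s, P.[s] = G j (0, s *: e i)) & P`_1 = M j i) ->
  M \in unitmx -> (forall j, G j (0, 0) = 0) ->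
  (exists2 r0 : R, 0 < r0 & forall v : vec, (forall i, `|v 0 i| <= r0) ->
     (forall j, G j (0, v) = 0) -> v = 0) ->
  forall r : R, 0 < r -> small (fun t => exists2 v : vec, (forall i, `|v 0 i| < r) &
     forall j, G j (t, v) = 0).
Proof.
move=> HG HM Mu G0 [r0 r0_gt0 Hr0] r r_gt0.
have HJ j i := cid2 (poly_in_deriv i (HG j)).
pose J j i := sval (HJ j i).
have Jpoly j i : poly_in gen (J j i) by rewrite /J; case: (HJ j i).
have JP j i t a : exists2 P : {poly R},
    (forall s, P.[s] = G j (t, a + s *: e i)) & P`_1 = J j i (t, a).
  by rewrite /J; case: (HJ j i).
pose D x := \det (\matrix_(j, i) J j i x).
have D0 : D (0, 0) = \det M.
  congr (\det _); apply/matrixP => j i; rewrite mxE.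
  have [P P1 <-] := JP j i 0 0; have [P' P1' <-] := HM j i.
  suff -> : P = P' by [].
  by apply: poly_eq_fun => s; rewrite P1 P1' add0r.
have Dpoly : poly_in gen (fun x => D x ^+ 2) by apply: poly_inX; exact: poly_in_det.
have [|r1 r1_gt0 Hr1] := positive_near0 Dpoly.
  by rewrite D0 exprn_even_gt0 //= -unitfE -unitmxE.
pose q := Num.min (r / 2) (Num.min r0 (r1 / 2)).
have q_gt0 : 0 < q by rewrite /q !lt_min r0_gt0 !divr_gt0.
have [qr [qr0 qr1]] : q < r /\ q <= r0 /\ q < r1.
  rewrite /q !gt_min !ge_min lexx !orbT; split; last split => //.
    by rewrite (_ : r / 2 < r) //; lra.
  by rewrite (_ : r1 / 2 < r1) ?orbT //; lra.
pose N x := \sum_j G j x ^+ 2.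
have Npoly : poly_in gen N by apply: poly_in_sum => j _; apply: poly_inX.
have N0 : N (0, 0) = 0 by rewrite /N big1 // => j _; rewrite G0 expr0n.
have := @interior_min R (fun=> - q) (fun=> q) N 0 Npoly.
have K0 : box (fun=> - q) (fun=> q) (0 : vec).
  by move=> i; rewrite mxE oppr_le0 ltW.
move=> /(_ K0) Hmin.
have Hb (a : vec) : box_boundary (fun=> - q) (fun=> q) a -> N (0, 0) < N (0, a).
  move=> [Ka [i Hi]]; rewrite N0 lt_neqAle sumr_ge0 ?andbT => [|j _]; last exact: sqr_ge0.
  apply/eqP => /esym/eqP; rewrite psumr_eq0 => [/allP Na|j _]; last exact: sqr_ge0.
  have a0 : a = 0.
    apply: Hr0 => [j|j]; first by rewrite (le_trans _ qr0) // ler_norml; exact: Ka.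
    by apply/eqP; rewrite -sqrf_eq0; apply: Na; rewrite mem_index_enum.
  by case: Hi; rewrite a0 mxE => Hi; move: q_gt0; clear -Hi; lra.
have sr1 : small (fun t => `|t| < r1) by exists r1.
apply: smallS (small_and sr1 (Hmin Hb)) => t [tr1 [v vK vmin]].
have vq i : `|v 0 i| < q by rewrite ltr_norml; exact: vK.
exists v => [i|]; first exact: lt_trans (vq i) qr.
have Du : (\matrix_(j, i) J j i (t, v)) \in unitmx.
  rewrite unitmxE unitfE; have := Hr1 t v tr1 (fun i => lt_trans (vq i) qr1).
  by rewrite exprn_even_gt0.
pose g := \row_j G j (t, v).
suff gJ : g *m (\matrix_(j, i) J j i (t, v)) = 0.
  have g0 : g = 0 by rewrite -[g](mulmxK Du) gJ mul0mx.
  by move=> j; have := congr1 (fun x : vec => x 0 j) g0; rewrite !mxE.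
apply/rowP => i; rewrite !mxE.
have HP j := cid2 (JP j i t v); pose P j := sval (HP j).
have PE j s : (P j).[s] = G j (t, v + s *: e i) by rewrite /P; case: (HP j).
have P1 j : (P j)`_1 = J j i (t, v) by rewrite /P; case: (HP j).
pose S := \sum_j P j ^+ 2.
have SE s : S.[s] = N (t, v + s *: e i).
  by rewrite /S horner_sum; apply: eq_bigr => j _; rewrite horner_exp PE.
have S1 : S`_1 = 2 * \sum_j G j (t, v) * J j i (t, v).
  rewrite coef_sum mulr_sumr; apply: eq_bigr => j _.
  rewrite expr2 coefM !big_ord_recl big_ord0 /= addr0 -P1 -horner_coef0 PE.
  by rewrite scale0r addr0; ring.
have /eqP : S`_1 = 0.
  pose d := Num.min (q - v 0 i) (v 0 i + q).
  have /andP[v1 v2] := vK i.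
  apply: (@poly_local_min _ S d); first by rewrite /d lt_min; apply/andP; split; lra.
  move=> s; rewrite /d lt_min !ltr_norml => /andP[/andP[s1 s2] /andP[s3 s4]].
  rewrite !SE scale0r addr0; apply: vmin => j; rewrite !mxE eqxx /=.
  have [->|ji] := eqVneq j i; first by rewrite mulr1; apply/andP; split; lra.
  by rewrite mulr0 addr0; have /andP[w1 w2] := vK j; rewrite !ltW.
rewrite S1 mulf_eq0 pnatr_eq0 /= => /eqP gJ0.
by rewrite -[RHS]gJ0; apply: eq_bigr => j _; rewrite !mxE.
Qed.

End ImplicitFunction.

(** * Real cubics and the sextic of an inner product *)

Lemma ord3_enum (i j k : 'I_3) : i != j -> j != k -> i != k ->
  forall x : 'I_3, [|| x == i, x == j | x == k].
Proof.
rewrite -!val_eqE /= => ij jk ik x; rewrite -!val_eqE /=.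
by have := ltn_ord i; have := ltn_ord j; have := ltn_ord k; have := ltn_ord x; lia.
Qed.

Lemma big_ord3 (K : nmodType) (F : 'I_3 -> K) (i j k : 'I_3) :
  i != j -> j != k -> i != k -> \sum_x F x = F i + F j + F k.
Proof.
move=> ij jk ik; rewrite (bigD1 i) // (bigD1 j) 1?eq_sym //= (bigD1 k) /=; last first.
  by rewrite eq_sym ik eq_sym jk.
rewrite big_pred0 ?addr0 ?addrA // => x.
by have := ord3_enum ij jk ik x; case: eqP; case: eqP; case: eqP.
Qed.

(** The tensor of 6 x y z: its entries with distinct indices are 1. *)
Definition xyz_tens (K : comNzRingType) (t : 'I_10) : K :=
  (t == tens_index (inord 0) (inord 1) (inord 2))%:R.

Lemma tens_xyz (K : comNzRingType) i j k :
  tens (xyz_tens K) i j k = ([&& i != j, j != k & i != k])%:R.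
Proof.
rewrite /tens /xyz_tens; congr (nat_of_bool _)%:R; rewrite /tens_index -!val_eqE.
by elim/ord3_ind: i; elim/ord3_ind: j; elim/ord3_ind: k;
    rewrite /= !inordK //= !inordK.
Qed.

Lemma tcontr_xyz (K : comNzRingType) i j k (a : 'rV[K]_3) :
  i != j -> j != k -> i != k -> tcontr (xyz_tens K) k a = 2 * (a 0 i * a 0 j).
Proof.
move=> ij jk ik; rewrite /tcontr (big_ord3 _ ij jk ik) !(big_ord3 _ ij jk ik).
rewrite !tens_xyz !eqxx ij jk ik ![j == i]eq_sym ij ![k == _]eq_sym jk ik /=.
ring.
Qed.

Definition cubic_form (K : comNzRingType) (c : 'I_10 -> K) (a : 'rV[K]_3) : K :=
  \sum_k a 0 k * tcontr c k a.

Lemma cubic_form_xyz (K : comNzRingType) (a : 'rV[K]_3) :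
  cubic_form (xyz_tens K) a = 6 * (a 0 (inord 0) * a 0 (inord 1) * a 0 (inord 2)).
Proof.
have n01 : (inord 0 : 'I_3) != inord 1 by rewrite -val_eqE /= !inordK.
have n12 : (inord 1 : 'I_3) != inord 2 by rewrite -val_eqE /= !inordK.
have n02 : (inord 0 : 'I_3) != inord 2 by rewrite -val_eqE /= !inordK.
rewrite /cubic_form (big_ord3 _ n01 n12 n02) (tcontr_xyz _ n01 n12 n02).
rewrite (@tcontr_xyz _ (inord 1) (inord 2) (inord 0)) ?(eq_sym _ (inord 0 : 'I_3)) //.
rewrite (@tcontr_xyz _ (inord 0) (inord 2) (inord 1)) ?(eq_sym _ (inord 1 : 'I_3)) //; last by rewrite eq_sym.
ring.
Qed.

Section RealQuintics.
Variables (R : realType) (Q : inner_product (Sym R 3 2)).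
Local Notation vec := 'rV[R]_3.
Local Notation gen := (@param_gen R).
Local Notation e := (base_vec R).
Implicit Types (a b : vec).

Definition sextic a : R := Q (power 3 a) (power 3 a).
(** A sixth of the k-th partial derivative of the sextic. *)
Definition quintic k a : R := Q (power 3 a) (mul3 a a (e k)).

Lemma sextic_gt0 a : a != 0 -> 0 < sextic a.
Proof.
move=> a0; apply: inner_gt0; apply: contra_neq a0 => /(congr1 val) /= /eqP.
by rewrite expf_eq0 => /eqP; exact: linform_eq0.
Qed.

Lemma inner_Zr u (t : R) v : Q u (t *: v) = t * Q u v.
Proof. exact: linearZ. Qed.

Lemma inner_Zl u (t : R) v : Q (t *: v) u = t * Q v u.
Proof. by rewrite inner_sym inner_Zr inner_sym. Qed.

Lemma sexticZ (t : R) a : sextic (t *: a) = t ^+ 6 * sextic a.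
Proof.
by rewrite /sextic power3Z inner_Zr inner_Zl; ring.
Qed.

Lemma quinticZ k (t : R) a : quintic k (t *: a) = t ^+ 5 * quintic k a.
Proof.
rewrite /quintic power3Z mul3Zl mul3Zm scalerA inner_Zr inner_Zl; ring.
Qed.

(** Euler's identity for the sextic. *)
Lemma sextic_euler a : sextic a = \sum_k a 0 k * quintic k a.
Proof.
transitivity (Q (power 3 a) (mul3 a a (\sum_k a 0 k *: e k))).
  by rewrite -vec_sum /sextic {2}power3E.
rewrite linear_sum linear_sum.
by apply: eq_bigr => k _ /=; rewrite mul3Zr inner_Zr.
Qed.

Lemma poly_in_inner (T : Type) n (x : 'I_n -> T -> R) (a b c a' b' c' : T -> vec) :
  (forall i, poly_in x (fun t => a t 0 i)) -> (forall i, poly_in x (fun t => b t 0 i)) ->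
  (forall i, poly_in x (fun t => c t 0 i)) -> (forall i, poly_in x (fun t => a' t 0 i)) ->
  (forall i, poly_in x (fun t => b' t 0 i)) -> (forall i, poly_in x (fun t => c' t 0 i)) ->
  poly_in x (fun t => Q (mul3 (a t) (b t) (c t)) (mul3 (a' t) (b' t) (c' t))).
Proof.
move=> Ha Hb Hc Ha' Hb' Hc'.
apply: poly_in_ext (fun t => esym (inner_sum6 Q _ _ _ _ _ _)) _.
do 6![apply: poly_in_sum => ? _].
apply: poly_inM; [|apply: poly_inM; [|exact: poly_in_cst]];
  by apply: poly_inM; [apply: poly_inM|].
Qed.

Lemma poly_in_sextic (T : Type) n (x : 'I_n -> T -> R) (a : T -> vec) :
  (forall i, poly_in x (fun t => a t 0 i)) -> poly_in x (fun t => sextic (a t)).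
Proof.
move=> Ha; apply: (@poly_in_ext _ _ _ _ (fun t => Q (mul3 (a t) (a t) (a t)) (mul3 (a t) (a t) (a t)))).
  by move=> t; rewrite /sextic power3E.
exact: poly_in_inner.
Qed.

Lemma poly_in_quintic k (T : Type) n (x : 'I_n -> T -> R) (a : T -> vec) :
  (forall i, poly_in x (fun t => a t 0 i)) -> poly_in x (fun t => quintic k (a t)).
Proof.
move=> Ha; apply: (@poly_in_ext _ _ _ _ (fun t => Q (mul3 (a t) (a t) (a t)) (mul3 (a t) (a t) (e k)))).
  by move=> t; rewrite /quintic power3E.
by apply: poly_in_inner => // i; exact: poly_in_cst.
Qed.

Lemma poly_in_tcontr k (T : Type) n (x : 'I_n -> T -> R) (c : T -> 'I_10 -> R) (a : T -> vec) :
  (forall i, poly_in x (fun t => c t i)) -> (forall i, poly_in x (fun t => a t 0 i)) ->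
  poly_in x (fun t => tcontr (c t) k (a t)).
Proof.
move=> Hc Ha; apply: poly_in_sum => i _; apply: poly_in_sum => j _.
by apply: poly_inM; [exact: Hc | exact: poly_inM].
Qed.

(** The coefficients come from expanding both cubes by power3_shift. *)
Lemma sextic_shift k a : exists2 P : {poly R},
  (forall s, P.[s] = sextic (a + s *: e k)) & P`_1 = 6 * quintic k a.
Proof.
pose A := power 3 a; pose B := mul3 a a (e k); pose D := mul3 a (e k) (e k).
pose E : Sym R 3 2 := power 3 (e k).
exists (Poly [:: Q A A; 6 * Q A B; 9 * Q B B + 6 * Q A D; 2 * Q A E + 18 * Q B D;
  6 * Q B E + 9 * Q D D; 6 * Q D E; Q E E]); last by rewrite coef_Poly.
move=> s; rewrite horner_Poly /= /sextic power3_shift -/A -/B -/D -/E.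
set X := A + _ + _ + _.
have XE Y : Q X Y = Q A Y + 3 * s * Q B Y + 3 * s ^+ 2 * Q D Y + s ^+ 3 * Q E Y.
  by rewrite inner_sym !linearD !linearZ /= !(inner_sym Q Y).
rewrite XE !(inner_sym Q _ X) !XE (inner_sym Q B A) (inner_sym Q D A) (inner_sym Q D B).
rewrite (inner_sym Q E A) (inner_sym Q E B) (inner_sym Q E D); ring.
Qed.

(** Each of the three arguments of the symmetric tensor contributes once. *)
Lemma cubic_form_shift (c : 'I_10 -> R) k a : exists2 P : {poly R},
  (forall s, P.[s] = cubic_form c (a + s *: e k)) & P`_1 = 3 * tcontr c k a.
Proof.
pose g i : {poly R} := (a 0 i)%:P + (i == k)%:R *: 'X.
have gE s i : (g i).[s] = (a + s *: e k) 0 i.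
  by rewrite /g !hornerE !mxE eqxx /= mulrC.
have g1 i : (g i)^`() = (i == k)%:R%:P.
  by rewrite /g derivD derivC derivZ derivX add0r -mul_polyC mulr1.
have g0 i : (g i).[0] = a 0 i by rewrite gE scale0r addr0.
exists (\sum_l g l * \sum_i \sum_j (tens c i j l)%:P * (g i * g j)).
  move=> s; rewrite horner_sum; apply: eq_bigr => l _; rewrite hornerM gE; congr (_ * _).
  rewrite horner_sum; apply: eq_bigr => i _; rewrite horner_sum; apply: eq_bigr => j _.
  by rewrite !hornerM hornerC !gE.
rewrite -[LHS](coef_deriv _ 0) -horner_coef0 (raddf_sum (@deriv R)) /= horner_sum.
under eq_bigr do rewrite derivM hornerD !hornerM g1 hornerC g0.
rewrite big_split /=.
have -> : \sum_i (i == k)%:R * (\sum_i0 \sum_j (tens c i0 j i)%:P * (g i0 * g j)).[0] = tcontr c k a.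
  rewrite (bigD1 k) //= eqxx mul1r [X in _ + X]big1 ?addr0 => [|i ik]; last by rewrite (negPf ik) mul0r.
  rewrite horner_sum; apply: eq_bigr => i _; rewrite horner_sum; apply: eq_bigr => j _.
  by rewrite !hornerM hornerC !g0.
have -> : \sum_i a 0 i * (\sum_i0 \sum_j (tens c i0 j i)%:P * (g i0 * g j))^`().[0] =
   \sum_l \sum_i \sum_j tens c i j l * a 0 l * ((i == k)%:R * a 0 j)
   + \sum_l \sum_i \sum_j tens c i j l * a 0 l * (a 0 i * (j == k)%:R).
  rewrite -big_split; apply: eq_bigr => l _ /=; rewrite -big_split (raddf_sum (@deriv R)) /= horner_sum mulr_sumr.
  apply: eq_bigr => i _ /=; rewrite -big_split (raddf_sum (@deriv R)) /= horner_sum mulr_sumr.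
  apply: eq_bigr => j _ /=; rewrite derivM derivC mul0r add0r derivM !g1.
  by rewrite hornerM hornerC hornerD 2!hornerM !hornerC !g0; ring.
have -> : \sum_l \sum_i \sum_j tens c i j l * a 0 l * ((i == k)%:R * a 0 j) = tcontr c k a.
  rewrite /tcontr; apply: eq_bigr => l _; rewrite (bigD1 k) //= eqxx.
  rewrite [X in _ + X]big1 ?addr0 => [|i ik]; last first.
    by rewrite big1 // => j _; rewrite (negPf ik) mul0r mulr0.
  by apply: eq_bigr => j _; rewrite mul1r tensC12 tensC23 tensC12 -tensC23 mulrA.
have -> : \sum_l \sum_i \sum_j tens c i j l * a 0 l * (a 0 i * (j == k)%:R) = tcontr c k a.
  rewrite /tcontr; apply: eq_bigr => l _; apply: eq_bigr => i _.
  rewrite (bigD1 k) //= eqxx big1 ?addr0 => [|j jk]; last by rewrite (negPf jk) !mulr0.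
  by rewrite mulr1 tensC23 tensC12 -mulrA; congr (_ * _).
ring.
Qed.

End RealQuintics.

(** * Minima in the octants where x y z > 0 *)

Section RealSolutions.
Variables (R : realType) (Q : inner_product (Sym R 3 2)) (w : 'I_10 -> R).
Local Notation vec := 'rV[R]_3.
Local Notation gen := (@param_gen R).
Local Notation e := (base_vec R).
Local Notation sextic := (sextic Q).
Local Notation quintic := (quintic Q).
Implicit Types (a b : vec).

(** The cubic 6 x y z, moved in the direction w in order to leave a given
    hypersurface. *)
Definition pert (t : R) (i : 'I_10) : R := xyz_tens R i + t * w i.

Lemma poly_in_pert i : poly_in gen (fun x => pert x.1 i).
Proof.
apply: poly_inD; first exact: poly_in_cst.
by apply: poly_inM; [exact: poly_in_param | exact: poly_in_cst].
Qed.

Lemma pert0 : pert 0 = xyz_tens R.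
Proof. by apply/funext => i; rewrite /pert mul0r addr0. Qed.

(** The minimum of the sextic on the boundary of the cube serves as mu, by
    homogeneity. *)
Lemma sextic_coercive : exists2 mu : R, 0 < mu & forall a M, 0 < M ->
  (forall i, `|a 0 i| <= M) -> (exists i, `|a 0 i| = M) -> mu * M ^+ 6 <= sextic a.
Proof.
pose B := box_boundary (fun=> - 1) (fun=> 1 : R).
have cB : compact B by exact: box_boundary_compact.
have B0 : B !=set0.
  exists (\row_i 1 : vec); split; last by exists ord0; right; rewrite mxE.
  by move=> i; rewrite mxE lexx andbT (@le_trans _ _ 0) ?oppr_le0.
have cS : continuous sextic.
  apply: (@continuous_poly_in R _ 3 (fun i (a : vec) => a 0 i)).
    by move=> i; exact: coord_continuous.
  by apply: poly_in_sextic => i; exact: (poly_in_gen (fun i (a : vec) => a 0 i) i).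
have [m mB mmin] := derive.compact_EVT_min B0 cB (continuous_subspaceT cS).
exists (sextic m).
  apply: sextic_gt0; move: mB; rewrite inE => -[_ [i Hi]]; apply/eqP => m0.
  by case: Hi => /eqP; rewrite m0 mxE eq_sym ?oppr_eq0 oner_eq0.
move=> a M M0 aM [i Hi].
have Mn0 : M != 0 by rewrite gt_eqF.
have Ma : a = M *: (M^-1 *: a) by rewrite scalerA divff ?scale1r.
rewrite Ma sexticZ mulrC ler_pM2l ?exprn_gt0 //; apply: mmin; rewrite inE.
split.
  move=> j; rewrite mxE -ler_norml normrM gtr0_norm ?invr_gt0 // mulrC.
  by rewrite ler_pdivrMr // mul1r.
exists i; rewrite mxE; have [a0|a0] := lerP 0 (a 0 i); [right|left].
  by rewrite -Hi ger0_norm // mulVf // -(ger0_norm a0) Hi.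
by rewrite -Hi ltr0_norm // invrN mulNr mulVf // ltr0_neq0.
Qed.

Lemma ler_prod3 (x y z X Y Z : R) : 0 <= x -> 0 <= y -> 0 <= z ->
  x <= X -> y <= Y -> z <= Z -> x * y * z <= X * Y * Z.
Proof.
move=> x0 y0 z0 xX yY zZ; apply: ler_pM => //; first exact: mulr_ge0.
exact: ler_pM.
Qed.

Section Octant.
(* The positive coordinates of the octant; an even number of coordinates is
   negative, so that x y z > 0. *)
Variable sg : 'I_3 -> bool.
Hypothesis sg_even : (sg (inord 0) (+) sg (inord 1)) = ~~ sg (inord 2).
Let sgn i : R := if sg i then 1 else -1.
Let sgn2 i : sgn i * sgn i = 1.
Proof. by rewrite /sgn; case: sg; ring. Qed.
Let sgn_prod : sgn (inord 0) * sgn (inord 1) * sgn (inord 2) = 1.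
Proof.
by rewrite /sgn; move: sg_even; do 3![case: sg => //=]; move=> _; ring.
Qed.

(** The k-th partial derivative in a is six times the difference
    quintic k a - tcontr c k a of the two sides of the equations. *)
Let pot (x : R * vec) : R := sextic x.2 - 2 * cubic_form (pert x.1) x.2.

Let pot_poly : poly_in gen pot.
Proof.
apply: poly_inB; first by apply: poly_in_sextic => i; exact: poly_in_coord.
apply: poly_inM; first exact: poly_in_cst.
apply: poly_in_sum => k _; apply: poly_inM; first exact: poly_in_coord.
by apply: poly_in_tcontr => i; [exact: poly_in_pert | exact: poly_in_coord].
Qed.

Let pot0 a : pot (0, a) =
  sextic a - 12 * (sgn (inord 0) * a 0 (inord 0) * (sgn (inord 1) * a 0 (inord 1))
                   * (sgn (inord 2) * a 0 (inord 2))).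
Proof.
rewrite /pot /= pert0 cubic_form_xyz.
rewrite (_ : _ * _ * (sgn (inord 2) * _) = (sgn (inord 0) * sgn (inord 1) * sgn (inord 2)) *
   (a 0 (inord 0) * a 0 (inord 1) * a 0 (inord 2))); last by ring.
by rewrite sgn_prod; ring.
Qed.

(** At t = 0 the function pot is Q(a ^ 3, a ^ 3) - 12 x y z. It is negative at
    small vectors inside the octant, where the cubic beats the sextic; it is
    almost nonnegative near the walls and positive far out, where the sextic
    beats the cubic. So it has a minimum inside a box in the octant, still for
    small t. The bound r on the ratios of coordinates, which comes from the
    box, distinguishes these solutions from the saddles near the axes. *)
Theorem octant_solution : exists2 r : R, 0 < r &
  small (fun t => exists2 a, (forall k, tcontr (pert t) k a = quintic k a) &
    (forall i, 0 < (if sg i then 1 else -1) * a 0 i) /\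
    (forall i k, r * `|a 0 k| < `|a 0 i|)).
Proof.
have [mu mu0 Hmu] := sextic_coercive.
pose sv : vec := \row_i sgn i; pose m := sextic sv.
have m0 : 0 < m.
  apply: sextic_gt0; apply/eqP => /rowP/(_ ord0); rewrite !mxE /sgn.
  by case: sg => /eqP; rewrite ?oppr_eq0 oner_eq0.
(* With s * m <= 1 the value of pot at s * sv is s ^ 6 * m - 12 * s ^ 3, at most
   - H0. *)
pose s := 1 / (1 + m).
have s0 : 0 < s by rewrite divr_gt0 // addr_gt0.
have sm : s * (1 + m) = 1 by rewrite /s mul1r mulVf // gt_eqF // addr_gt0.
have s1 : s <= 1 by nra.
pose H0 := 11 * s ^+ 3.
have H0_gt0 : 0 < H0 by rewrite mulr_gt0 // exprn_gt0.
(* This M makes the sextic, at least mu * M ^ 6, exceed 12 * M ^ 3. *)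
pose M := 12 / mu + 1.
have M1 : 1 < M by rewrite ltrDr divr_gt0.
have M0 : 0 < M by apply: lt_trans M1.
have muM : 12 < mu * M.
  by rewrite /M mulrDr mulr1 mulrCA divff ?mulr1 ?ltrDl // gt_eqF.
(* This eta makes 12 * x y z at most 12 * eta * M ^ 2 <= H0 / 2 on the inner walls. *)
pose eta := Num.min (s / 2) (H0 / (24 * M ^+ 2)).
have M2 : 0 < 24 * M ^+ 2 by rewrite mulr_gt0 // exprn_gt0.
have eta0 : 0 < eta by rewrite /eta lt_min; apply/andP; split; exact: divr_gt0.
have [etas etaH] : eta <= s / 2 /\ eta <= H0 / (24 * M ^+ 2).
  by rewrite /eta !ge_min !lexx orbT.
rewrite ler_pdivlMr // in etaH.
pose l i := if sg i then eta else - M; pose r i := if sg i then M else - eta.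
have boxP a : box l r a -> forall i, eta <= sgn i * a 0 i <= M.
  move=> Ka i; have := Ka i; rewrite /l /r /sgn; case: sg; first by rewrite mul1r.
  by rewrite mulN1r lerNr andbC lerNl.
have absP a i : 0 < sgn i * a 0 i -> `|a 0 i| = sgn i * a 0 i.
  rewrite /sgn; case: sg; first by rewrite mul1r => /gtr0_norm.
  by rewrite mulN1r oppr_gt0 => /ltr0_norm.
pose p0 : vec := s *: sv.
have Kp0 : box l r p0.
  move=> i; rewrite !mxE /l /r /sgn; case: sg; apply/andP; split; lra.
have pot_p0 : pot (0, p0) <= - H0.
  rewrite pot0 /p0 sexticZ -/m !mxE.
  rewrite (_ : sgn (inord 0) * _ * _ * _ = s ^+ 3 * (sgn (inord 0) * sgn (inord 0)) *
    (sgn (inord 1) * sgn (inord 1)) * (sgn (inord 2) * sgn (inord 2))); last by ring.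
  rewrite !sgn2 !mulr1 /H0 (_ : s ^+ 6 * m = s ^+ 3 * (s ^+ 2 * (s * m))); last by ring.
  have : s ^+ 2 * (s * m) <= 1.
    have sm1 : s * m <= 1 by move: sm; rewrite mulrDr mulr1; lra.
    apply: mulr_ile1 => //; [exact: sqr_ge0 | by rewrite mulr_ge0 // ltW |].
    by rewrite exprn_ile1 // ltW.
  have : 0 < s ^+ 3 by rewrite exprn_gt0.
  nra.
have barrier a : box_boundary l r a -> pot (0, p0) < pot (0, a).
  move=> [Ka [i Hi]]; apply: (le_lt_trans pot_p0); rewrite pot0.
  have ya := boxP _ Ka.
  have y_gt0 j : 0 < sgn j * a 0 j by have /andP[h _] := ya j; exact: lt_le_trans h.
  have y_ge0 j := ltW (y_gt0 j).
  have yM j : sgn j * a 0 j <= M by have /andP[] := ya j.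
  have [yi|yi] : sgn i * a 0 i = eta \/ sgn i * a 0 i = M.
  - by case: Hi => ->; rewrite /l /r /sgn; case: sg; rewrite ?mul1r ?mulN1r ?opprK; auto.
  - have a_gt0 : 0 < sextic a.
      apply: sextic_gt0; apply/eqP => a0; move: (y_gt0 i).
      by rewrite a0 mxE mulr0 ltxx.
    have : sgn (inord 0) * a 0 (inord 0) * (sgn (inord 1) * a 0 (inord 1))
                   * (sgn (inord 2) * a 0 (inord 2)) <= eta * M ^+ 2.
      have P1 : eta * M * M = eta * M ^+ 2 by ring.
      have P2 : M * eta * M = eta * M ^+ 2 by ring.
      have P3 : M * M * eta = eta * M ^+ 2 by ring.
      by move: yi; elim/ord3_ind: i {Hi} => yi; [rewrite -P1|rewrite -P2|rewrite -P3];
        apply: ler_prod3 => //; rewrite yi.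
    by lra.
  have a_ge : mu * M ^+ 6 <= sextic a.
    apply: Hmu => // [j|]; first by rewrite absP.
    by exists i; rewrite absP.
  have : sgn (inord 0) * a 0 (inord 0) * (sgn (inord 1) * a 0 (inord 1))
                   * (sgn (inord 2) * a 0 (inord 2)) <= M * M * M.
    exact: ler_prod3.
  have -> : M * M * M = M ^+ 3 by ring.
  have M3 : 1 <= M ^+ 3 by rewrite exprn_ege1 // ltW.
  have : 12 * M ^+ 3 <= mu * M ^+ 6.
    rewrite (_ : mu * M ^+ 6 = (mu * M) * M ^+ 2 * M ^+ 3); last by ring.
    have : 1 <= M ^+ 2 by rewrite exprn_ege1 // ltW.
    have : 0 < M ^+ 3 by rewrite exprn_gt0.
    set A := M ^+ 3; set B := M ^+ 2; set D := mu * M in muM * => hA hB.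
    by apply: ler_wpM2r; [exact: ltW | nra].
  lra.
exists (eta / (2 * M)); first by rewrite divr_gt0 // mulr_gt0.
apply: smallS (interior_min pot_poly Kp0 barrier) => t [a aK amin].
have aK' : box l r a by move=> i; have /andP[h1 h2] := aK i; rewrite !ltW.
have y_gt0 j : 0 < sgn j * a 0 j.
  by have /andP[h _] := boxP _ aK' j; exact: lt_le_trans h.
exists a; last first.
  split=> [//|i k]; rewrite !absP //.
  have /andP[h1 _] := boxP _ aK' i; have /andP[_ h2] := boxP _ aK' k.
  apply: lt_le_trans h1; rewrite mulrAC ltr_pdivrMr ?mulr_gt0 //.
  by rewrite ltr_pM2l //; lra.
move=> k; have [P PE P1] := sextic_shift Q k a.
have [P' P'E P'1] := cubic_form_shift (pert t) k a.
pose S := P - 2 *: P'.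
have SE x : S.[x] = pot (t, a + x *: e k) by rewrite /S hornerD hornerN hornerZ PE P'E.
have : S`_1 = 0.
  pose d := Num.min (r k - a 0 k) (a 0 k - l k).
  have /andP[a1 a2] := aK k.
  apply: (@poly_local_min _ S d); first by rewrite /d lt_min !subr_gt0 a1 a2.
  move=> x; rewrite /d lt_min !ltr_norml => /andP[/andP[x1 x2] /andP[x3 x4]].
  rewrite !SE scale0r addr0; apply: amin => j; rewrite !mxE eqxx /=.
  have [->|jk] := eqVneq j k; first by rewrite mulr1; apply/andP; split; lra.
  by rewrite mulr0 addr0; exact: aK'.
rewrite coefB coefZ P1 P'1 => E; lra.
Qed.

End Octant.
End RealSolutions.

(** * Saddles near the axes, and seven real solutions *)

Section Saddles.
Variables (R : realType) (Q : inner_product (Sym R 3 2)) (w : 'I_10 -> R).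
Local Notation vec := 'rV[R]_3.
Local Notation gen := (@param_gen R).
Local Notation e := (base_vec R).
Local Notation sextic := (sextic Q).
Local Notation quintic := (quintic Q).
Local Notation pert := (pert w).
Implicit Types (a b : vec).

Lemma third_index (i k : 'I_3) : i != k -> exists2 l : 'I_3, i != l & l != k.
Proof.
elim/ord3_ind: i; elim/ord3_ind: k; rewrite -?val_eqE /= !inordK // => _.
all: first [ by exists (inord 0); rewrite -val_eqE /= !inordK
  | by exists (inord 1); rewrite -val_eqE /= !inordK
  | by exists (inord 2); rewrite -val_eqE /= !inordK].
Qed.

Lemma quintic_base k : quintic k (e k) = sextic (e k).
Proof.
rewrite sextic_euler (bigD1 k) //= mxE !eqxx mul1r big1 ?addr0 // => j jk.
by rewrite mxE (negPf jk) andbF mul0r.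
Qed.

Lemma base_neq0 k : e k != 0.
Proof.
by apply/eqP => /rowP/(_ k); rewrite !mxE !eqxx => /eqP; rewrite oner_eq0.
Qed.

Section OneSaddle.
Variable k : 'I_3.

(** The unknowns v are near 0: the affine coordinates of a direction near e_k,
    and in the k-th place the multiplier in the proportionality G = 0 of the
    gradients of the cubic and of the sextic. *)
Let dir (v : vec) : vec := \row_i if i == k then 1 else v 0 i.
Let G (j : 'I_3) (x : R * vec) : R :=
  tcontr (pert x.1) j (dir x.2) - x.2 0 k * quintic j (dir x.2).

Let dir_poly i : poly_in gen (fun x : R * vec => dir x.2 0 i).
Proof.
apply: (@poly_in_ext _ _ _ _ (fun x : R * vec => if i == k then 1 else x.2 0 i)).
  by move=> x; rewrite mxE.
by case: (i == k); [exact: poly_in_cst | exact: poly_in_coord].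
Qed.

Let G_poly j : poly_in gen (G j).
Proof.
apply: poly_inB; first by apply: poly_in_tcontr => i; [exact: poly_in_pert | exact: dir_poly].
by apply: poly_inM; [exact: poly_in_coord | exact: poly_in_quintic].
Qed.

Let dir0 : dir 0 = e k.
Proof.
by apply/rowP => i; rewrite !mxE eqxx /=; case: (i == k).
Qed.

(** The Jacobian of G at 0: the Hessian of x y z transversally to e_k, and in
    column k minus the gradient of the sextic, up to factors. *)
Let M : 'M[R]_3 := \matrix_(j, i) if i == k then - quintic j (e k)
  else 2 * ((j != i) && (j != k))%:R.

Let G_lin j i s : G j (0, s *: e i) = M j i * s.
Proof.
rewrite /G /= pert0; have [->|ik] := eqVneq i k.
  have -> : dir (s *: e k) = e k.
    rewrite -dir0; apply/rowP => x; rewrite !mxE.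
    by case: (x == k) => //=; rewrite ?andbF ?mulr0.
  have [x jx] : exists x, j != x.
    by have [->|jk] := eqVneq j ord0; [exists (inord 1); rewrite -val_eqE /= inordK | exists ord0].
  have [y xy yj] : exists2 y, x != y & y != j by apply: third_index; rewrite eq_sym.
  rewrite (tcontr_xyz (i := x) (j := y)) // 1?eq_sym // !mxE !eqxx /=.
  have -> : (x == k)%:R * (y == k)%:R = 0 :> R.
    by have [xk|] := eqVneq x k; rewrite ?mul0r // -xk eq_sym (negPf xy) mulr0.
  by rewrite mulr0 mulr1; ring.
have [l il lk] := third_index ik.
have dk : dir (s *: e i) 0 k = 1 by rewrite mxE eqxx.
have di : dir (s *: e i) 0 i = s by rewrite !mxE (negPf ik) !eqxx mulr1.
have dl : dir (s *: e i) 0 l = 0 by rewrite !mxE (negPf lk) eqxx eq_sym (negPf il) mulr0.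
have -> : (s *: e i) 0 k = 0 by rewrite !mxE eqxx eq_sym (negPf ik) mulr0.
rewrite mul0r subr0 [M j i]mxE (negPf ik).
have /or3P[/eqP->|/eqP->|/eqP->] := ord3_enum il lk ik j.
- rewrite eqxx /= (tcontr_xyz (i := l) (j := k)) // 1?eq_sym // dl.
  by rewrite mul0r !mulr0 mul0r.
- rewrite (eq_sym l i) il lk /= (tcontr_xyz (i := i) (j := k)) // 1?eq_sym // di dk; ring.
- by rewrite eqxx andbF (tcontr_xyz (i := i) (j := l)) // dl !mulr0 mul0r.
Qed.

Let M_unit : M \in unitmx.
Proof.
rewrite -row_free_unit -kermx_eq0; apply/rowV0P => u /sub_kermxP uM.
have [i ik] : exists i, i != k.
  by have [->|jk] := eqVneq k ord0; [exists (inord 1); rewrite -val_eqE /= inordK | exists ord0; rewrite eq_sym].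
have [l il lk] := third_index ik.
have E x : \sum_j u 0 j * M j x = 0 by have := congr1 (fun m : vec => m 0 x) uM; rewrite !mxE.
have ul : u 0 l = 0.
  have := E i; rewrite (big_ord3 _ il lk ik) !mxE (negPf ik) !eqxx (eq_sym l i) il lk andbF /=.
  by move=> H; lra.
have ui : u 0 i = 0.
  have := E l; rewrite (big_ord3 _ il lk ik) !mxE (negPf lk) !eqxx il ik andbF /=.
  by move=> H; lra.
have uk : u 0 k = 0.
  have := E k; rewrite (big_ord3 _ il lk ik) !mxE !eqxx ul ui !mul0r !add0r quintic_base.
  by move/eqP; rewrite mulf_eq0 oppr_eq0 (gt_eqF (sextic_gt0 Q (base_neq0 k))) orbF => /eqP.
by apply/rowP => x; rewrite mxE; have /or3P[/eqP->|/eqP->|/eqP->] := ord3_enum il lk ik x.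
Qed.

(** Eliminating between the equations i and k gives v_k * f = 0 with f > 0 near 0.
    So the multiplier v_k vanishes, and the equations i and l then give
    v_l = 0 and v_i = 0. *)
Let G_isolated : exists2 r0 : R, 0 < r0 & forall v : vec, (forall i, `|v 0 i| <= r0) ->
  (forall j, G j (0, v) = 0) -> v = 0.
Proof.
have [i ik] : exists i, i != k.
  by have [->|jk] := eqVneq k ord0; [exists (inord 1); rewrite -val_eqE /= inordK | exists ord0; rewrite eq_sym].
have [l il lk] := third_index ik.
pose f (x : R * vec) := quintic k (dir x.2) - x.2 0 i * quintic i (dir x.2).
have f_poly : poly_in gen f.
  apply: poly_inB; first exact: poly_in_quintic.
  by apply: poly_inM; [exact: poly_in_coord | exact: poly_in_quintic].
have [|r r0 Hr] := positive_near0 f_poly.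
  by rewrite /f /= dir0 mxE mul0r subr0 quintic_base sextic_gt0 // base_neq0.
exists (r / 2); first by rewrite divr_gt0.
move=> v vr Gv.
have fv : 0 < f (0, v).
  by apply: Hr => [|j]; rewrite ?normr0 // (le_lt_trans (vr j)) //; lra.
have dk : dir v 0 k = 1 by rewrite mxE eqxx.
have di : dir v 0 i = v 0 i by rewrite mxE (negPf ik).
have dl : dir v 0 l = v 0 l by rewrite mxE (negPf lk).
have Gi := Gv i; have Gl := Gv l; have Gk := Gv k.
rewrite /G /= pert0 (tcontr_xyz (i := l) (j := k)) // 1?eq_sym // dl dk in Gi.
rewrite /G /= pert0 (tcontr_xyz (i := i) (j := k)) // 1?eq_sym // di dk in Gl.
rewrite /G /= pert0 (tcontr_xyz (i := i) (j := l)) // di dl in Gk.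
have vk : v 0 k = 0.
  have /eqP : v 0 k * f (0, v) = 0.
    rewrite /f /=; move: Gi Gk.
    set A := quintic k _; set B := quintic i _; move=> Gi Gk.
    have -> : v 0 k * (A - v 0 i * B) =
       v 0 i * (2 * (v 0 l * 1) - v 0 k * B) - (2 * (v 0 i * v 0 l) - v 0 k * A) by ring.
    by rewrite Gi Gk mulr0 subrr.
  by rewrite mulf_eq0 (gt_eqF fv) orbF => /eqP.
rewrite vk mul0r subr0 in Gi; rewrite vk mul0r subr0 in Gl.
apply/rowP => x; rewrite mxE.
by have /or3P[/eqP->|/eqP->|/eqP->] := ord3_enum il lk ik x; lra.
Qed.

(** The gradient of x y z vanishes at e_k, a vertex of the triangle x y z = 0,
    where the gradients are thus proportional with multiplier 0. The Hessian is
    nondegenerate transversally, so this persists by implicit_zero. *)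
Theorem saddle_direction r : 0 < r -> small (fun t => exists2 d : vec,
  d 0 k = 1 /\ (forall i, i != k -> `|d 0 i| < r) &
  exists m, forall j, tcontr (pert t) j d = m * quintic j d).
Proof.
move=> r0; have := @implicit_zero R G M G_poly _ M_unit _ G_isolated r r0.
have H1 j i : exists2 P : {poly R}, (forall s, P.[s] = G j (0, s *: e i)) & P`_1 = M j i.
  exists (M j i *: 'X); last by rewrite coefZ coefX mulr1.
  by move=> s; rewrite hornerZ hornerX G_lin.
have H2 j : G j (0, 0) = 0 by have := G_lin j ord0 0; rewrite scale0r mulr0.
move=> /(_ H1 H2); apply: smallS => t [v vr Gv].
exists (dir v); first by split=> [|i ik]; rewrite mxE ?eqxx // (negPf ik).
by exists (v 0 k) => j; apply/eqP; rewrite -subr_eq0; apply/eqP; exact: Gv.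
Qed.

End OneSaddle.

Lemma cube_root (x : R) : exists y, y ^+ 3 = x.
Proof.
pose p : {poly R} := 'X^3 - x%:P; pose b := 1 + `|x|.
have b1 : 1 <= b by rewrite lerDl.
have bx : `|x| <= b ^+ 3.
  have : b <= b ^+ 3 by rewrite -{1}[b]expr1 ler_weXn2l.
  by apply: le_trans; rewrite lerDr.
have pb : p.[- b] <= 0 <= p.[b].
  rewrite !hornerE; move: bx; rewrite ler_norml => /andP[h1 h2].
  have -> : (- b) ^+ 3 = - b ^+ 3 by ring.
  by apply/andP; split; lra.
have bb : - b <= b by lra.
have [y _] := poly_ivt bb pb.
by rewrite rootE !hornerE subr_eq0 => /eqP <-; exists y.
Qed.

(** Four octant minima and three saddles. A saddle direction becomes a solution
    on multiplication by the real cube root of its multiplier, which is nonzero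
    because the cubic is smooth. Minima in different octants differ in sign,
    and saddles near different axes, or a saddle and a minimum, differ in the
    ratios of their coordinates. *)
Theorem seven_real_solutions : small (fun t =>
  (forall a, (forall k, tcontr (pert t) k a = 0) -> a = 0) ->
  exists2 f : option 'I_3 + 'I_3 -> vec, injective f &
    forall x, f x != 0 /\ forall k, tcontr (pert t) k (f x) = quintic k (f x)).
Proof.
(* None is the positive octant, Some j the one where only the j-th coordinate
   is positive. *)
pose sg (o : option 'I_3) i := if o is Some j then i == j else true.
have sg_even o : sg o (inord 0) (+) sg o (inord 1) = ~~ sg o (inord 2).
  by case: o => [j|//]; rewrite /sg -!val_eqE /= !inordK //; elim/ord3_ind: j; rewrite inordK.
pose pick_r o := cid2 (octant_solution Q w (sg_even o)).
pose ro o := sval (pick_r o).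
have ro0 o : 0 < ro o by rewrite /ro; case: (pick_r o).
have Ho o : small (fun t => exists2 a, (forall k, tcontr (pert t) k a = quintic k a) &
    (forall i, 0 < (if sg o i then 1 else -1) * a 0 i) /\
    (forall i k, ro o * `|a 0 k| < `|a 0 i|)) by rewrite /ro; case: (pick_r o).
pose r := \big[Num.min/1]_o ro o.
have r0 : 0 < r by rewrite /r; elim/big_ind: _ => // x y x0 y0; rewrite lt_min x0.
have rr o : r <= ro o by rewrite /r (bigD1 o) //= ge_min lexx.
have r1 : r <= 1.
  by rewrite /r; elim/big_rec: _ => // o x _ x1; rewrite ge_min x1 orbT.
have Hs := small_forall (fun k => saddle_direction k r0).
apply: smallS (small_and (small_forall Ho) Hs) => t [Hoct Hsad] smooth.
have octs o : {a : vec | (forall k, tcontr (pert t) k a = quintic k a) /\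
    (forall i, 0 < (if sg o i then 1 else -1) * a 0 i) /\
    (forall i k, r * `|a 0 k| < `|a 0 i|)}.
  apply: cid; have [a H1 [H2 H3]] := Hoct o; exists a; split=> //; split=> // i k.
  by apply: le_lt_trans (H3 i k); rewrite ler_wpM2r.
have sads k : {a : vec | (forall j, tcontr (pert t) j a = quintic j a) /\ a 0 k != 0 /\
    forall i, i != k -> `|a 0 i| < r * `|a 0 k|}.
  apply: cid; have [d [dk dr] [m Hm]] := Hsad k; have [y ym] := cube_root m.
  have y0 : y != 0.
    apply/eqP => y0; have : d = 0.
      by apply: smooth => j; rewrite Hm -ym y0 expr0n mul0r.
    by move/(congr1 (fun a : vec => a 0 k))/eqP; rewrite dk mxE oner_eq0.
  exists (y *: d); split; first by move=> j; rewrite tcontrZ quinticZ Hm -ym; ring.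
  rewrite !mxE dk mulr1; split=> // i ik; rewrite mxE normrM mulrC.
  by rewrite ltr_pM2r ?normr_gt0 // dr.
pose f (x : option 'I_3 + 'I_3) : vec :=
  match x with inl o => sval (octs o) | inr k => sval (sads k) end.
have octP o : let a := sval (octs o) in (forall i, 0 < (if sg o i then 1 else -1) * a 0 i) /\
    (forall i k, r * `|a 0 k| < `|a 0 i|) by case: (octs o) => a [].
have sadP k : let a := sval (sads k) in a 0 k != 0 /\
    forall i, i != k -> `|a 0 i| < r * `|a 0 k| by case: (sads k) => a [].
have other (k : 'I_3) : exists i, i != k.
  by have [->|jk] := eqVneq k ord0; [exists (inord 1); rewrite -val_eqE /= inordK | exists ord0; rewrite eq_sym].
have sg_eq o o' : sval (octs o) = sval (octs o') -> sg o =1 sg o'.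
  move=> E i; have [/(_ i) h _] := octP o; have [/(_ i) h' _] := octP o'.
  by move: h h'; rewrite E; case: (sg o i); case: (sg o' i) => //; lra.
have mixed o k : sval (octs o) <> sval (sads k).
  move=> E; have [i ik] := other k; have [_ /(_ i k) h] := octP o.
  have [_ /(_ i ik) h'] := sadP k; by move: h; rewrite E => /lt_trans/(_ h'); rewrite ltxx.
exists f; last first.
  case=> [o|k] /=.
    split; last by case: (octs o) => a [].
    apply/eqP => a0; have [/(_ ord0) h _] := octP o.
    by move: h; rewrite a0 mxE mulr0 ltxx.
  split; last by case: (sads k) => a [].
  apply/eqP => a0; have [h _] := sadP k.
  by move: h; rewrite [sval _]a0 mxE => /eqP.
move=> [o|k] [o'|k'] /= E.
- congr inl; have := sg_eq _ _ E; case: o o' {E} => [j|] [j'|] //= H.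
  + by have := H j; rewrite /= eqxx => /esym/eqP ->.
  + by have [i ij] := other j; have := H i; rewrite /= (negPf ij).
  + by have [i ij] := other j'; have := H i; rewrite /= (negPf ij).
- by case: (mixed _ _ E).
- by case: (mixed _ _ (esym E)).
- congr inr; apply/eqP; apply: contrapT => /negP kk'.
  have [_ h] := sadP k; have [_ h'] := sadP k'.
  have := h k'; rewrite eq_sym => /(_ kk'); rewrite E; have := h' k kk'.
  set x := `|_|; set y := `|_| => h1 h2.
  have x0 : 0 <= x by exact: normr_ge0.
  have y0 : 0 <= y by exact: normr_ge0.
  nra.
Qed.

End Saddles.

(** * The minimum is seven *)

Section LowerBound.
Variables (R : realType) (Q : inner_product (Sym R 3 2)).
Local Notation C := R[i].
Local Notation toC := (real_complex R).
Local Notation cplx := (@cplx R).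

Lemma tcontr_cplx (c : 'I_10 -> R) k a :
  tcontr (toC \o c) k (cplx a) = toC (tcontr c k a).
Proof.
rewrite /tcontr rmorph_sum; apply: eq_bigr => i _; rewrite rmorph_sum.
by apply: eq_bigr => j _ /=; rewrite !rmorphM /= !mxE.
Qed.

Lemma cplx_inj : injective cplx.
Proof. by move=> a b ab; apply: (map_mx_inj (f := toC)) => //; exact: complexI. Qed.

(** Over the reals x ^ 2 + x y + y ^ 2 = 0 forces x = y = 0, so a cube determines
    its root. *)
Lemma power3_cplx_inj : injective (fun a => power 3 (cplx a)).
Proof.
move=> a b /power3_eqP H; apply/rowP => i; have := H i i i.
rewrite !mxE -!rmorphM => /complexI E.
have : (a 0 i - b 0 i) * (a 0 i ^+ 2 + a 0 i * b 0 i + b 0 i ^+ 2) = 0.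
  by apply/eqP; rewrite -subr_eq0 -(subrr (a 0 i * a 0 i * a 0 i)) {2}E; apply/eqP; ring.
move/eqP; rewrite mulf_eq0 => /orP[|/eqP s0]; first by rewrite subr_eq0 => /eqP.
move: s0; set x := a 0 i; set y := b 0 i => s0.
have hx := sqr_ge0 x; have hy := sqr_ge0 y; have hxy := sqr_ge0 (x + y).
have sE : (x + y) ^+ 2 = 2 * (x ^+ 2 + x * y + y ^+ 2) - x ^+ 2 - y ^+ 2 by ring.
rewrite sE s0 in hxy.
have /eqP : x ^+ 2 = 0 by lra.
have /eqP : y ^+ 2 = 0 by lra.
by rewrite !sqrf_eq0 => /eqP -> /eqP ->.
Qed.

Lemma small_nonroot (P : {poly C}) (S : R -> Prop) : P != 0 -> small S ->
  exists2 t, P.[toC t] != 0 & S t.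
Proof.
move=> P0 [d d0 Hd]; apply: contrapT => H.
pose t (n : nat) : R := d / n.+2%:R.
have t_inj : injective t.
  move=> m n /(mulfI (lt0r_neq0 d0)) /invr_inj /eqP.
  by rewrite eqr_nat => /eqP [].
have td n : `|t n| < d.
  rewrite ger0_norm ?divr_ge0 ?ltW // ltr_pdivrMr ?ltr0n //.
  by rewrite ltr_pMr // ltr1n.
pose s := [seq toC (t n) | n <- iota 0 (size P)].
have us : uniq s by rewrite map_inj_uniq ?iota_uniq // => m n /complexI/t_inj.
have : all (root P) s.
  apply/allP => _ /mapP[n _ ->]; apply: contrapT => /negP Pn; apply: H.
  by exists (t n) => //; exact: Hd.
by move/(max_poly_roots P0)/(_ us); rewrite size_map size_iota ltnn.
Qed.

(** If fewer than seven solutions were generic, this and smoothness would hold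
    off some hypersurface g = 0. Choose the direction w so that the line from
    6 x y z along w leaves it; then g has nonroots at arbitrarily small real t
    on this line, where there are seven real solutions. *)
Theorem at_least_seven : ~ generic (fun c => ~ atleast (dquad Q) 7 c).
Proof.
move=> /(generic_and (generic_smooth C)) [g g0 Hg].
have [v gv] := mpoly_neq0_nat g0.
pose w i : R := (v i)%:R - xyz_tens R i.
pose G i : {poly C} := (toC (xyz_tens R i))%:P + toC (w i) *: 'X.
pose P := mmap polyC G g.
have PE t : P.[toC t] = g.@[toC \o pert w t].
  rewrite horner_mmap; apply: meval_eq => i.
  rewrite /G hornerD hornerC hornerZ hornerX /= /pert.
  by rewrite -rmorphM -rmorphD [w i * t]mulrC.
have P0 : P != 0.
  apply: contra_neq gv => P0; have := PE 1; rewrite P0 horner0 => ->.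
  apply: meval_eq => i; rewrite /= /pert mul1r /w addrC subrK.
  by rewrite rmorph_nat.
have [t] := small_nonroot P0 (seven_real_solutions Q w).
rewrite PE => /Hg[c_smooth]; apply: contra_not => Hf.
have [|f f_inj fP] := Hf.
  move=> a Ha; apply: cplx_inj; rewrite [cplx 0](raddf0 (map_mx toC)).
  by apply: c_smooth => k; rewrite tcontr_cplx Ha rmorph0.
have c7 : #|{: option 'I_3 + 'I_3}| = 7%N by rewrite card_sum card_option !card_ord.
exists (fun i : 'I_7 => cplx (f (enum_val (cast_ord (esym c7) i)))).
split=> [i|]; last first.
  by move=> i j /power3_cplx_inj/f_inj/enum_val_inj/cast_ord_inj.
have [a0 Ha] := fP (enum_val (cast_ord (esym c7) i)).
split; last by move=> k; rewrite tcontr_cplx Ha dquad_real.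
by apply: contra_neq a0 => E; apply: cplx_inj; rewrite E [cplx 0](raddf0 (map_mx toC)).
Qed.

Theorem EDdegree_exists : exists2 k, generic (fun c => atleast (dquad Q) k c) &
  EDdegree (complexify Q) (veronese C 3 2) = k /\ (7 <= k)%N.
Proof.
have [k Hk] := exact_count (dquad_poly Q) (dquad_homog Q).
exists k; first by apply: genericS Hk => c [].
split; first exact/EDdegreeE/has_EDdegree_count.
rewrite leqNgt; apply/negP => k7; apply: at_least_seven.
by apply: genericS Hk => c [_ nk] /(atleastS k7).
Qed.

End LowerBound.

Theorem EDdegree_frobenius (R : realType) (Q : inner_product (Sym R 3 2)) :
  Frobenius Q -> EDdegree (complexify Q) (veronese R[i] 3 2) = 7%N.
Proof.
move=> [Q1 HQ1]; have [k Hk [-> k7]] := EDdegree_exists Q.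
apply/eqP; rewrite eqn_leq k7 andbT leqNgt; apply/negP => k8.
apply: generic_contra (frobenius_at_most_seven HQ1).
by apply: genericS Hk => c; exact: atleastS.
Qed.

Theorem corollary5p15 (R : realType) (QF : inner_product (Sym R 3 2))
    (hQF : Frobenius QF) :
  is_min [set EDdegree (complexify Q) (veronese R[i] 3 2)
         | Q in [set: inner_product (Sym R 3 2)]]
    (EDdegree (complexify QF) (veronese R[i] 3 2)) /\
  EDdegree (complexify QF) (veronese R[i] 3 2) = 7%N.
Proof.
rewrite (EDdegree_frobenius hQF); split=> //; split.
  by exists QF => //; exact: EDdegree_frobenius.
by move=> _ [Q _ <-]; have [k _ [-> k7]] := EDdegree_exists Q.
Qed.
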